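(* Let $F_1,F_2$ be two square-integrable graph root distributions on $\mathcal K$, each with uncorrelated positive and negative components. Then $F_1$ and $F_2$ give the same exchangeable random graph sampling distribution if and only if $F_1\stackrel{o.t.}{=}F_2$, i.e. if and only if there exist orthogonal transforms $Q_+$ on $\mathcal H_+$ and $Q_-$ on $\mathcal H_-$ such that $(X,Y)\sim F_1\Leftrightarrow(Q_+X,Q_-Y)\sim F_2$.
   Context: Krein space: $\mathcal H_+=\mathcal H_-=\{x\in\mathbb R^\infty:\sum_j x_j^2<\infty\}$ with the usual inner product, and $\mathcal K=\mathcal H_+\ominus\mathcal H_-$ is the set of pairs $(x,y)$, $x\in\mathcal H_+$, $y\in\mathcal H_-$, with indefinite inner product $\langle(x,y),(x',y')\rangle_{\mathcal K}=\langle x,x'\rangle_{\mathcal H_+}-\langle y,y'\rangle_{\mathcal H_-}$, norm $\|(x,y)\|=(\|x\|^2+\|y\|^2)^{1/2}$, and the Borel $\sigma$-field of this norm. For a random vector $Z=(X,Y)$ in $\mathcal K$, $X$ is the positive component and $Y$ the negative component. Graph root distribution (GRD): a Borel probability measure $F$ on $\mathcal K$ such that $\mathbb P(\langle Z_1,Z_2\rangle_{\mathcal K}\in[0,1])=1$ for independent $Z_1,Z_2\sim F$. It is square-integrable if $\mathbb E_{Z\sim F}\|Z\|^2<\infty$. It has uncorrelated positive and negative components if $\mathbb E_{(X,Y)\sim F}(X_jY_{j'})=0$ for all $j,j'\ge1$ (uncentered second moments). Exchangeable random graph sampling distribution of $F$: the law of the array $(A_{ij})_{i,j\ge1}$ obtained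 by drawing $(Z_i)_{i\ge1}$ iid from $F$ and, given these, drawing $A_{ij}$, $i<j$, independently from Bernoulli distributions with parameter $\langle Z_i,Z_j\rangle_{\mathcal K}$, with $A_{ji}=A_{ij}$ and $A_{ii}=0$.
   Formalization: ''Only if'' fails for orthogonal Q± on all of H± (X=e_j vs X=e_{j+1} with prob. 2^-j, Y=0); proved instead with Q± orthogonal between closed subspaces carrying X, Y, and as printed when the orthogonal complements of the supports' spans have equal dimension for F1 and F2. *)

(* Defs.v *)
From HB Require Import structures.
From mathcomp Require Import all_boot all_order all_algebra.
From mathcomp Require Import all_classical all_reals all_analysis.
From mathcomp Require Import ring lra.

Set Implicit Arguments.
Unset Strict Implicit.
Unset Printing Implicit Defensive.

Import Order.TTheory GRing.Theory Num.Theory.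
Import numFieldNormedType.Exports.

Local Open Scope classical_set_scope.
Local Open Scope ring_scope.

(* A positive definite symmetric bilinear form satisfies the triangle
   inequality; used below for both the norm of l^2 and the norm of K. *)
Section form_norm.
Variables (R : realType) (V : lmodType R) (f : V -> V -> R).
Hypothesis fC : forall x y, f x y = f y x.
Hypothesis fP : forall a x y z, f (a *: x + y) z = a * f x z + f y z.
Hypothesis f_ge0 : forall x, 0 <= f x x.
Hypothesis f_eq0 : forall x, f x x = 0 -> x = 0.

Let fPr a x y z : f z (a *: x + y) = a * f z x + f z y.
Proof. by rewrite fC fP !(fC z). Qed.

Let f0l z : f 0 z = 0.
Proof. by have := fP 1 0 0 z; rewrite scaler0 addr0; lra. Qed.

Let fZl a x z : f (a *: x) z = a * f x z.
Proof. by rewrite -[a *: x]addr0 fP f0l addr0. Qed.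

Let fDl x y z : f (x + y) z = f x z + f y z.
Proof. by rewrite -[x in x + y]scale1r fP mul1r. Qed.

Let cauchy_schwarz x y : f x y ^+ 2 <= f x x * f y y.
Proof.
have [/f_eq0 -> |y0] := eqVneq (f y y) 0.
  by rewrite fC !f0l; lra.
have yp : 0 < f y y by rewrite lt_neqAle eq_sym y0 f_ge0.
have := f_ge0 (f y y *: x + (- f x y) *: y).
rewrite fP fZl !(fC _ (_ + _)) !fP !fZl !(fC y x) => h.
have : 0 <= f y y * (f x x * f y y - f x y ^+ 2) by nra.
by rewrite pmulr_rge0// subr_ge0.
Qed.

Lemma form_normD x y :
  Num.sqrt (f (x + y) (x + y)) <= Num.sqrt (f x x) + Num.sqrt (f y y).
Proof.
rewrite -(@ler_pXn2r _ 2)// ?nnegrE ?sqrtr_ge0 ?addr_ge0 ?sqrtr_ge0//.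
rewrite sqrrD !sqr_sqrtr// -sqrtrM//.
have -> : f (x + y) (x + y) = f x x + f x y *+ 2 + f y y.
  by rewrite fDl !(fC _ (x + y)) !fDl (fC y x); ring.
rewrite lerD2r lerD2l lerMn2r/=.
apply: (le_trans (ler_norm _)).
by rewrite -sqrtr_sqr ler_sqrt ?mulr_ge0.
Qed.

Lemma form_normZ a x : Num.sqrt (f (a *: x) (a *: x)) = `|a| * Num.sqrt (f x x).
Proof.
by rewrite fZl fC fZl mulrA -expr2 sqrtrM ?sqr_ge0// sqrtr_sqr.
Qed.

Lemma form_norm_eq0 x : Num.sqrt (f x x) = 0 -> x = 0.
Proof.
by move/eqP; rewrite sqrtr_eq0 => h; apply/f_eq0/eqP; rewrite eq_le h f_ge0.
Qed.

End form_norm.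

(* The Hilbert space l^2 of real square-summable sequences. *)
Section ell2.
Variable R : realType.

Definition square_summable : {pred (nat -> R)} :=
  fun x => `[< cvgn (series (fun j => x j ^+ 2)) >].

Record ell2 := Ell2 {
  ell2_seq :> nat -> R;
  ell2_prop : ell2_seq \in square_summable }.

HB.instance Definition _ := [isSub for ell2_seq].
HB.instance Definition _ := [Choice of ell2 by <:].

Let sqsumP (x : nat -> R) :
  reflect (cvgn (series (fun j => x j ^+ 2))) (x \in square_summable).
Proof. exact: asboolP. Qed.

Let bound_ge0 (a u v : R) : 0 <= 2 * a ^+ 2 * u ^+ 2 + 2 * v ^+ 2.
Proof.
have := mulr_ge0 (sqr_ge0 a) (sqr_ge0 u); have := sqr_ge0 v.
by rewrite -!mulrA; lra.
Qed.

Let bound_le (a u v : R) :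
  (a * u + v) ^+ 2 <= 2 * a ^+ 2 * u ^+ 2 + 2 * v ^+ 2.
Proof. by have := sqr_ge0 (a * u - v); nra. Qed.

Lemma square_summable_submod : submod_closed square_summable.
Proof.
split.
  apply/sqsumP; rewrite (_ : series _ = cst 0); first exact: is_cvg_cst.
  apply/funext => n; rewrite /series/= big1// => i _.
  by rewrite [(0 : nat -> R) i]/(0 : R) expr0n.
move=> a x y /sqsumP cx /sqsumP cy; apply/sqsumP.
have cz : cvgn (series (2 * a ^+ 2 *: (fun j => x j ^+ 2) +
    2 *: (fun j => y j ^+ 2) : nat -> R)).
  apply: is_cvg_seriesD.
    exact: is_cvg_seriesZ cx.
  exact: is_cvg_seriesZ cy.
by apply: series_le_cvg cz => n; [exact: sqr_ge0|exact: bound_ge0|exact: bound_le].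
Qed.

HB.instance Definition _ := GRing.isSubmodClosed.Build R (nat -> R)
  square_summable square_summable_submod.
HB.instance Definition _ := GRing.SubChoice_isSubLmodule.Build R (nat -> R)
  square_summable ell2 (GRing.subsemimodClosedP _).

Definition dot (x y : ell2) : R := limn (series (fun j => x j * y j)).

Let prod_le (u v : R) : `|u * v| <= u ^+ 2 + v ^+ 2.
Proof.
rewrite ler_norml; apply/andP; split.
  by have := sqr_ge0 (u + v); nra.
by have := sqr_ge0 (u - v); nra.
Qed.

Lemma is_cvg_dot (x y : ell2) : cvgn (series (fun j => x j * y j)).
Proof.
apply: normed_cvg.
have /sqsumP cx := ell2_prop x; have /sqsumP cy := ell2_prop y.
have cz : cvgn (series ((fun j => x j ^+ 2) + (fun j => y j ^+ 2) : nat -> R)).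
  exact: is_cvg_seriesD.
apply: series_le_cvg cz => n; [exact: normr_ge0| |exact: prod_le].
exact: addr_ge0 (sqr_ge0 _) (sqr_ge0 _).
Qed.

Lemma dotC x y : dot x y = dot y x.
Proof. by congr (limn (series _)); apply/funext => j; rewrite mulrC. Qed.

Lemma dotP a x y z : dot (a *: x + y) z = a * dot x z + dot y z.
Proof.
rewrite /dot (_ : (fun j => _) =
    a *: (fun j => x j * z j) + (fun j => y j * z j) :> (nat -> R)); last first.
  apply/funext => j.
  suff h (u v w : R) : (a * u + v) * w = a * (u * w) + v * w by exact: h.
  by ring.
have cx := @is_cvg_dot x z; have cy := @is_cvg_dot y z.
have cax : cvgn (series (a *: (fun j => x j * z j) : nat -> R)).
  exact: is_cvg_seriesZ cx.
by rewrite (lim_seriesD cax cy); congr (_ + _); exact: lim_seriesZ.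
Qed.

Let dot_term_ge (x : ell2) j : x j ^+ 2 <= dot x x.
Proof.
have h : series (fun j => x j * x j) j.+1 <= dot x x.
  apply: nondecreasing_cvgn_le (@is_cvg_dot x x) _.
  by apply/nondecreasing_series => i _ _; rewrite -expr2 sqr_ge0.
apply: le_trans h; rewrite /series/= big_nat_recr//= expr2 lerDr.
by apply: sumr_ge0 => i _; rewrite -expr2 sqr_ge0.
Qed.

Lemma dot_ge0 x : 0 <= dot x x.
Proof. exact: le_trans (sqr_ge0 (x 0)) (dot_term_ge x 0). Qed.

Lemma dot_eq0 x : dot x x = 0 -> x = 0.
Proof.
move=> x0; apply: val_inj; apply/funext => j; suff : x j = 0 by [].
apply/eqP; rewrite -[_ == _]sqrf_eq0 eq_le sqr_ge0 andbT -x0.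
exact: dot_term_ge.
Qed.

HB.instance Definition _ := @Lmodule_isNormed.Build R ell2
  (fun x => Num.sqrt (dot x x))
  (form_normD dotC dotP dot_ge0 dot_eq0)
  (form_normZ dotC dotP)
  (form_norm_eq0 dot_ge0 dot_eq0).

End ell2.

Section krein.
Variable R : realType.

Definition krein := (ell2 R * ell2 R)%type.

HB.instance Definition _ := GRing.Lmodule.copy krein (ell2 R * ell2 R)%type.

(* The positive definite form inducing the norm of K. *)
Definition majorant (z z' : krein) : R := dot z.1 z'.1 + dot z.2 z'.2.

Definition kdot (z z' : krein) : R := dot z.1 z'.1 - dot z.2 z'.2.

Let majorantC z z' : majorant z z' = majorant z' z.
Proof. by rewrite /majorant !(dotC z'.1) !(dotC z'.2). Qed.

Let majorantP a z z' t :
  majorant (a *: z + z') t = a * majorant z t + majorant z' t.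
Proof. by rewrite /majorant/= !dotP; ring. Qed.

Let majorant_ge0 z : 0 <= majorant z z.
Proof. by rewrite addr_ge0 ?dot_ge0. Qed.

Let majorant_eq0 z : majorant z z = 0 -> z = 0.
Proof.
move=> /eqP; rewrite paddr_eq0 ?dot_ge0// => /andP[/eqP h1 /eqP h2].
by case: z h1 h2 => x y /= /dot_eq0 -> /dot_eq0 ->.
Qed.

(* Replaces the sup norm that the library puts on a product. *)
HB.instance Definition _ := @Lmodule_isNormed.Build R krein
  (fun z => Num.sqrt (majorant z z))
  (form_normD majorantC majorantP majorant_ge0 majorant_eq0)
  (form_normZ majorantC majorantP)
  (form_norm_eq0 majorant_ge0 majorant_eq0).

End krein.

(* K with the Borel sigma-field of its norm. *)
Notation kreinB R := (g_sigma_algebraType (@open (krein R))).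

Section graph_root_distributions.
Variable R : realType.
Local Open Scope ereal_scope.

Definition is_grd (F : probability (kreinB R) R) : Prop :=
  (F \x F) [set z | (0 <= kdot z.1 z.2 <= 1)%R] = 1.

Definition square_integrable (F : probability (kreinB R) R) : Prop :=
  'E_F[fun z => (`|z : krein R| ^+ 2)%R] < +oo.

Definition uncorrelated_components (F : probability (kreinB R) R) : Prop :=
  forall j k : nat, 'E_F[fun z => (z.1 j * z.2 k)%R] = 0.

Definition has_law d d' (W : measurableType d) (T : measurableType d')
    (Pr : probability W R) (Z : W -> T) (F : probability T R) : Prop :=
  measurable_fun setT Z /\
  forall B, measurable B -> Pr (Z @^-1` B) = F B.

End graph_root_distributions.

(* Infinite binary arrays with the product sigma-field. *)
Definition entry_sets : set (set (nat -> nat -> bool)) :=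
  [set B | exists i j, B = [set a : nat -> nat -> bool | a i j]].
Notation array := (g_sigma_algebraType entry_sets).

Section sampling.
Variable R : realType.
Local Open Scope ereal_scope.

Definition iid d (W : measurableType d) (Pr : probability W R)
    (Z : nat -> W -> kreinB R) (F : probability (kreinB R) R) : Prop :=
  (forall i, measurable_fun setT (Z i)) /\
  (forall (n : nat) (B : nat -> set (kreinB R)),
    (forall i, measurable (B i)) ->
    Pr [set w | forall i, (i < n)%N -> B i (Z i w)] = \prod_(i < n) F (B i)).

Definition sigma_of d (W : measurableType d) (Z : nat -> W -> kreinB R) :
    set (set W) :=
  <<s [set C | exists i B, measurable B /\ C = Z i @^-1` B] >>.

(* The last clause says that, conditionally on the sigma-field of (Z_i)_i, the
   probability of {A i j = a i j for all i < j < n} is the product of the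
   Bernoulli weights, i.e. the edges are conditionally independent. *)
Definition graph_sample d (W : measurableType d) (Pr : probability W R)
    (Z : nat -> W -> kreinB R) (A : W -> array)
    (F : probability (kreinB R) R) : Prop :=
  [/\ iid Pr Z F,
      measurable_fun setT A,
      forall w i j, A w i j = A w j i,
      forall w i, A w i i = false
    & forall (n : nat) (a : nat -> nat -> bool) (C : set W), sigma_of Z C ->
        Pr (C `&` [set w | forall i j, (i < j < n)%N -> A w i j = a i j]) =
        \int[Pr]_(w in C)
          (\prod_(j < n) \prod_(i < j)
             bernoulli_pmf (kdot (Z i w) (Z j w)) (a i j))%:E].

Definition sampling_distribution (F : probability (kreinB R) R)
    (mu : probability array R) : Prop :=
  exists d (W : measurableType d) (Pr : probability W R) Z A,
    graph_sample Pr Z A F /\ has_law Pr A mu.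

Definition same_sampling_distribution (F1 F2 : probability (kreinB R) R) :=
  exists mu, sampling_distribution F1 mu /\ sampling_distribution F2 mu.

End sampling.

Section orthogonal_transforms.
Variable R : realType.

Definition orthogonal (Q : {linear ell2 R -> ell2 R}) : Prop :=
  (forall x y, dot (Q x) (Q y) = dot x y) /\ (forall y, exists x, Q x = y).

Definition closed_subspace (D : set (ell2 R)) : Prop :=
  [/\ closed D, D 0 & forall a x y, D x -> D y -> D (a *: x + y)].

(* Q restricts to an orthogonal transform of the subspace D onto the subspace
   D'; off D it is the usual extension by 0 on the orthogonal complement. *)
Definition orthogonal_on (D D' : set (ell2 R))
    (Q : {linear ell2 R -> ell2 R}) : Prop :=
  [/\ closed_subspace D,
      forall x y, D x -> D y -> dot (Q x) (Q y) = dot x y,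
      Q @` D = D'
    & forall x, (forall y, D y -> dot x y = 0) -> Q x = 0].

Definition transform (Qp Qn : ell2 R -> ell2 R) (z : kreinB R) : kreinB R :=
  (Qp z.1, Qn z.2).

Definition ot_eq (F1 F2 : probability (kreinB R) R) : Prop :=
  exists Qp Qn : {linear ell2 R -> ell2 R},
  [/\ orthogonal Qp, orthogonal Qn
    & forall d (W : measurableType d) (Pr : probability W R)
        (Z : W -> kreinB R), measurable_fun setT Z ->
      has_law Pr Z F1 <-> has_law Pr (transform Qp Qn \o Z) F2].

(* With everywhere defined bijections, ot_eq is too strong for laws that are
   carried by infinite-dimensional proper subspaces: the law of X = e_j with
   probability 2^-j, Y = 0, and its image under the shift e_j |-> e_{j+1}
   have the same Gram matrices, but no orthogonal transform of l^2 maps the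
   first to the second (and none, even if not onto, maps the second to the
   first). ot_eq_carried allows the orthogonal transforms to be defined on
   closed subspaces Dp, Dn that carry the components. *)
Definition ot_eq_carried (F1 F2 : probability (kreinB R) R) : Prop :=
  exists (Dp Dp' Dn Dn' : set (ell2 R)) (Qp Qn : {linear ell2 R -> ell2 R}),
  [/\ orthogonal_on Dp Dp' Qp, orthogonal_on Dn Dn' Qn,
      F1 (Dp `*` Dn) = 1%E
    & forall d (W : measurableType d) (Pr : probability W R)
        (Z : W -> kreinB R), measurable_fun setT Z ->
      Pr (Z @^-1` (Dp `*` Dn)) = 1%E ->
      has_law Pr Z F1 <-> has_law Pr (transform Qp Qn \o Z) F2].

(* The orthogonal complements of the closed linear spans of the supports of
   the positive and of the negative component. *)
Definition null_pos (F : probability (kreinB R) R) : set (ell2 R) :=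
  [set u | F [set z | dot u z.1 = 0] = 1%E].
Definition null_neg (F : probability (kreinB R) R) : set (ell2 R) :=
  [set u | F [set z | dot u z.2 = 0] = 1%E].

(* These complements have the same Hilbert dimension for F1 and for F2, e.g.
   because the supports span l^2 or because they span subspaces of the same
   finite dimension. *)
Definition same_codimension (F1 F2 : probability (kreinB R) R) : Prop :=
  (exists U, orthogonal_on (null_pos F1) (null_pos F2) U) /\
  (exists U, orthogonal_on (null_neg F1) (null_neg F2) U).

End orthogonal_transforms.

(* Main.v *)
(* From an orthogonal transform to the samples: if F2 is the image of F1, then
   transforming the latent vectors of a sample of F1 gives a sample of F2 with the
   same graph.

   From the samples to an orthogonal transform: since the components are
   uncorrelated, the kernel k(z, w) = <z, w> of K acts on L^2(F) as A on the
   positive and as -B on the negative component, A and B being the second moment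
   operators. The density of paths of length m + 1 from i to j in the graph
   estimates the iterated kernel <X_i, A^m X_j> - (-1)^m <Y_i, B^m Y_j>, and
   polynomials tending to the indicators of the two half-lines then recover the
   Gram matrices of (X_i) and of (Y_i) from the graph. As the graphs have the same
   law, graphs of F1 and of F2 coincide on a common finite pattern with positive
   probability; by tightness, an ultralimit of such samples gives two sequences in
   K with equal Gram matrices, whose empirical measures converge to F1 and to F2.
   Equal Gram matrices yield isometries between the closed spans of the two
   sequences, which therefore carry F1 to F2.

   When the codimensions agree, the isometry extends to l^2: it is kept on the
   orthogonal complement of the null directions, and these are matched by the
   given transforms. *)
Require Import Defs.
From mathcomp Require Import all_boot all_order all_algebra.
From mathcomp Require Import all_classical all_reals all_analysis.
From mathcomp Require Import measurable_realfun.
From HB Require Import structures.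
From mathcomp Require Import zify ring lra.

Set Implicit Arguments.
Unset Strict Implicit.
Unset Printing Implicit Defensive.

Import Order.TTheory GRing.Theory Num.Theory.
Import numFieldNormedType.Exports.

Local Open Scope classical_set_scope.
Local Open Scope ring_scope.

(** * Sequence spaces *)

(** An infinite graph usually has probability zero, and the samples of the two laws live on
    unrelated spaces, so no common infinite graph can simply be picked. Finite patterns remain: two
    events of probability above 1/2, one for each law, must share one. Every property wanted in the
    limit is therefore made an event of probability bounded below, and the graph statistic must be
    literally the same for both laws, whence the common normalising constant c. Gram entries do not
    survive weak limits, and bounded sets of K are not compact in norm; tightness gives norm
    convergence of each root, hence convergence of the Gram entries. The spectral projections are
    reached only through polynomials, and each inequality between these on [0, 1] is certified by an
    explicit combination of the products X^k (1 - X)^l with nonnegative coefficients, which is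
    positive at every self-adjoint 0 <= A <= 1. The polynomials vanish at 0, so they recover the
    inner product only on the closure of the range of A; almost every root has its component
    there. *)

Lemma preimage_measurable d d' (T : measurableType d) (T' : measurableType d')
    (f : T -> T') B :
  measurable_fun setT f -> measurable B -> measurable (f @^-1` B).
Proof. by move=> mf mB; rewrite -[X in measurable X]setTI; exact: mf. Qed.

Lemma ae_full d (T : measurableType d) (R : realType) (mu : probability T R) (B : set T) :
  measurable B -> mu B = 1%E -> {ae mu, forall x, B x}.
Proof.
move=> mB B1; exists (~` B); split => //; first exact: measurableC.
by transitivity (1 - mu B)%E; [exact: probability_setC|rewrite B1 subee].
Qed.

Section sequence_space.
Context {d} (E : measurableType d).

Definition coordinate_sets : set (set (nat -> E)) :=
  [set B | exists i C, measurable C /\ B = [set w | C (w i)]].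

Definition seqspace := g_sigma_algebraType coordinate_sets.

Definition upd (k : nat) (w : seqspace) (e : E) : seqspace :=
  fun i => if i == k then e else w i.

Lemma measurable_coord i : measurable_fun setT (fun w : seqspace => w i).
Proof.
move=> _ B mB; rewrite setTI; apply: sub_sigma_algebra.
by exists i, B.
Qed.

Lemma measurable_seqspace d' (T : measurableType d') (f : T -> seqspace) :
  (forall i, measurable_fun setT (fun t => f t i)) -> measurable_fun setT f.
Proof.
move=> mf; apply: (@measurability _ _ _ seqspace _ _ coordinate_sets) => //.
move=> _ [_ [i [C [mC ->]]] <-].
exact: (mf i).
Qed.

Lemma measurable_upd k :
  measurable_fun setT (fun we : seqspace * E => upd k we.1 we.2).
Proof.
apply: measurable_seqspace => i; rewrite /upd; case: (i == k).
  exact: measurable_snd.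
exact: (measurableT_comp (@measurable_coord i) measurable_fst).
Qed.

Definition rect (n : nat) (B : nat -> set E) : set seqspace :=
  [set w | forall i, (i < n)%N -> B i (w i)].

Lemma rectS n B : rect n.+1 B = rect n B `&` [set w | B n (w n)].
Proof.
apply/seteqP; split => w /=.
  by move=> h; split; [move=> i im; apply/h/ltnW|exact/h].
by move=> [h hn] i; rewrite ltnS leq_eqVlt => /predU1P[->//|]; exact: h.
Qed.

Lemma rect0 B : rect 0 B = setT.
Proof. by apply/seteqP; split. Qed.

Lemma measurable_rect n B : (forall i, measurable (B i)) -> measurable (rect n B).
Proof.
move=> mB; elim: n => [|n ih]; first by rewrite rect0.
rewrite rectS; apply: measurableI => //.
by apply: (preimage_measurable (measurable_coord n)).
Qed.

Definition rects : set (set seqspace) :=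
  [set A | exists n B, (forall i, measurable (B i)) /\ A = rect n B].

Lemma rects_gen : @measurable _ seqspace = <<s rects >>.
Proof.
apply/seteqP; split.
  apply: smallest_sub; first exact: smallest_sigma_algebra.
  move=> _ [i [C [mC ->]]]; apply: sub_sigma_algebra.
  exists i.+1, (fun j => if j == i then C else setT); split.
    by move=> j; case: ifP.
  apply/seteqP; split => w /=.
    by move=> Cw j _; case: eqP => // ->.
  by move=> /(_ i (ltnSn _)); rewrite eqxx.
apply: smallest_sub; first exact: sigma_algebra_measurable.
by move=> _ [n [B [mB ->]]]; exact: measurable_rect.
Qed.

Lemma rects_setI : setI_closed rects.
Proof.
move=> _ _ [n [B [mB ->]]] [m [C [mC ->]]].
exists (maxn n m), (fun i => (if (i < n)%N then B i else setT) `&`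
   (if (i < m)%N then C i else setT)); split.
  by move=> i; apply: measurableI; case: ifP.
apply/seteqP; split => w /=.
  by move=> [h1 h2] i _; split; case: ifP => // ?; [exact: h1|exact: h2].
move=> h; split=> i im.
  have /h : (i < maxn n m)%N by rewrite leq_max im.
  by rewrite im => -[].
have /h : (i < maxn n m)%N by rewrite leq_max im orbT.
by rewrite im => -[].
Qed.

Lemma seqspace_measure_unique (R : realType)
    (m1 m2 : {measure set seqspace -> \bar R}) : (m1 setT < +oo)%E ->
  (forall n B, (forall i, measurable (B i)) -> m1 (rect n B) = m2 (rect n B)) ->
  forall A, measurable A -> m1 A = m2 A.
Proof.
move=> m1oo h A mA; apply: (measure_unique rects (fun=> setT)) => //.
- exact: rects_gen.
- exact: rects_setI.
- by move=> i; exists 0%N, (fun=> setT); split=> //; rewrite rect0.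
- by rewrite bigcup_const.
- by move=> _ [n [B [mB ->]]]; exact: h.
Qed.

End sequence_space.

(** * Infinite products of probability measures *)

Section infinite_product.
Context {d} {E : measurableType d} {R : realType} (P : probability E R).
Local Open Scope ereal_scope.
Implicit Types (f : seqspace E -> \bar R) (w : seqspace E) (C : set (seqspace E)).

(** The values may lie in any type, so that the notion covers integrands and also sets, which are
    functions into [Prop]. *)
Definition depends_on T (n : nat) (f : seqspace E -> T) :=
  forall w w', (forall i, (i < n)%N -> w i = w' i) -> f w = f w'.

Definition int_coord k f : seqspace E -> \bar R := fun w => \int[P]_e f (upd k w e).

Lemma int_coord_ge0 k f : (forall w, 0 <= f w) -> forall w, 0 <= int_coord k f w.
Proof. by move=> f0 w; exact: integral_ge0. Qed.

Lemma measurable_updr k w : measurable_fun setT (upd k w).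
Proof. exact: (measurable_fun_pair2 w (measurable_upd k)). Qed.

Lemma measurable_upd_comp k w f :
  measurable_fun setT f -> measurable_fun setT (fun e => f (upd k w e)).
Proof. by move=> mf; exact: (measurableT_comp mf (@measurable_updr k w)). Qed.

Lemma measurable_int_coord k f : (forall w, 0 <= f w) ->
  measurable_fun setT f -> measurable_fun setT (int_coord k f).
Proof.
move=> f0 mf.
apply: (@measurable_fun_fubini_tonelli_F _ _ _ _ R P (fun we => f (upd k we.1 we.2))) => //.
exact: (measurableT_comp mf (measurable_upd k)).
Qed.

Fixpoint int_coords (m k : nat) f : seqspace E -> \bar R :=
  if m is m'.+1 then int_coord k (int_coords m' k.+1 f) else f.

(* The conditional probability of [C], which depends on the first [n]
   coordinates, given the first [k] of them. *)
Definition cyl_val n k C := int_coords (n - k) k (fun w => (\1_C w)%:E).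

Lemma int_coords_ge0 m k f : (forall w, 0 <= f w) -> forall w, 0 <= int_coords m k f w.
Proof. by move=> f0; elim: m k => //= m ih k; exact: int_coord_ge0. Qed.

Lemma measurable_int_coords m k f : (forall w, 0 <= f w) ->
  measurable_fun setT f -> measurable_fun setT (int_coords m k f).
Proof.
move=> f0 mf; elim: m k => //= m ih k; apply: measurable_int_coord => //.
exact: int_coords_ge0.
Qed.

Lemma int_coord_depends k f : depends_on k f -> int_coord k f = f.
Proof.
move=> fk; apply/funext => w; rewrite /int_coord.
rewrite (_ : (fun e => _) = cst (f w)).
  by rewrite integral_cst//= probability_setT mule1.
apply/funext => e /=; apply: fk => i ik; rewrite /upd.
by move: ik; case: eqP => // ->; rewrite ltnn.
Qed.

Lemma int_coords_dep m k f : depends_on (k + m) f -> depends_on k (int_coords m k f).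
Proof.
elim: m k => [k|m ih k]; first by rewrite addn0.
rewrite addnS -addSn => /ih h w w' ww' /=.
apply: eq_integral => e _; apply: h => i; rewrite ltnS leq_eqVlt /upd.
by case: eqP => //= _; exact: ww'.
Qed.

Lemma depends_onW T m n (f : seqspace E -> T) :
  (m <= n)%N -> depends_on m f -> depends_on n f.
Proof. by move=> mn h w w' ww'; apply: h => i im; apply: ww'; exact: leq_trans mn. Qed.

Lemma indic_depends n C : depends_on n C -> depends_on n (fun w => (\1_C w)%:E : \bar R).
Proof.
move=> h w w' /h e; rewrite !indicE; congr ((nat_of_bool _)%:R%:E).
by apply/idP/idP; rewrite !inE e.
Qed.

Lemma cyl_val_dep n k C : depends_on n C -> depends_on k (cyl_val n k C).
Proof.
move=> nC; apply: int_coords_dep; apply: depends_onW (indic_depends nC).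
lia.
Qed.

Lemma cyl_valS n k C w : depends_on n C ->
  cyl_val n k C w = \int[P]_e cyl_val n k.+1 C (upd k w e).
Proof.
move=> nC; rewrite /cyl_val; have [kn|nk] := ltnP k n.
  by rewrite (_ : n - k = (n - k.+1).+1)%N//; lia.
have /eqP -> : (n - k == 0)%N by rewrite subn_eq0.
have /eqP -> : (n - k.+1 == 0)%N by rewrite subn_eq0 ltnW.
have h := int_coord_depends (depends_onW nk (indic_depends nC)).
exact: (congr1 (fun f => f w) (esym h)).
Qed.

Lemma cyl_val_ge n k C w : (n <= k)%N -> cyl_val n k C w = (\1_C w)%:E.
Proof. by rewrite /cyl_val => /eqP ->. Qed.

(** Above both bounds each side is the indicator of C, and one step down in k is the same
    integration on both sides; hence the induction on the distance from k to the larger bound. It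
    makes the choice of n in [cylprob] harmless. *)
Lemma cyl_val_indep n m k C : depends_on n C -> depends_on m C ->
  cyl_val n k C = cyl_val m k C.
Proof.
move=> nC mC; move: {2}(maxn n m - k)%N (leqnn (maxn n m - k)) => l.
elim: l k => [k|l ih k] lk; apply/funext => w.
  by rewrite !cyl_val_ge//; lia.
rewrite !cyl_valS//; apply: eq_integral => e _.
by rewrite ih//; lia.
Qed.

Lemma measurable_indic_ereal C : measurable C ->
  measurable_fun setT (fun w => (\1_C w)%:E : \bar R).
Proof. by move=> mC; apply/measurable_EFinP; exact: measurable_indic. Qed.

Lemma measurable_cyl_val n k C : measurable C -> measurable_fun setT (cyl_val n k C).
Proof.
move=> mC; apply: measurable_int_coords; last exact: measurable_indic_ereal.
by move=> w; rewrite lee_fin.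
Qed.

Lemma cyl_val_ge0 n k C w : 0 <= cyl_val n k C w.
Proof. by apply: int_coords_ge0 => ?; rewrite lee_fin. Qed.

Definition cylinder : set (set (seqspace E)) :=
  [set C | measurable C /\ exists n, depends_on n C].

(** A copy of [seqspace E], so that the algebra of cylinders and the product sigma-field can both be
    attached to the same points. *)
Definition cyltype := seqspace E.
HB.instance Definition _ := Pointed.on cyltype.

Lemma cylinder0 : cylinder set0.
Proof. by split => //; exists 0%N. Qed.

Lemma cylinderU : setU_closed cylinder.
Proof.
move=> A B [mA [n nA]] [mB [m mB']]; split; first exact: measurableU.
exists (maxn n m) => w w' h; rewrite /setU/=.
by rewrite (@depends_onW _ _ _ _ (leq_maxl n m) nA _ _ h)
  (@depends_onW _ _ _ _ (leq_maxr n m) mB' _ _ h).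
Qed.

Lemma cylinderC : setC_closed cylinder.
Proof.
move=> A [mA [n nA]]; split; first exact: measurableC.
by exists n => w w' /nA; rewrite /setC/= => ->.
Qed.

Fact cylinder_display : measure_display. Proof. exact: default_measure_display. Qed.

HB.instance Definition _ := @isAlgebraOfSets.Build cylinder_display cyltype
  cylinder cylinder0 cylinderU cylinderC.

Definition cylprob C : \bar R := cyl_val (xget 0%N [set n | depends_on n C]) 0 C point.

Lemma cylprobE n C : depends_on n C -> cylprob C = cyl_val n 0 C point.
Proof.
move=> nC; rewrite /cylprob; congr (_ _); apply: cyl_val_indep => //.
by apply: (@xgetPex _ 0%N [set m | depends_on m C]); exists n.
Qed.

Lemma int_coordsD m k f g : (forall w, 0 <= f w) -> (forall w, 0 <= g w) ->
    measurable_fun setT f -> measurable_fun setT g ->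
  int_coords m k (fun w => f w + g w) =
  (fun w => int_coords m k f w + int_coords m k g w).
Proof.
move=> f0 g0 mf mg; elim: m k => //= m ih k.
apply/funext => w; rewrite /int_coord ih ge0_integralD//.
- by move=> e _; exact: int_coords_ge0.
- by apply: measurable_upd_comp; exact: measurable_int_coords.
- by move=> e _; exact: int_coords_ge0.
- by apply: measurable_upd_comp; exact: measurable_int_coords.
Qed.

Lemma cylprob_ge0 C : 0 <= cylprob C.
Proof. exact: cyl_val_ge0. Qed.

Lemma cylprob0 : cylprob set0 = 0.
Proof.
rewrite (@cylprobE 0 set0)// /cyl_val/= indicE.
by rewrite (_ : _ \in _ = false)//; apply/negP; rewrite inE.
Qed.

Lemma cylprob_additive : measure_function.semi_additive (cylprob : set cyltype -> \bar R).
Proof.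
apply/additive2P; first exact: cylprob0.
move=> A B [mA [n nA]] [mB [m mB']] AB0.
have nA' := depends_onW (leq_maxl n m) nA.
have mB'' := depends_onW (leq_maxr n m) mB'.
rewrite (@cylprobE (maxn n m) A)// (@cylprobE (maxn n m) B)//.
rewrite (@cylprobE (maxn n m) (A `|` B)); last first.
  by move=> w w' h; rewrite /setU/= (nA' _ _ h) (mB'' _ _ h).
have /(congr1 (fun f => f point)) <- := @int_coordsD (maxn n m - 0) 0
    (fun w => (\1_A w)%:E) (fun w => (\1_B w)%:E)
    (fun w => ltac:(by rewrite lee_fin)) (fun w => ltac:(by rewrite lee_fin))
    (measurable_indic_ereal mA) (measurable_indic_ereal mB).
rewrite /cyl_val; congr (int_coords _ _ _ _).
apply/funext => w; rewrite -EFinD !indicE in_setU.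
have : (w \in A) && (w \in B) = false by rewrite -in_setI AB0 in_set0.
by case: (w \in A); case: (w \in B) => //= _; rewrite ?addr0 ?add0r.
Qed.

Definition cylmeasure : set cyltype -> \bar R := cylprob.

HB.instance Definition _ := @isContent.Build cylinder_display cyltype R cylmeasure
  cylprob_ge0 cylprob_additive.

(** If a cover had total mass below that of A, the strict inequality between conditional masses
    would survive the choice of one more coordinate, hence hold along a whole sequence w. For large
    k the conditional masses are indicators at w, which forces w into A and out of every [F i]. *)
Lemma cylprob_sigma_subadditive :
  measurable_subset_sigma_subadditive (cylprob : set cyltype -> \bar R).
Proof.
move=> A F mF [mA [n nA]] AF; rewrite leNgt; apply/negP => lt0.
have /choice[N FN] i : exists m, depends_on m (F i) by case: (mF i).
pose inv k w := \sum_(i <oo) cyl_val (N i) k (F i) w < cyl_val n k A w.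
have inv0 : inv 0%N point.
  rewrite /inv -cylprobE//; apply: le_lt_trans lt0.
  by rewrite le_eqVlt; apply/orP; left; apply/eqP/eq_eseriesr => i _; rewrite (cylprobE (FN i)).
have invS k w : inv k w -> exists e, inv k.+1 (upd k w e).
  (* If every value e reversed the inequality at stage k + 1, integration over e would reverse it at
     stage k. *)
  apply: contraPP => /forallNP h; apply/negP; rewrite -leNgt.
  under eq_eseriesr do rewrite cyl_valS//.
  rewrite cyl_valS// -integral_nneseries//; last 2 first.
  - by move=> i; apply: measurable_upd_comp; apply: measurable_cyl_val; case: (mF i).
  - by move=> i e _; exact: cyl_val_ge0.
  apply: ge0_le_integral => //.
  - by move=> e _; exact: cyl_val_ge0.
  - by apply: measurable_upd_comp; exact: measurable_cyl_val.
  - apply: ge0_emeasurable_sum.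
      by move=> i e _ _; exact: cyl_val_ge0.
    by move=> i _; apply: measurable_upd_comp; apply: measurable_cyl_val; case: (mF i).
  - by move=> e _; rewrite leNgt; apply/negP; exact: h.
(* [s k] has its first k coordinates settled; later stages keep them, so the diagonal sequence w
   agrees with [s k] below k. *)
pose s := fix s k := if k is k'.+1 then
  upd k' (s k') (xget point [set e | inv k (upd k' (s k') e)]) else point.
have sinv k : inv k (s k).
  by elim: k => // k /invS h; exact: (xgetPex point h).
pose w : seqspace E := fun i => s i.+1 i.
have sw k i : (i < k)%N -> s k i = w i.
  elim: k => // k ih; rewrite ltnS leq_eqVlt => /predU1P[->//|ik].
  by rewrite [LHS]/= {1}/upd ltn_eqF// ih.
have winv k : inv k w.
  rewrite /inv -(cyl_val_dep (k := k) nA (sw k)).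
  under eq_eseriesr do rewrite -(cyl_val_dep (FN _) (sw k)).
  exact: sinv.
have term k i : cyl_val (N i) k (F i) w < cyl_val n k A w.
  apply: le_lt_trans (winv k).
  have := @nneseries_lim_ge _ (fun i => cyl_val (N i) k (F i) w) xpredT 0 i.+1.
  rewrite big_nat_recr//= => h; apply: le_trans (h _).
    by rewrite leeDr// sume_ge0// => j _; exact: cyl_val_ge0.
  by move=> j _ _; exact: cyl_val_ge0.
have [Aw|nAw] := pselect (A w); last first.
  have := term n 0%N; rewrite [X in _ < X]cyl_val_ge// indicE memNset//.
  by rewrite ltNge cyl_val_ge0.
have [i _ Fiw] := AF _ Aw.
(* At this stage both conditional masses are indicators, and both equal 1 at w. *)
have := term (maxn n (N i)) i.
rewrite !cyl_val_ge ?leq_maxl ?leq_maxr// !indicE !mem_set//.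
by rewrite ltxx.
Qed.

HB.instance Definition _ := @Content_SigmaSubAdditive_isMeasure.Build
  cylinder_display R cyltype cylmeasure cylprob_sigma_subadditive.

Lemma sub_cylinder : (@measurable _ (seqspace E)) `<=` <<s cylinder >>.
Proof.
rewrite rects_gen; apply: smallest_sub; first exact: smallest_sigma_algebra.
move=> _ [n [B [mB ->]]]; apply: sub_sigma_algebra; split.
  exact: measurable_rect.
exists n => w w' h; apply/propext; split => H i ni; have := H i ni; rewrite h//.
Qed.

Definition iprod : set (seqspace E) -> \bar R :=
  measure_extension cylmeasure.

Let iprod0 : iprod set0 = 0. Proof. exact: measure0. Qed.

Let iprod_ge0 A : 0 <= iprod A. Proof. exact: measure_ge0. Qed.

Let iprod_sigma_additive : semi_sigma_additive iprod.
Proof.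
move=> F mF tF mUF.
by apply: measure_semi_sigma_additive => // [i|]; exact: sub_cylinder.
Qed.

HB.instance Definition _ := isMeasure.Build _ _ _ iprod
  iprod0 iprod_ge0 iprod_sigma_additive.

Lemma iprodE C : cylinder C -> iprod C = cylprob C.
Proof. by move=> mC; apply: (@measurable_mu_extE _ _ cyltype). Qed.

Let iprodT : iprod setT = 1.
Proof.
rewrite iprodE; last by split => //; exists 0%N.
by rewrite (@cylprobE 0 setT)// /cyl_val/= indicT.
Qed.

HB.instance Definition _ := Measure_isProbability.Build _ _ _ iprod iprodT.

Lemma cyl_val_rect n B k w : (forall i, measurable (B i)) -> (k <= n)%N ->
  cyl_val n k (rect n B) w = (\1_(rect k B) w)%:E * \prod_(k <= i < n) P (B i).
Proof.
move=> mB kn.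
have dn : depends_on n (rect n B).
  move=> v v' h; apply/propext; split => H i ni; have := H i ni; rewrite h//.
move: {2}(n - k)%N (erefl (n - k)%N) => l; elim: l k kn w => [|l ih] k kn w nk.
  have -> : k = n by lia.
  by rewrite cyl_val_ge// big_geq// mule1.
rewrite cyl_valS// big_ltn; last lia.
under eq_integral => e _.
  rewrite ih; [|lia|lia].
  rewrite rectS indicI/= (_ : \1_(rect k B) (upd k w e) = \1_(rect k B) w); last first.
    have h : forall i, (i < k)%N -> upd k w e i = w i.
      by move=> i ik; rewrite /upd ltn_eqF.
    have e' : rect k B (upd k w e) = rect k B w.
      by apply/propext; split => H i ni; have := H i ni; rewrite h.
    by rewrite !indicE; congr ((nat_of_bool _)%:R); apply/idP/idP; rewrite !inE e'.
  rewrite (_ : \1_[set v : seqspace E | B k (v k)] _ = \1_(B k) e); last first.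
    by rewrite !indicE /upd; congr ((nat_of_bool _)%:R);
      apply/idP/idP; rewrite !inE/= eqxx.
  rewrite EFinM -muleA [_%:E * \prod_(_ <= _ < _) _]muleC.
  over.
have p0 : 0 <= \prod_(k.+1 <= i < n) P (B i).
  by elim/big_ind: _ => // x y; exact: mule_ge0.
have mI : measurable_fun setT (fun e => (\1_(B k) e)%:E : \bar R).
  by apply/measurable_EFinP; exact: measurable_indic.
rewrite ge0_integralZl_EFin//; last 2 first.
  by move=> e _; rewrite mule_ge0// lee_fin.
  exact: measurable_funeM.
rewrite ge0_integralZl// integral_indic// setIT.
by congr (_ * _); rewrite muleC.
Qed.

Lemma iprod_rect n B : (forall i, measurable (B i)) ->
  iprod (rect n B) = \prod_(i < n) P (B i).
Proof.
move=> mB.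
have dn : depends_on n (rect n B).
  move=> v v' h; apply/propext; split => H i ni; have := H i ni; rewrite h//.
rewrite iprodE; last by split; [exact: measurable_rect|exists n].
rewrite (cylprobE dn) cyl_val_rect// rect0 indicT mul1e big_mkord//.
Qed.

End infinite_product.

(** * The Hilbert space of square-summable sequences *)

Section ell2_theory.
Variable R : realType.
Implicit Types (x y z : ell2 R) (D : set (ell2 R)).

Lemma ell2B x y j : (x - y) j = x j - y j. Proof. by []. Qed.

Lemma dot0l y : dot 0 y = 0.
Proof. by have := dotP 1 0 0 y; rewrite scaler0 addr0 mul1r => /eqP; rewrite -subr_eq subrr => /eqP. Qed.

Lemma dotZl a x y : dot (a *: x) y = a * dot x y.
Proof. by rewrite -[a *: x]addr0 dotP dot0l addr0. Qed.

Lemma dotDl x y z : dot (x + y) z = dot x z + dot y z.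
Proof. by rewrite -[x in LHS]scale1r dotP mul1r. Qed.

Lemma dotNl x y : dot (- x) y = - dot x y.
Proof. by rewrite -scaleN1r dotZl mulN1r. Qed.

Lemma dotBl x y z : dot (x - y) z = dot x z - dot y z.
Proof. by rewrite dotDl dotNl. Qed.

Lemma dot0r y : dot y 0 = 0. Proof. by rewrite dotC dot0l. Qed.

Lemma dotZr a x y : dot y (a *: x) = a * dot y x.
Proof. by rewrite dotC dotZl dotC. Qed.

Lemma dotDr x y z : dot z (x + y) = dot z x + dot z y.
Proof. by rewrite dotC dotDl !(dotC z). Qed.

Lemma dotNr x y : dot y (- x) = - dot y x.
Proof. by rewrite dotC dotNl dotC. Qed.

Lemma dotBr x y z : dot z (x - y) = dot z x - dot z y.
Proof. by rewrite dotDr dotNr. Qed.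

Lemma dot_suml I (r : seq I) (P : pred I) (F : I -> ell2 R) y :
  dot (\sum_(i <- r | P i) F i) y = \sum_(i <- r | P i) dot (F i) y.
Proof. by elim/big_rec2: _ => [|i a b _ <-]; rewrite ?dot0l ?dotDl. Qed.

Lemma dot_sumr I (r : seq I) (P : pred I) (F : I -> ell2 R) y :
  dot y (\sum_(i <- r | P i) F i) = \sum_(i <- r | P i) dot y (F i).
Proof. by elim/big_rec2: _ => [|i a b _ <-]; rewrite ?dot0r ?dotDr. Qed.

Lemma ell2_normE x : `|x| = Num.sqrt (dot x x). Proof. by []. Qed.

Lemma ell2_norm_sqr x : `|x| ^+ 2 = dot x x.
Proof. by rewrite ell2_normE sqr_sqrtr// dot_ge0. Qed.

Lemma dot_norm_le x y : `|dot x y| <= `|x| * `|y|.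
Proof.
have [y0|y0] := eqVneq (dot y y) 0.
  by rewrite (dot_eq0 y0) dot0r normr0 mulr_ge0.
have yp : 0 < dot y y by rewrite lt_neqAle eq_sym y0 dot_ge0.
have h := dot_ge0 (dot y y *: x - dot x y *: y).
have cs : dot x y ^+ 2 <= dot x x * dot y y.
  rewrite -subr_ge0 -(pmulr_rge0 _ yp).
  move: h; rewrite dotBl !dotBr !dotZl !dotZr (dotC y x).
  by congr (0 <= _); ring.
rewrite !ell2_normE -sqrtrM ?dot_ge0// -sqrtr_sqr ler_sqrt//.
by rewrite mulr_ge0 ?dot_ge0.
Qed.

Lemma square_summable_bounded (u : nat -> R) M :
  (forall n, \sum_(0 <= j < n) u j ^+ 2 <= M) -> u \in @square_summable R.
Proof.
move=> h; apply/asboolP; apply: nondecreasing_is_cvgn.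
  by apply/nondecreasing_series => i _ _; rewrite sqr_ge0.
by exists M => _ [n _ <-]; exact: h.
Qed.

Lemma dot_sum_le x n : \sum_(0 <= j < n) x j ^+ 2 <= dot x x.
Proof.
have h : series (fun j => x j * x j) n <= dot x x.
  apply: nondecreasing_cvgn_le (@is_cvg_dot R x x) _.
  by apply/nondecreasing_series => i _ _; rewrite -expr2 sqr_ge0.
by apply: le_trans h; rewrite /series/=; under eq_bigr do rewrite expr2.
Qed.

Lemma coord_sqr_le x j : x j ^+ 2 <= dot x x.
Proof.
apply: le_trans (dot_sum_le x j.+1); rewrite big_nat_recr//= lerDr.
by apply: sumr_ge0 => i _; exact: sqr_ge0.
Qed.

Lemma ler_of_sqr (a b : R) : 0 <= b -> a ^+ 2 <= b ^+ 2 -> a <= b.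
Proof. by move=> b0 ab; rewrite leNgt; apply/negP => ba; nra. Qed.

Lemma coord_le x j : `|x j| <= `|x|.
Proof.
by rewrite ell2_normE -sqrtr_sqr ler_sqrt ?dot_ge0// coord_sqr_le.
Qed.

Lemma dot_self_le x M : (forall n, \sum_(0 <= j < n) x j ^+ 2 <= M) -> dot x x <= M.
Proof.
move=> h; apply: limr_le; first exact: is_cvg_dot.
apply: nearW => n; rewrite /series/=.
by under eq_bigr do rewrite -expr2; exact: h.
Qed.

Lemma cvg_distP T (F : set_system T) {FF : Filter F} (V : normedModType R)
    (f : T -> V) (x : V) :
  (fun t => `|f t - x|) @ F --> (0 : R) <-> f @ F --> x.
Proof. exact: iff_trans (norm_cvg0P _) (subr_cvg0 _ _). Qed.

Lemma cvg_dot T (F : set_system T) {FF : Filter F} (f g : T -> ell2 R) x y :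
  f @ F --> x -> g @ F --> y -> (fun t => dot (f t) (g t)) @ F --> dot x y.
Proof.
move=> fx gy; apply/cvg_distP.
apply: (@squeeze_cvgr _ _ _ _ (fun=> 0)
  (fun t => `|f t - x| * `|g t| + `|x| * `|g t - y|)).
- apply: nearW => t; rewrite normr_ge0/=.
  have -> : dot (f t) (g t) - dot x y = dot (f t - x) (g t) + dot x (g t - y).
    by rewrite dotBl dotBr; ring.
  by apply: le_trans (ler_normD _ _) _; apply: lerD; exact: dot_norm_le.
- exact: cvg_cst.
- have -> : (0 : R) = 0 * `|y| + `|x| * 0 by rewrite mul0r mulr0 addr0.
  apply: cvgD; apply: cvgM.
  + exact/cvg_distP.
  + exact: cvg_norm.
  + exact: cvg_cst.
  + exact/cvg_distP.
Qed.

Lemma cvg_coord T (F : set_system T) {FF : Filter F} (f : T -> ell2 R) x j :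
  f @ F --> x -> (fun t => f t j) @ F --> x j.
Proof.
move=> /cvg_distP fx; apply/cvg_distP; move: fx; apply: squeeze_cvgr; last exact: cvg_cst.
by apply: nearW => t; rewrite normr_ge0 -ell2B coord_le.
Qed.

(** The coordinates converge; for each fixed length the partial sums of squared distances pass to
    the limit, with a bound uniform in the length. Filters replace sequences because ultralimits of
    roots need the same fact. *)
Lemma ell2_cauchy_cvg (F : set_system (ell2 R)) : ProperFilter F ->
  (forall e, 0 < e -> exists x, F [set y | `|x - y| <= e]) -> exists l : ell2 R, F --> l.
Proof.
move=> PF cF.
have cj j : cvg ((fun y : ell2 R => y j) @ F).
  apply: cauchy_cvg; apply: cauchy_exP => e e0.
  have [x Fx] := cF (e / 2) (divr_gt0 e0 (ltr0Sn _ _)); exists (x j).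
  rewrite /fmap/nbhs/=/ball/=; apply: filterS Fx => y/= xy.
  rewrite -ell2B; apply: le_lt_trans (coord_le _ _) _; apply: le_lt_trans xy _.
  by rewrite ltr_pdivrMr// ltr_pMr// ltr1n.
pose u j := lim ((fun y : ell2 R => y j) @ F).
have key (x : ell2 R) e : 0 < e -> F [set y | `|x - y| <= e] ->
    forall n, \sum_(0 <= j < n) (x j - u j) ^+ 2 <= e ^+ 2.
  move=> e0 Fx n.
  have c : (fun y : ell2 R => \sum_(0 <= j < n) (x j - y j) ^+ 2) @ F -->
      \sum_(0 <= j < n) (x j - u j) ^+ 2.
    apply: cvg_big => [|j _]; first exact: add_continuous.
    apply: (@cvg_comp _ _ _ _ (fun t => t ^+ 2)); last exact: exprn_continuous.
    by apply: cvgB; [exact: cvg_cst|exact: cj].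
  apply: (cvgr_to_le c).
  apply: filterS Fx => y xy; under eq_bigr do rewrite -ell2B.
  apply: le_trans (dot_sum_le _ _) _.
  rewrite -ell2_norm_sqr.
  by apply: lerXn2r => //; rewrite nnegrE// ltW.
have [x0 Fx0] := cF 1 ltr01.
have su : u \in @square_summable R.
  have s1 : (x0 : nat -> R) - u \in @square_summable R.
    exact: (square_summable_bounded (key _ _ ltr01 Fx0)).
  rewrite -[u](subKr (x0 : nat -> R)).
  exact: rpredB (ell2_prop x0) s1.
exists (Ell2 su); apply/cvgrPdist_le => e e0.
have e2 : 0 < e / 2 by rewrite divr_gt0.
have [x Fx] := cF (e / 2) e2.
have hk := key x _ e2 Fx.
apply: filterS Fx => y/= xy.
have -> : Ell2 su - y = (Ell2 su - x) + (x - y) by rewrite subrKA.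
rewrite (splitr e); apply: le_trans (ler_normD _ _) (lerD _ xy).
have e20 : 0 <= e / 2 by rewrite divr_ge0// ltW.
rewrite distrC; apply: ler_of_sqr => //; rewrite ell2_norm_sqr; apply: dot_self_le => n.
exact: hk.
Qed.

Lemma ell2_cvg_seq (s : nat -> ell2 R) :
  (forall e, 0 < e -> exists N, forall m n, (N <= m)%N -> (N <= n)%N ->
    `|s m - s n| <= e) -> exists l : ell2 R, s @ \oo --> l.
Proof.
move=> h; apply: ell2_cauchy_cvg => e /h[N hN]; exists (s N).
by exists N => // n /= Nn; exact: hN.
Qed.

Definition basis_vec (j : nat) : ell2 R.
Proof.
apply: (@Ell2 R (fun i => (i == j)%:R)); apply: (@square_summable_bounded _ 1) => n.
case: (ltnP j n) => jn.
  rewrite big_mkord (bigD1 (Ordinal jn))//= eqxx expr1n big1 ?addr0// => i.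
  by rewrite -val_eqE/= => /negbTE ->; rewrite expr0n.
rewrite big_nat big1// => i /andP[_ ij].
by rewrite ltn_eqF ?expr0n//; exact: leq_trans jn.
Defined.

Lemma dot_basis x j : dot x (basis_vec j) = x j.
Proof.
apply: cvg_lim => //; apply: cvg_near_cst; exists j.+1 => // n /= jn.
rewrite /series/= big_mkord (bigD1 (Ordinal jn))//= eqxx mulr1 big1 ?addr0// => i.
by rewrite -val_eqE/= => /negbTE ->; rewrite mulr0.
Qed.

Lemma ell2_eqP x y : (forall j, x j = y j) -> x = y.
Proof. by move=> h; apply: val_inj; apply/funext. Qed.

Lemma dot_eqP x y : (forall z, dot x z = dot y z) -> x = y.
Proof. by move=> h; apply: ell2_eqP => j; rewrite -!dot_basis h. Qed.

Lemma ell2_norm_sqrB x y : `|x - y| ^+ 2 = dot x x - 2 * dot x y + dot y y.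
Proof. by rewrite ell2_norm_sqr dotBl !dotBr (dotC y x); ring. Qed.

Lemma ell2_norm_sqrD x y : `|x + y| ^+ 2 = dot x x + 2 * dot x y + dot y y.
Proof. by rewrite ell2_norm_sqr dotDl !dotDr (dotC y x); ring. Qed.

Definition subspace D := D 0 /\ forall a x y, D x -> D y -> D (a *: x + y).

Lemma subspaceD D x y : subspace D -> D x -> D y -> D (x + y).
Proof. by move=> [_ h] Dx Dy; rewrite -[x]scale1r; exact: h. Qed.

Lemma subspaceZ D a x : subspace D -> D x -> D (a *: x).
Proof. by move=> [D0 h] Dx; rewrite -[_ *: _]addr0; exact: h. Qed.

Lemma subspaceB D x y : subspace D -> D x -> D y -> D (x - y).
Proof. by move=> sD Dx Dy; apply: subspaceD => //; rewrite -scaleN1r; exact: subspaceZ. Qed.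

(* The nearest-point sequence is Cauchy by the parallelogram law. *)
Lemma projection_seq D x : subspace D ->
  exists (s : nat -> ell2 R) (p : ell2 R),
    [/\ forall n, D (s n), s @ \oo --> p & forall y, D y -> dot (x - p) y = 0].
Proof.
move=> sD; have [D0 _] := sD.
pose S := [set `|x - d| ^+ 2 | d in D].
have hS : has_inf S.
  split; first by exists (`|x - 0| ^+ 2), 0.
  by exists 0 => _ [d _ <-]; exact: sqr_ge0.
pose delta := inf S.
have dle d : D d -> delta <= `|x - d| ^+ 2.
  by move=> Dd; apply: ge_inf; [case: hS|exists d].
have /choice[s hs] n : exists d, D d /\ `|x - d| ^+ 2 < delta + n.+1%:R^-1.
  have n0 : 0 < n.+1%:R^-1 :> R by rewrite invr_gt0.
  have [_ [d Dd <-] dlt] := inf_adherent n0 hS.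
  by exists d.
have Ds n : D (s n) by have [] := hs n.
have close m n : `|s m - s n| ^+ 2 <= 2 * m.+1%:R^-1 + 2 * n.+1%:R^-1.
  have /dle : D (2^-1 *: (s m + s n)) by apply: subspaceZ => //; exact: subspaceD.
  have [_] := hs m; have [_] := hs n; rewrite (ell2_norm_sqrB x (s n)).
  rewrite (ell2_norm_sqrB x (s m)) (ell2_norm_sqrB (s m) (s n)).
  rewrite (ell2_norm_sqrB x (2^-1 *: (s m + s n))) dotZr dotZl dotDr.
  rewrite dotZr -(ell2_norm_sqr (s m + s n)) (ell2_norm_sqrD (s m) (s n)).
  move: (dot x x) (dot x (s n)) (dot x (s m)) => a b c.
  move: (dot (s m) (s m)) (dot (s n) (s n)) (dot (s m) (s n)) => a' b' c'.
  by move: (n.+1%:R^-1) (m.+1%:R^-1) => u v; lra.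
have [p sp] : exists p : ell2 R, s @ \oo --> p.
  apply: ell2_cvg_seq => e e0.
  have [N hN] : exists N, 4 * N.+1%:R^-1 <= e ^+ 2.
    have e20 : 0 < e ^+ 2 / 4 by rewrite divr_gt0// exprn_gt0.
    have [N _ /(_ N (leqnn _))/= hN] := near_infty_natSinv_lt (PosNum e20).
    by exists N; move: hN; rewrite /= ltr_pdivlMr// mulrC => /ltW.
  exists N => m n Nm Nn; apply: ler_of_sqr; first exact: ltW.
  apply: le_trans (close m n) _; apply: le_trans hN.
  have inv k : (N <= k)%N -> k.+1%:R^-1 <= N.+1%:R^-1 :> R.
    by move=> Nk; rewrite lef_pV2 ?posrE// ler_nat.
  have := inv _ Nm; have := inv _ Nn.
  by move: (m.+1%:R^-1) (n.+1%:R^-1) (N.+1%:R^-1) => a b c; lra.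
exists s, p; split => // y Dy.
(* Moving [s n] by [t *: y] stays in D and can lower the squared distance by at most 1/(n + 1),
   since [s n] is that close to the infimum. *)
have lower t n : - n.+1%:R^-1 <= - 2 * t * dot (x - s n) y + t ^+ 2 * dot y y.
  have /dle : D (s n + t *: y) by apply: subspaceD => //; exact: subspaceZ.
  have [_] := hs n.
  have -> : x - (s n + t *: y) = (x - s n) - t *: y by rewrite opprD addrA.
  rewrite (ell2_norm_sqrB (x - s n) (t *: y)) (ell2_norm_sqr (x - s n)) !dotZr dotZl.
  move: (dot (x - s n) (x - s n)) (dot (x - s n) y) (dot y y) (n.+1%:R^-1) => a b c d.
  by lra.
have quad t : 0 <= - 2 * t * dot (x - p) y + t ^+ 2 * dot y y.
  have c : (fun n => - 2 * t * dot (x - s n) y + t ^+ 2 * dot y y) @ \oo -->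
      - 2 * t * dot (x - p) y + t ^+ 2 * dot y y.
    apply: cvgD; last exact: cvg_cst.
    apply: cvgM; first exact: cvg_cst.
    apply: cvg_dot; last exact: cvg_cst.
    by apply: cvgB => //; exact: cvg_cst.
  have c0 : (fun n => - n.+1%:R^-1 : R) @ \oo --> (0 : R).
    by rewrite -oppr0; apply: cvgN; exact: cvg_harmonic.
  by apply: ler_cvg_to c0 c _; apply: nearW => n; exact: lower.
have [y0|y0] := eqVneq (dot y y) 0; first by rewrite (dot_eq0 y0) dot0r.
have yp : 0 < dot y y by rewrite lt_neqAle eq_sym y0 dot_ge0.
(* This t minimises the quadratic, with minimum - a^2 / b. *)
have := quad (dot (x - p) y / dot y y).
set a := dot (x - p) y; set b := dot y y in y0 yp *.
rewrite (_ : _ + _ = - (a ^+ 2 / b)); last by field.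
rewrite oppr_ge0 pmulr_lle0 ?invr_gt0// => a2.
by apply/eqP; rewrite -[_ == _]sqrf_eq0 eq_le a2 sqr_ge0.
Qed.

Definition closed_subspaceW D : closed_subspace D -> subspace D.
Proof. by case. Qed.

Lemma projection_ex D x : closed_subspace D ->
  exists p, D p /\ forall y, D y -> dot (x - p) y = 0.
Proof.
move=> cD; have [s [p [Ds sp xp]]] := projection_seq x (closed_subspaceW cD).
exists p; split => //; case: cD => cD _ _.
by apply: (closed_cvg D cD (nearW _ Ds) p sp).
Qed.

(** Closedness is a premise inside the existential, so that [proj] is a total function of the set D
    and carries no proof; for other sets its values are arbitrary. *)
Lemma projector_ex D : exists P : ell2 R -> ell2 R, closed_subspace D ->
  forall x, D (P x) /\ forall y, D y -> dot (x - P x) y = 0.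
Proof.
have [cD|ncD] := pselect (closed_subspace D); last by exists id.
have /choice[P hP] x := projection_ex x cD.
by exists P.
Qed.

Definition proj D : ell2 R -> ell2 R := sval (cid (projector_ex D)).

Section projection.
Variables (D : set (ell2 R)) (cD : closed_subspace D).

Lemma proj_in x : D (proj D x).
Proof. by have [] := svalP (cid (projector_ex D)) cD x. Qed.

Lemma proj_orth x y : D y -> dot (x - proj D x) y = 0.
Proof. by have [_] := svalP (cid (projector_ex D)) cD x; exact. Qed.

Opaque proj.

Lemma proj_dot x y : D y -> dot (proj D x) y = dot x y.
Proof. by move=> /(proj_orth x); rewrite dotBl => /eqP; rewrite subr_eq0 => /eqP. Qed.

Lemma proj_unique x p : D p -> (forall y, D y -> dot (x - p) y = 0) -> proj D x = p.
Proof.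
move=> Dp h; apply/eqP; rewrite -subr_eq0; apply/eqP/dot_eq0.
have sD := closed_subspaceW cD.
have Dpp : D (proj D x - p) by exact: subspaceB (proj_in x) Dp.
rewrite {1}(_ : proj D x - p = (x - p) - (x - proj D x)).
  by rewrite dotBl h// proj_orth// subr0.
by rewrite opprB [RHS]addrC addrA subrK.
Qed.

Lemma proj_id x : D x -> proj D x = x.
Proof. by move=> Dx; apply: proj_unique => // y _; rewrite subrr dot0l. Qed.

Lemma projP a x y : proj D (a *: x + y) = a *: proj D x + proj D y.
Proof.
have sD := closed_subspaceW cD; apply: proj_unique.
  by case: sD => _; apply; exact: proj_in.
move=> z Dz.
have -> : a *: x + y - (a *: proj D x + proj D y) = a *: (x - proj D x) + (y - proj D y).
  by rewrite scalerBr opprD addrACA.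
by rewrite dotP (proj_orth x Dz) (proj_orth y Dz) mulr0 addr0.
Qed.

Lemma proj_self_adjoint x y : dot (proj D x) y = dot x (proj D y).
Proof.
rewrite -(proj_dot x (proj_in y)) [RHS]dotC (proj_dot y (proj_in x)).
exact: dotC.
Qed.

Lemma proj0 x : (forall y, D y -> dot x y = 0) -> proj D x = 0.
Proof.
move=> h; apply: proj_unique; first by case: cD.
by move=> y Dy; rewrite subr0 h.
Qed.

End projection.

Lemma cvg_limn_le (V : normedModType R) (s : nat -> V) (l : V) e : 0 < e ->
  s @ \oo --> l -> exists n, `|s n - l| < e.
Proof.
move=> e0 /cvgrPdist_lt /(_ e e0)[N _ hN].
by exists N; rewrite distrC; exact: hN (leqnn N).
Qed.

Definition lincomb (u : nat -> ell2 R) (c : seq R) : ell2 R :=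
  \sum_(i < size c) c`_i *: u i.

Definition lspan (u : nat -> ell2 R) : set (ell2 R) := [set lincomb u c | c in setT].

Lemma lincombP u v a c1 c2 : exists c3,
  lincomb u c3 = a *: lincomb u c1 + lincomb u c2 /\
  lincomb v c3 = a *: lincomb v c1 + lincomb v c2.
Proof.
pose n := maxn (size c1) (size c2).
have ext w c : (size c <= n)%N -> lincomb w c = \sum_(i < n) c`_i *: w i.
  move=> cn; rewrite /lincomb (big_ord_widen n (fun i => c`_i *: w i) cn) big_mkcond/=.
  apply: eq_bigr => i _; case: ifPn => //; rewrite -leqNgt => ci.
  by rewrite nth_default// scale0r.
suff h w : lincomb w (mkseq (fun i => a * c1`_i + c2`_i) n) = a *: lincomb w c1 + lincomb w c2.
  by exists (mkseq (fun i => a * c1`_i + c2`_i) n).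
rewrite !ext ?size_mkseq ?leq_maxl ?leq_maxr// scaler_sumr -big_split/=.
by apply: eq_bigr => i _; rewrite nth_mkseq// scalerDl scalerA.
Qed.

Lemma lspan_subspace u : subspace (lspan u).
Proof.
split; first by exists [::] => //; rewrite /lincomb big_ord0.
move=> a _ _ [c1 _ <-] [c2 _ <-]; have [c3 [h _]] := lincombP u u a c1 c2.
by exists c3.
Qed.

Lemma lspan_gen u i : lspan u (u i).
Proof.
exists (mkseq (fun j => (j == i)%:R) i.+1) => //.
rewrite /lincomb size_mkseq big_ord_recr/= nth_mkseq// eqxx scale1r big1 ?add0r// => j _.
by rewrite nth_mkseq ?(ltn_trans (ltn_ord j))// ltn_eqF// scale0r.
Qed.

Definition adherence D : set (ell2 R) :=
  [set x | forall e, 0 < e -> exists2 y, D y & `|x - y| < e].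

Lemma subset_adherence D : D `<=` adherence D.
Proof. by move=> x Dx e e0; exists x => //; rewrite subrr normr0. Qed.

Lemma adherence_closed_subspace D : subspace D -> closed_subspace (adherence D).
Proof.
move=> sD; split.
- move=> x xD e e0; have e20 : 0 < e / 2 by rewrite divr_gt0.
  have [y [/(_ _ e20)[z Dz yz]]] := xD _ (nbhsx_ballx x _ e20).
  rewrite -ball_normE/= => xy; exists z => //.
  rewrite -(subrK y x) -addrA (splitr e); apply: le_lt_trans (ler_normD _ _) _.
  exact: ltrD.
- by apply: subset_adherence; case: sD.
- move=> a x y Dx Dy e e0.
  have e20 : 0 < e / 2 by rewrite divr_gt0.
  have a1 : 0 < `|a| + 1 by rewrite ltr_wpDl.
  have ea : 0 < e / 2 / (`|a| + 1) by rewrite divr_gt0.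
  have [x' Dx' xx'] := Dx _ ea; have [y' Dy' yy'] := Dy _ e20.
  exists (a *: x' + y'); first by case: sD => _; exact.
  have -> : a *: x + y - (a *: x' + y') = a *: (x - x') + (y - y').
    by rewrite scalerBr opprD addrACA.
  apply: le_lt_trans (ler_normD _ _) _; rewrite normrZ (splitr e).
  apply: ler_ltD => //; move: xx'; rewrite ltr_pdivlMr// => /ltW.
  by apply: le_trans; rewrite mulrDr mulr1 mulrC lerDl.
Qed.

Lemma dot_adherence D x : (forall y, D y -> dot x y = 0) ->
  forall y, adherence D y -> dot x y = 0.
Proof.
move=> h y Dy; apply/eqP; rewrite -normr_le0; apply/ler_addgt0Pr => e e0.
have x1 : 0 < `|x| + 1 by rewrite ltr_wpDl.
have [z Dz yz] := Dy (e / (`|x| + 1)) (divr_gt0 e0 x1).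
have -> : dot x y = dot x (y - z) by rewrite dotBr (h z Dz) subr0.
rewrite add0r; apply: le_trans (dot_norm_le _ _) _.
move: yz; rewrite ltr_pdivlMr// => /ltW; apply: le_trans.
by rewrite mulrC ler_wpM2l// lerDl.
Qed.

Definition cspan u := adherence (lspan u).

Lemma cspan_closed u : closed_subspace (cspan u).
Proof. exact/adherence_closed_subspace/lspan_subspace. Qed.

Lemma cspan_gen u i : cspan u (u i).
Proof. exact/subset_adherence/lspan_gen. Qed.

Lemma dot_cspan u x : (forall i, dot x (u i) = 0) -> forall y, cspan u y -> dot x y = 0.
Proof.
move=> h; apply: dot_adherence => _ [c _ <-].
by rewrite dot_sumr big1// => i _; rewrite dotZr h mulr0.
Qed.

Lemma cspan_dot_inj u x y : cspan u x -> cspan u y ->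
  (forall i, dot x (u i) = dot y (u i)) -> x = y.
Proof.
move=> Dx Dy h; apply/eqP; rewrite -subr_eq0; apply/eqP/dot_eq0.
have Dxy := subspaceB (closed_subspaceW (cspan_closed u)) Dx Dy.
apply: (@dot_cspan u (x - y) _ _ Dxy) => i.
by rewrite dotBl (h i) subrr.
Qed.

Section gram_isometry.
Variables (u v : nat -> ell2 R).
Hypothesis uv : forall i j, dot (u i) (u j) = dot (v i) (v j).

Lemma gram_lincomb c c' : dot (lincomb u c) (lincomb u c') = dot (lincomb v c) (lincomb v c').
Proof.
rewrite /lincomb !dot_suml; apply: eq_bigr => i _.
rewrite !dot_sumr; apply: eq_bigr => j _.
by rewrite !dotZl !dotZr uv.
Qed.

(** The projection of x is approximated from the algebraic span of u, that is by finite
    combinations; the same coefficients on v give a sequence with the same mutual distances, and y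
    is its limit. Inner products with the generators determine y within [cspan v], which later
    yields both linearity and the inverse. *)
Lemma gram_map_ex x : exists y, [/\ cspan v y,
  forall i, dot y (v i) = dot x (u i) &
  dot y y = dot (proj (cspan u) x) (proj (cspan u) x)].
Proof.
have [s [p [Ds sp xp]]] := projection_seq x (lspan_subspace u).
have /choice[c cs] n : exists c, lincomb u c = s n by case: (Ds n) => c _ <-; exists c.
pose s' n := lincomb v (c n).
have s's m n : `|s' m - s' n| = `|s m - s n|.
  have e : `|s' m - s' n| ^+ 2 = `|s m - s n| ^+ 2.
    by rewrite !ell2_norm_sqrB -!cs !gram_lincomb.
  by apply/eqP; rewrite -(eqrXn2 (n := 2))// e.
have [y s'y] : exists y : ell2 R, s' @ \oo --> y.
  apply: ell2_cvg_seq => e e0.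
  have e20 : 0 < e / 2 by rewrite divr_gt0.
  move/cvgrPdist_lt : sp => /(_ _ e20)[N _ hN].
  exists N => m n Nm Nn; rewrite s's (_ : s m - s n = (p - s n) - (p - s m)); last first.
    by rewrite opprB [RHS]addrC addrA subrK.
  rewrite (splitr e); apply: le_trans (ler_normB _ _) _.
  by apply: lerD; apply: ltW; exact: hN.
have Dp : cspan u p.
  move=> e e0; have [n sn] := cvg_limn_le e0 sp.
  by exists (s n); [exists (c n)|rewrite distrC].
have pE : proj (cspan u) x = p.
  by apply: (proj_unique (cspan_closed u)) => //; exact: dot_adherence.
exists y; split.
- move=> e e0; have [n sn] := cvg_limn_le e0 s'y.
  by exists (s' n); [exists (c n)|rewrite distrC].
- move=> i; have -> : dot x (u i) = dot p (u i).
    by apply/eqP; rewrite -subr_eq0 -dotBl xp//; exact: lspan_gen.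
  have c1 : (fun n => dot (s n) (u i)) @ \oo --> dot p (u i).
    by apply: cvg_dot => //; exact: cvg_cst.
  have c2 : (fun n => dot (s' n) (v i)) @ \oo --> dot y (v i).
    by apply: cvg_dot => //; exact: cvg_cst.
  have e : (fun n => dot (s' n) (v i)) = (fun n => dot (s n) (u i)).
    apply/funext => n; rewrite -cs /s' /lincomb !dot_suml; apply: eq_bigr => j _.
    by rewrite !dotZl uv.
  by rewrite e in c2; exact: (cvg_unique _ c2 c1).
- rewrite pE.
  have c1 : (fun n => dot (s n) (s n)) @ \oo --> dot p p by exact: cvg_dot.
  have c2 : (fun n => dot (s' n) (s' n)) @ \oo --> dot y y by exact: cvg_dot.
  have e : (fun n => dot (s' n) (s' n)) = (fun n => dot (s n) (s n)).
    by apply/funext => n; rewrite -cs gram_lincomb.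
  by rewrite e in c2; exact: (cvg_unique _ c2 c1).
Qed.

Lemma gram_isometry_half : exists Q : {linear ell2 R -> ell2 R},
  [/\ forall x, cspan v (Q x), forall x i, dot (Q x) (v i) = dot x (u i) &
  forall x, dot (Q x) (Q x) = dot (proj (cspan u) x) (proj (cspan u) x)].
Proof.
have /choice[Q hQ] := gram_map_ex.
have Qlin : linear Q.
  move=> a x y; have [Dx hx _] := hQ x; have [Dy hy _] := hQ y.
  have [Dxy hxy _] := hQ (a *: x + y).
  have Dz : cspan v (a *: Q x + Q y) by case: (cspan_closed v) => _ _ h; exact: h.
  apply: (cspan_dot_inj Dxy Dz) => i.
  by rewrite hxy !dotP hx hy.
pose Qm := GRing.isLinear.Build R (ell2 R) (ell2 R) *:%R Q Qlin.
pose Ql : {linear ell2 R -> ell2 R} := HB.pack Q Qm.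
by exists Ql; split => x; have [] := hQ x.
Qed.

End gram_isometry.

Lemma gram_isometry u v : (forall i j, dot (u i) (u j) = dot (v i) (v j)) ->
  exists Q Q' : {linear ell2 R -> ell2 R},
  [/\ orthogonal_on (cspan u) (cspan v) Q, orthogonal_on (cspan v) (cspan u) Q',
      forall i, Q (u i) = v i, forall x, cspan u x -> Q' (Q x) = x &
      forall y, cspan v y -> Q (Q' y) = y].
Proof.
move=> uv; have vu i j : dot (v i) (v j) = dot (u i) (u j) by rewrite uv.
have [Q [Q1 Q2 Q3]] := gram_isometry_half uv.
have [Q' [Q'1 Q'2 Q'3]] := gram_isometry_half vu.
(* Polarisation: preservation of norms, applied to a sum, gives preservation of inner products. *)
have polar (w : nat -> ell2 R) (T : {linear ell2 R -> ell2 R}) :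
    (forall x, dot (T x) (T x) = dot (proj (cspan w) x) (proj (cspan w) x)) ->
    forall x y, cspan w x -> cspan w y -> dot (T x) (T y) = dot x y.
  move=> T3 x y Dx Dy.
  have Dxy := subspaceD (closed_subspaceW (cspan_closed w)) Dx Dy.
  have iso z : cspan w z -> dot (T z) (T z) = dot z z.
    by move=> Dz; rewrite T3 (proj_id (cspan_closed w) Dz).
  have := iso _ Dxy; rewrite (linearD T x y).
  rewrite -(ell2_norm_sqr (T x + T y)) -(ell2_norm_sqr (x + y)).
  rewrite (ell2_norm_sqrD (T x) (T y)) (ell2_norm_sqrD x y) (iso x Dx) (iso y Dy).
  by move: (dot (T x) (T y)) (dot x y) (dot x x) (dot y y) => a b c d; lra.
have QQ' x : cspan u x -> Q' (Q x) = x.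
  move=> Dx; apply: (cspan_dot_inj (Q'1 _) Dx) => i.
  by rewrite Q'2 Q2.
have Q'Q y : cspan v y -> Q (Q' y) = y.
  move=> Dy; apply: (cspan_dot_inj (Q1 _) Dy) => i.
  by rewrite Q2 Q'2.
exists Q, Q'; split; [| | |exact: QQ'|exact: Q'Q].
- split; [exact: cspan_closed|exact: (polar u Q Q3)| |].
    apply/seteqP; split => [_ [x _ <-]|y Dy]; first exact: Q1.
    by exists (Q' y); [exact: Q'1|exact: Q'Q].
  by move=> x h; apply: dot_eq0; rewrite Q3 (proj0 (cspan_closed u) h) dot0l.
- split; [exact: cspan_closed|exact: (polar v Q' Q'3)| |].
    apply/seteqP; split => [_ [x _ <-]|y Dy]; first exact: Q'1.
    by exists (Q y); [exact: Q1|exact: QQ'].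
  by move=> x h; apply: dot_eq0; rewrite Q'3 (proj0 (cspan_closed v) h) dot0l.
- move=> i; apply: (cspan_dot_inj (Q1 _) (cspan_gen _ _)) => j.
  by rewrite Q2 uv.
Qed.

End ell2_theory.

(** * Borel sets of the Krein space *)

Lemma lipschitz1_continuous (R : realType) (V W : normedModType R) (f : V -> W) :
  (forall x y, `|f x - f y| <= `|x - y|) -> continuous f.
Proof.
move=> h x; apply/cvgrPdist_lt => e e0.
have : \forall y \near x, ball x e y by exact: nbhsx_ballx.
by apply: filterS => y; rewrite -ball_normE/=; exact: le_lt_trans.
Qed.

Section krein_topology.
Variable R : realType.
Implicit Types (z : krein R).

Lemma krein_norm_sqr z : `|z| ^+ 2 = `|z.1| ^+ 2 + `|z.2| ^+ 2.
Proof.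
rewrite !ell2_norm_sqr [`|z|]/(Num.sqrt (majorant z z)) sqr_sqrtr//.
by rewrite addr_ge0 ?dot_ge0.
Qed.

Lemma krein_norm1_le z : `|z.1| <= `|z|.
Proof. by apply: ler_of_sqr => //; rewrite krein_norm_sqr lerDl sqr_ge0. Qed.

Lemma krein_norm2_le z : `|z.2| <= `|z|.
Proof. by apply: ler_of_sqr => //; rewrite krein_norm_sqr lerDr sqr_ge0. Qed.

Lemma krein_norm_le z : `|z| <= `|z.1| + `|z.2|.
Proof.
apply: ler_of_sqr; first by rewrite addr_ge0.
by rewrite krein_norm_sqr sqrrD lerD2r lerDl mulrn_wge0// mulr_ge0.
Qed.

Lemma krein_fstB z z' : (z - z').1 = z.1 - z'.1. Proof. by []. Qed.
Lemma krein_sndB z z' : (z - z').2 = z.2 - z'.2. Proof. by []. Qed.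

Lemma cvg_krein T (F : set_system T) {FF : Filter F} (f : T -> krein R) z :
  (f @ F --> z) <-> ((fun t => (f t).1) @ F --> z.1 /\ (fun t => (f t).2) @ F --> z.2).
Proof.
split.
  move=> /cvg_distP fz; split; apply/cvg_distP; move: fz; apply: squeeze_cvgr;
    try exact: cvg_cst; apply: nearW => t; rewrite normr_ge0/=.
  - by rewrite -krein_fstB krein_norm1_le.
  - by rewrite -krein_sndB krein_norm2_le.
move=> [/cvg_distP f1 /cvg_distP f2]; apply/cvg_distP.
apply: (@squeeze_cvgr _ _ _ _ (fun=> 0)
  (fun t => `|(f t).1 - z.1| + `|(f t).2 - z.2|)).
- by apply: nearW => t; rewrite normr_ge0/= -krein_fstB -krein_sndB krein_norm_le.
- exact: cvg_cst.
- by rewrite -[X in _ --> X]addr0; exact: cvgD.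
Qed.

Lemma continuous_krein_fst : continuous (fun z : krein R => z.1).
Proof. by apply: lipschitz1_continuous => x y; rewrite -krein_fstB krein_norm1_le. Qed.

Lemma continuous_krein_snd : continuous (fun z : krein R => z.2).
Proof. by apply: lipschitz1_continuous => x y; rewrite -krein_sndB krein_norm2_le. Qed.

Lemma open_measurable_kreinB (U : set (krein R)) : open U ->
  measurable (U : set (kreinB R)).
Proof. exact: sub_sigma_algebra. Qed.

Lemma closed_measurable_kreinB (U : set (krein R)) : closed U ->
  measurable (U : set (kreinB R)).
Proof.
move=> cU; rewrite -[U]setCK; apply: measurableC.
by apply: open_measurable_kreinB; exact: closed_openC.
Qed.

Lemma continuous_measurable_kreinB (f : krein R -> R) : continuous f ->
  measurable_fun setT (f : kreinB R -> R).
Proof.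
move=> /continuousP cf; apply: (measurability _ (RGenOpens.measurableE R)).
move=> _ [_ [a [b ->]] <-]; rewrite setTI; apply: open_measurable_kreinB.
by apply: cf; exact: interval_open.
Qed.

Lemma continuous_measurable_kreinBB (f : krein R -> krein R) : continuous f ->
  measurable_fun setT (f : kreinB R -> kreinB R).
Proof.
move=> /continuousP cf.
apply: (@measurability _ _ _ (kreinB R) _ _ (@open (krein R))) => //.
by move=> _ [U oU <-]; rewrite setTI; apply: open_measurable_kreinB; exact: cf.
Qed.

(** No sigma-field is put on [ell2 R]: measurable coordinates suffice for [dot], a pointwise limit
    of its partial sums. *)
Definition coord_measurable d (T : measurableType d) (f : T -> ell2 R) :=
  forall j, measurable_fun setT (fun t => f t j).

Lemma measurable_dot d (T : measurableType d) (f g : T -> ell2 R) :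
  coord_measurable f -> coord_measurable g ->
  measurable_fun setT (fun t => dot (f t) (g t)).
Proof.
move=> mf mg.
apply: (@measurable_fun_cvg _ _ _ _ (fun n t => series (fun j => f t j * g t j) n)).
  move=> n; rewrite /series/=.
  by apply: measurable_sum => j; apply: measurable_funM; [exact: mf|exact: mg].
by move=> t _; exact: is_cvg_dot.
Qed.

Lemma coord_measurable_cst d (T : measurableType d) (u : ell2 R) :
  coord_measurable (fun _ : T => u).
Proof. by move=> j; exact: measurable_cst. Qed.

Lemma coord_measurable_fst d (T : measurableType d) (f : T -> kreinB R) :
  measurable_fun setT f -> coord_measurable (fun t => (f t).1).
Proof.
move=> mf j; apply: (measurableT_comp (_ : measurable_fun setT (fun z : kreinB R => z.1 j))) => //.
apply: continuous_measurable_kreinB => z.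
apply: (@cvg_coord R _ (nbhs z) _ (fun t : krein R => t.1) z.1 j).
exact: continuous_krein_fst.
Qed.

Lemma coord_measurable_snd d (T : measurableType d) (f : T -> kreinB R) :
  measurable_fun setT f -> coord_measurable (fun t => (f t).2).
Proof.
move=> mf j; apply: (measurableT_comp (_ : measurable_fun setT (fun z : kreinB R => z.2 j))) => //.
apply: continuous_measurable_kreinB => z.
apply: (@cvg_coord R _ (nbhs z) _ (fun t : krein R => t.2) z.2 j).
exact: continuous_krein_snd.
Qed.

Lemma measurable_kdot d (T : measurableType d) (f g : T -> kreinB R) :
  measurable_fun setT f -> measurable_fun setT g ->
  measurable_fun setT (fun t => kdot (f t) (g t)).
Proof.
move=> mf mg; apply: measurable_funB; apply: measurable_dot.
- exact: coord_measurable_fst.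
- exact: coord_measurable_fst.
- exact: coord_measurable_snd.
- exact: coord_measurable_snd.
Qed.

Lemma measurable_krein_norm : measurable_fun setT (fun z : kreinB R => `|z : krein R|).
Proof. by apply: continuous_measurable_kreinB; exact: norm_continuous. Qed.

Lemma closed_kreinX (D D' : set (ell2 R)) : closed D -> closed D' ->
  closed (D `*` D' : set (krein R)).
Proof.
move=> cD cD'; apply: closedI.
  by apply: (closed_comp _ cD) => z _; exact: continuous_krein_fst.
by apply: (closed_comp _ cD') => z _; exact: continuous_krein_snd.
Qed.

Lemma kreinB_measure_unique (m1 m2 : {measure set (kreinB R) -> \bar R}) :
  (m1 setT < +oo)%E ->
  (forall C : set (krein R), closed C -> m1 C = m2 C) ->
  forall A, measurable A -> m1 A = m2 A.
Proof.
move=> m1oo h A mA; apply: (@measure_unique _ R (kreinB R) (@closed (krein R)) (fun=> setT)) => //.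
- apply/seteqP; split.
    apply: smallest_sub; first exact: smallest_sigma_algebra.
    move=> U oU; rewrite -[U]setCK; apply: sigma_algebraC.
    by apply: sub_sigma_algebra; exact: open_closedC.
  apply: smallest_sub; first exact: sigma_algebra_measurable.
  exact: closed_measurable_kreinB.
- by move=> ? ?; exact: closedI.
- by rewrite bigcup_const.
Qed.

End krein_topology.

(** * Isometries of closed subspaces, extended by 0 *)

Section orthogonal_maps.
Variable R : realType.
Implicit Types (D : set (ell2 R)) (Q : {linear ell2 R -> ell2 R}).

Lemma orthogonal_onE D D' Q x : orthogonal_on D D' Q -> Q x = Q (proj D x).
Proof.
move=> [cD _ _ Q0].
have h : Q (x - proj D x) = 0 by apply: Q0 => y Dy; exact: (proj_orth cD).
by apply/eqP; rewrite -subr_eq0 -(linearB Q) h.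
Qed.

Lemma orthogonal_on_norm D D' Q x : orthogonal_on D D' Q -> `|Q x| <= `|x|.
Proof.
move=> oQ; rewrite (orthogonal_onE x oQ); have [cD iso _ _] := oQ.
apply: ler_of_sqr => //; rewrite !ell2_norm_sqr (iso _ _ (proj_in cD x) (proj_in cD x)).
have -> : dot x x = dot (proj D x) (proj D x) + dot (x - proj D x) (x - proj D x).
  rewrite -(ell2_norm_sqr (x - _)) (ell2_norm_sqrB x) -(proj_dot cD x (proj_in cD x)).
  by move: (dot x x) (dot _ _) => a b; ring.
by rewrite lerDl dot_ge0.
Qed.

Lemma orthogonal_on_continuous D D' Q : orthogonal_on D D' Q -> continuous Q.
Proof.
move=> oQ; apply: lipschitz1_continuous => x y.
by rewrite -(linearB Q); exact: orthogonal_on_norm oQ.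
Qed.

Lemma orthogonal_setT Q : Defs.orthogonal Q -> orthogonal_on setT setT Q.
Proof.
move=> [iso sur]; split.
- by split => //; exact: closedT.
- by move=> x y _ _; exact: iso.
- by apply/seteqP; split => // y _; have [x <-] := sur y; exists x.
- by move=> x h; rewrite (dot_eq0 (h x I)) linear0.
Qed.

Lemma measurable_transform Dp Dp' Dn Dn' (Qp Qn : {linear ell2 R -> ell2 R}) :
  orthogonal_on Dp Dp' Qp -> orthogonal_on Dn Dn' Qn ->
  measurable_fun setT (transform Qp Qn).
Proof.
move=> oQp oQn; apply: continuous_measurable_kreinBB.
apply: lipschitz1_continuous => x y; apply: ler_of_sqr => //.
rewrite !krein_norm_sqr !krein_fstB !krein_sndB /= -(linearB Qp) -(linearB Qn).
apply: lerD; apply: lerXn2r => //; rewrite ?nnegrE//.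
  exact: orthogonal_on_norm oQp.
exact: orthogonal_on_norm oQn.
Qed.

End orthogonal_maps.

(** * Sampling from a graph root distribution *)

Section product_probability.
Context d1 d2 (T1 : measurableType d1) (T2 : measurableType d2) (R : realType).
Variables (P1 : probability T1 R) (P2 : probability T2 R).
Local Open Scope ereal_scope.

Definition pprod : set (T1 * T2) -> \bar R := P1 \x P2.

HB.instance Definition _ := Measure.on pprod.

Let pprodT : pprod setT = 1.
Proof.
transitivity (P1 setT * P2 setT); last first.
  by rewrite !probability_setT mule1.
by rewrite -product_measure1E// setXTT.
Qed.

HB.instance Definition _ := Measure_isProbability.Build _ _ _ pprod pprodT.

End product_probability.

Section pair_law.
Context d (W : measurableType d) (R : realType) (Pr : probability W R).
Local Open Scope ereal_scope.

Lemma pair_law_unique d1 d2 (T1 : measurableType d1) (T2 : measurableType d2)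
    (F1 : probability T1 R) (F2 : probability T2 R) (X : W -> T1) (Y : W -> T2) :
  measurable_fun setT X -> measurable_fun setT Y ->
  (forall A B, measurable A -> measurable B ->
     Pr (X @^-1` A `&` Y @^-1` B) = F1 A * F2 B) ->
  forall E, measurable E -> Pr [set w | E (X w, Y w)] = (F1 \x F2) E.
Proof.
move=> mX mY h E mE.
have mXY : measurable_fun setT (fun w => (X w, Y w)) by exact: measurable_fun_pair.
pose XY : {mfun W >-> (T1 * T2)%type} := HB.pack (fun w => (X w, Y w))
  (isMeasurableFun.Build _ _ _ _ _ mXY).
rewrite (@product_measure_unique _ _ _ _ _ F1 F2 (pushforward Pr XY))//; exact: h.
Qed.

Context (F : probability (kreinB R) R) (Z : nat -> W -> kreinB R).
Hypothesis iidZ : iid Pr Z F.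

Lemma iid_pair i j (A B : set (kreinB R)) : i != j -> measurable A -> measurable B ->
  Pr (Z i @^-1` A `&` Z j @^-1` B) = F A * F B.
Proof.
move=> ij mA mB.
pose n := (maxn i j).+1.
have iln : (i < n)%N by rewrite ltnS leq_maxl.
have jln : (j < n)%N by rewrite ltnS leq_maxr.
pose C l := if l == i then A else if l == j then B else setT.
have := iidZ.2 n C; rewrite (bigD1 (Ordinal iln))//= (bigD1 (Ordinal jln))/=; last first.
  by rewrite -val_eqE/= eq_sym.
rewrite /C eqxx (negbTE (_ : j != i)) ?eqxx; last by rewrite eq_sym.
rewrite big1; last first.
  move=> l; rewrite -!val_eqE/= => /andP[/negbTE -> /negbTE ->].
  exact: probability_setT.
rewrite mule1 => <-; last by move=> l; case: ifP => // _; case: ifP.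
congr (Pr _); apply/seteqP; split => w /=.
  by move=> [Aw Bw] l _; case: eqP => [->//|_]; case: eqP => [->|].
move=> h; split.
  by have := h i iln; rewrite eqxx.
by have := h j jln; rewrite eqxx (negbTE (_ : j != i))// eq_sym.
Qed.

Lemma iid_pair_law i j (E : set (kreinB R * kreinB R)) : i != j -> measurable E ->
  Pr [set w | E (Z i w, Z j w)] = (F \x F) E.
Proof.
move=> ij mE; apply: pair_law_unique => //; [exact: iidZ.1|exact: iidZ.1|].
by move=> A B mA mB; exact: iid_pair.
Qed.

Lemma iid_law i (B : set (kreinB R)) : measurable B -> Pr (Z i @^-1` B) = F B.
Proof.
move=> mB; have := @iid_pair i i.+1 B setT; rewrite preimage_setT setIT => ->//.
  by rewrite probability_setT mule1.
by rewrite ltn_eqF.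
Qed.

Lemma measurable_kdot_itv : measurable
  [set z : kreinB R * kreinB R | (0 <= kdot z.1 z.2 <= 1)%R].
Proof.
rewrite (_ : mkset _ = (fun z : kreinB R * kreinB R => kdot z.1 z.2) @^-1` `[0%R, 1%R]%classic).
  by apply: preimage_measurable => //; exact: measurable_kdot.
by apply/seteqP; split => z; rewrite /= in_itv.
Qed.

Lemma iid_kdot_itv i j : is_grd F -> i != j ->
  {ae Pr, forall w, (0 <= kdot (Z i w) (Z j w) <= 1)%R}.
Proof.
move=> grd ij; apply: ae_full; last by rewrite (iid_pair_law ij measurable_kdot_itv).
exact: (preimage_measurable (measurable_fun_pair (iidZ.1 i) (iidZ.1 j)) measurable_kdot_itv).
Qed.

End pair_law.

Section sample_existence.
Context (R : realType) (F : probability (kreinB R) R).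
Hypothesis grdF : is_grd F.
Local Open Scope ereal_scope.

Let mR := measurableTypeR R.
Let U : probability mR R := uniform_prob (@ltr01 R).

Lemma measurable_le_set (p : R) (b : bool) : measurable [set x : mR | (x <= p)%R = b].
Proof.
have h : measurable [set x : mR | (x <= p)%R = true].
  by rewrite (_ : mkset _ = `]-oo, p]%classic).
case: b => //; rewrite (_ : mkset _ = ~` [set x : mR | (x <= p)%R = true]).
  exact: measurableC.
by apply/seteqP; split => x /=; case: (x <= p)%R.
Qed.

Lemma uniform_le_pmf (p : R) (b : bool) : (0 <= p <= 1)%R ->
  U [set x : mR | (x <= p)%R = b] = (bernoulli_pmf p b)%:E.
Proof.
move=> /andP[p0 p1].
have Ule : U [set x : mR | (x <= p)%R = true] = p%:E.
  rewrite /U/= /uniform_prob integral_uniform_pdf.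
  rewrite (_ : _ `&` _ = `[0%R, p]%classic); last first.
    apply/seteqP; split => x /=; rewrite !in_itv/=.
      by move=> [-> /andP[-> _]].
    by move=> /andP[x0 xp]; rewrite x0 xp (le_trans xp p1).
  rewrite (eq_integral (fun=> 1)); last first.
    move=> x; rewrite inE/= in_itv/= => /andP[x0 xp].
    by rewrite /uniform_pdf x0 (le_trans xp p1)/= subr0 invr1.
  rewrite integral_cst//= mul1e lebesgue_measure_itv/= lte_fin.
  by case: ltP => [_|p0']; rewrite ?sube0//; congr (_%:E); apply/eqP; rewrite eq_le p0 p0'.
have mle := measurable_le_set p true.
case: b; first exact: Ule.
rewrite (_ : mkset _ = ~` [set x : mR | (x <= p)%R = true]); last first.
  by apply/seteqP; split => x /=; case: (x <= p)%R.
by rewrite probability_setC// Ule /bernoulli_pmf EFinB.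
Qed.

Let WZ := seqspace (kreinB R).
Let WU := seqspace (seqspace mR).

Let PZ : probability WZ R := iprod F.
Let PU : probability WU R := iprod (iprod U).

Definition sample_root (i : nat) (w : WZ * WU) : kreinB R := w.1 i.

(** An edge is present when the uniform variable of its pair falls below the kernel. The larger
    vertex indexes first in [w.2], so that a pattern on n vertices is a rectangle of rectangles in
    the order of the products in [graph_sample]. *)
Definition sample_edge (w : WZ * WU) : array := fun i j =>
  if (i < j)%N then (w.2 j i <= kdot (w.1 i) (w.1 j))%R
  else if (j < i)%N then (w.2 i j <= kdot (w.1 j) (w.1 i))%R else false.

Lemma sample_edge_lt w i j : (i < j)%N ->
  sample_edge w i j = (w.2 j i <= kdot (w.1 i) (w.1 j))%R.
Proof. by rewrite /sample_edge => ->. Qed.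

Lemma measurable_sample_root i : measurable_fun setT (sample_root i).
Proof. exact: (measurableT_comp (measurable_coord i) measurable_fst). Qed.

Lemma measurable_sample_edge_ij i j : measurable_fun setT (fun w => sample_edge w i j).
Proof.
have mle k l : measurable_fun setT (fun w : WZ * WU => (w.2 l k <= kdot (w.1 k) (w.1 l))%R).
  apply: measurable_fun_ler.
    have h := measurableT_comp (@measurable_coord _ (seqspace mR) l) (@measurable_snd _ _ WZ WU).
    exact: (measurableT_comp (@measurable_coord _ mR k) h).
  by apply: measurable_kdot; exact: measurable_sample_root.
rewrite /sample_edge; case: (ltnP i j) => // _; case: (ltnP j i) => // _.
Qed.

Lemma measurable_sample_edge : measurable_fun setT sample_edge.
Proof.
apply: (@measurability _ _ _ array _ _ entry_sets) => //.
move=> _ [_ [i [j ->]] <-].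
have -> : sample_edge @^-1` [set a : nat -> nat -> bool | a i j] =
    (fun w => sample_edge w i j) @^-1` [set true] by [].
exact: measurable_sample_edge_ij.
Qed.

Lemma iid_sample_root : iid (pprod PZ PU) sample_root F.
Proof.
split; first exact: measurable_sample_root.
move=> n B mB; rewrite /= /pprod.
rewrite (_ : mkset _ = rect n B `*` setT); last first.
  by apply/seteqP; split => w /=; [move=> h; split|case].
have mr := measurable_rect n mB.
transitivity (PZ (rect n B) * PU setT); first exact: product_measure1E.
by rewrite probability_setT mule1; exact: iprod_rect.
Qed.

Definition pmf_prod n (a : nat -> nat -> bool) (z : nat -> kreinB R) : R :=
  \prod_(j < n) \prod_(i < j) bernoulli_pmf (kdot (z i) (z j)) (a i j).

Lemma measurable_pmf_prod d (T : measurableType d) n a (z : nat -> T -> kreinB R) :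
  (forall i, measurable_fun setT (z i)) ->
  measurable_fun setT (fun t => pmf_prod n a (z ^~ t)).
Proof.
move=> mz; apply: measurable_prod => j _; apply: measurable_prod => i _.
have h := measurable_kdot (mz i) (mz j).
by rewrite /bernoulli_pmf; case: (a i j) => //; exact: measurable_funB.
Qed.

Lemma sample_section n a (z : WZ) :
  (forall i j, (i < j < n)%N -> (0 <= kdot (z i) (z j) <= 1)%R) ->
  PU [set u | forall i j, (i < j < n)%N -> sample_edge (z, u) i j = a i j] =
  (pmf_prod n a z)%:E.
Proof.
move=> z01.
pose B j i := [set x : mR | (x <= kdot (z i) (z j))%R = a i j].
have mB j i : measurable (B j i) by exact: measurable_le_set.
rewrite (_ : mkset _ = rect n (fun j => rect j (B j))); last first.
  apply/seteqP; split => u /= h.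
    by move=> j jn i ij; have := h i j; rewrite ij jn sample_edge_lt// => /(_ isT).
  move=> i j /andP[ij jn]; rewrite sample_edge_lt//.
  exact: (h j jn i ij).
transitivity (\prod_(j < n) iprod U (rect j (B j))).
  by apply: iprod_rect => j; exact: measurable_rect.
rewrite /pmf_prod -prodEFin; apply: eq_bigr => j _.
rewrite iprod_rect// -prodEFin; apply: eq_bigr => i _.
by rewrite uniform_le_pmf// z01// !ltn_ord.
Qed.

(** Events of the roots are cylinders over the first factor; the conditional clause of
    [graph_sample] thus reduces to integrating, over z, the probability of the section in u. *)
Lemma sigma_of_sample C : sigma_of sample_root C ->
  exists C0 : set WZ, measurable C0 /\ C = fst @^-1` C0.
Proof.
move: C; apply: smallest_sub.
  split.
  - by exists set0; rewrite preimage_set0.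
  - move=> _ [A [mA ->]]; exists (~` A); split; first exact: measurableC.
    by rewrite setTD.
  - move=> G hG; have /choice[H hH] n : exists A, measurable A /\ G n = fst @^-1` A.
      exact: hG.
    exists (\bigcup_n H n); split; first by apply: bigcupT_measurable => n; case: (hH n).
    by rewrite preimage_bigcup; apply: eq_bigcupr => n _; case: (hH n).
move=> _ [i [B [mB ->]]]; exists [set z | B (z i)]; split => //.
exact: (preimage_measurable (measurable_coord i)).
Qed.

Lemma graph_sample_exists : graph_sample (pprod PZ PU) sample_root sample_edge F.
Proof.
split.
- exact: iid_sample_root.
- exact: measurable_sample_edge.
- move=> w i j; rewrite /sample_edge.
  by case: (ltngtP i j).
- by move=> w i; rewrite /sample_edge ltnn.
move=> n a C /sigma_of_sample[C0 [mC0 ->]].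
pose A := [set w : WZ * WU | forall i j, (i < j < n)%N -> sample_edge w i j = a i j].
have mA : measurable A.
  rewrite (_ : A = \bigcap_i \bigcap_j [set w | (i < j < n)%N -> sample_edge w i j = a i j]).
    apply: bigcapT_measurable => i; apply: bigcapT_measurable => j.
    case: (boolP (i < j < n)%N) => ij.
      rewrite (_ : mkset _ = (fun w => sample_edge w i j) @^-1` [set a i j]).
        exact: (preimage_measurable (measurable_sample_edge_ij i j)).
      by apply/seteqP; split => w /=; [exact|].
    by rewrite (_ : mkset _ = setT)//; apply/seteqP; split.
  apply/seteqP; split => w h; first by move=> i _ j _; exact: h.
  by move=> i j; exact: (h i I j I).
pose good := [set z : WZ | forall i j, (i < j < n)%N -> (0 <= kdot (z i) (z j) <= 1)%R].
have iidPZ : iid PZ (fun i (z : WZ) => z i) F.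
  split; first by move=> i; exact: measurable_coord.
  by move=> m B mB; rewrite -iprod_rect.
have aegood : {ae PZ, forall z, good z}.
  apply: (@ae_foralln _ _ _ PZ (fun i z => forall j, (i < j < n)%N -> (0 <= kdot (z i) (z j) <= 1)%R)).
  move=> i; apply: (@ae_foralln _ _ _ PZ (fun j z => (i < j < n)%N -> (0 <= kdot (z i) (z j) <= 1)%R)) => j.
  have [ij|ij] := boolP (i < j)%N; last exact: aeW.
  have ij' : i != j by rewrite ltn_eqF.
  by apply: filterS (iid_kdot_itv iidPZ grdF ij') => z h _.
have mC : measurable (fst @^-1` C0 : set (WZ * WU)).
  exact: (preimage_measurable measurable_fst).
have mpmf : measurable_fun setT (fun z : WZ => pmf_prod n a z).
  by apply: measurable_pmf_prod => i; exact: measurable_coord.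
have mpmfZ : measurable_fun setT (fun w : WZ * WU => pmf_prod n a w.1).
  exact: (measurableT_comp mpmf measurable_fst).
(* The Bernoulli product is nonnegative only for almost every z; the absolute value makes f
   nonnegative everywhere, as Tonelli requires. *)
pose f (z : WZ) : \bar R := (\1_C0 z * `|pmf_prod n a z|)%:E.
have mf : measurable_fun setT f.
  apply/measurable_EFinP; apply: measurable_funM; first exact: measurable_indic.
  exact: measurableT_comp.
have f0 z : 0 <= f z by rewrite lee_fin mulr_ge0.
have aepos : {ae PZ, forall z, (0 <= pmf_prod n a z)%R}.
  apply: filterS aegood => z hz; rewrite /pmf_prod; apply: prodr_ge0 => j _.
  by apply: prodr_ge0 => i _; apply: bernoulli_pmf_ge0; apply: hz; rewrite !ltn_ord.
transitivity (\int[PZ]_z f z).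
  rewrite [LHS]/= /product_measure1/=.
  apply: ae_eq_integral => //.
    by apply: measurable_fun_xsection; exact: measurableI.
  apply: filterS aegood => z gz _.
  rewrite /f; have [zC|zC] := boolP (z \in C0).
    rewrite indicE zC mul1r ger0_norm; last first.
      rewrite /pmf_prod; apply: prodr_ge0 => j _.
      by apply: prodr_ge0 => i _; apply: bernoulli_pmf_ge0; apply: gz; rewrite !ltn_ord.
    rewrite -sample_section//; congr (PU _).
    apply/seteqP; split => u; rewrite /xsection/= inE/=; first by case.
    by move=> h; split => //; rewrite inE in zC.
  transitivity (PU set0); last by rewrite measure0 indicE (negbTE zC) mul0r.
  congr (PU _).
  by apply/seteqP; split => u //; rewrite /xsection/= inE/= => -[Cz _]; rewrite notin_setE in zC.
rewrite [RHS]integral_mkcond.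
transitivity (\int[pprod PZ PU]_w f w.1).
  rewrite [RHS](@fubini_tonelli1 _ _ _ _ _ PZ PU (fun w => f w.1))//; last first.
    exact: (measurableT_comp mf measurable_fst).
  apply: eq_integral => z _; rewrite /fubini_F/= integral_cst//.
  by rewrite [X in _ * X]probability_setT mule1.
apply: ae_eq_integral => //.
- exact: (measurableT_comp mf measurable_fst).
- apply/(measurable_restrictT _ mC); apply/measurable_funTS.
  exact/measurable_EFinP.
- have [N [mN N0 hN]] := aepos.
  exists (N `*` setT); split; first exact: measurableX.
    transitivity (PZ N * PU setT); first exact: product_measure1E.
    by rewrite N0 mul0e.
  move=> w /= hw; split => //; apply: hN => /= pw; apply: hw => _; rewrite /f patchE.
  have [zC|zC] := boolP (w.1 \in C0).
    rewrite indicE zC mul1r ger0_norm// (_ : w \in _ = true)//.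
  rewrite indicE (negbTE zC) mul0r ifF//; apply/negP; rewrite inE/=.
  by rewrite notin_setE in zC.
Qed.

End sample_existence.

(** * From a carried isometry to equal sampling distributions *)

Section transfer.
Context (R : realType).
Local Open Scope ereal_scope.

(** The equivalence is tested on the identity of [kreinB R] under F1, whose law is F1 itself. *)
Lemma law_iff_pushforward (F1 F2 : probability (kreinB R) R) (D : set (kreinB R))
    (T : kreinB R -> kreinB R) :
  (forall d (W : measurableType d) (Pr : probability W R) (Z : W -> kreinB R),
    measurable_fun setT Z -> Pr (Z @^-1` D) = 1 -> has_law Pr Z F1 <-> has_law Pr (T \o Z) F2) ->
  F1 D = 1 -> forall B, measurable B -> F2 B = F1 (T @^-1` B).
Proof.
move=> h D1 B mB; have hl : has_law F1 id F1 by split; [exact: measurable_id|].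
by have [/(_ hl)[_ <-]] := h _ _ F1 id (@measurable_id _ (kreinB R) setT) D1.
Qed.

Lemma ot_eq_carried_pushforward (F1 F2 : probability (kreinB R) R) :
  ot_eq_carried F1 F2 -> exists (D : set (kreinB R)) (T : kreinB R -> kreinB R),
    [/\ measurable D, F1 D = 1, measurable_fun setT T,
      forall z z', D z -> D z' -> kdot (T z) (T z') = kdot z z' &
      forall B, measurable B -> F2 B = F1 (T @^-1` B)].
Proof.
move=> [Dp [Dp' [Dn [Dn' [Qp [Qn [oQp oQn F1D h]]]]]]].
have [cDp isop _ _] := oQp; have [cDn ison _ _] := oQn.
have mT := measurable_transform oQp oQn.
exists (Dp `*` Dn), (transform Qp Qn); split => //.
- apply: closed_measurable_kreinB; apply: closed_kreinX.
    by case: cDp.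
  by case: cDn.
- by move=> z z' [z1 z2] [z1' z2']; rewrite /kdot/= isop// ison.
- exact: law_iff_pushforward h F1D.
Qed.

(** The graph is kept and only the roots are moved. The sigma-field of the moved roots is contained
    in that of Z, so the conditional clause for Z applies to the same C; the integrands agree
    because the roots lie in D almost surely. *)
Lemma graph_sample_transfer (F1 F2 : probability (kreinB R) R) (D : set (kreinB R))
    (T : kreinB R -> kreinB R)
    d (W : measurableType d) (Pr : probability W R) Z A :
  measurable D -> F1 D = 1 -> measurable_fun setT T ->
  (forall z z', D z -> D z' -> kdot (T z) (T z') = kdot z z') ->
  (forall B, measurable B -> F2 B = F1 (T @^-1` B)) ->
  graph_sample Pr Z A F1 -> graph_sample Pr (fun i => T \o Z i) A F2.
Proof.
move=> mD D1 mT isoT F12 [iidZ mA symA irrA hA].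
have mTZ i : measurable_fun setT (T \o Z i) by exact: measurableT_comp (iidZ.1 i).
have mTB (B : set (kreinB R)) : measurable B -> measurable (T @^-1` B).
  exact: preimage_measurable.
split => //.
- split=> // n B mB; rewrite [RHS](eq_bigr (fun i : 'I_n => F1 (T @^-1` B i))); last first.
    by move=> i _; rewrite F12.
  by rewrite -(iidZ.2 n (fun i => T @^-1` B i))// => i; exact: mTB.
move=> n a C sC.
have sC' : sigma_of Z C.
  move: C sC; apply: smallest_sub; first exact: smallest_sigma_algebra.
  move=> _ [i [B [mB ->]]]; apply: sub_sigma_algebra.
  by exists i, (T @^-1` B); split => //; exact: mTB.
have mC : measurable C.
  move: C sC sC'; move=> C _; move: C; apply: smallest_sub; first exact: sigma_algebra_measurable.
  by move=> _ [i [B [mB ->]]]; exact: (preimage_measurable (iidZ.1 i)).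
rewrite hA//; apply: ae_eq_integral => //.
- by apply/measurable_EFinP/measurable_funTS; exact: measurable_pmf_prod iidZ.1.
- by apply/measurable_EFinP/measurable_funTS; exact: measurable_pmf_prod mTZ.
have : {ae Pr, forall w, forall i, D (Z i w)}.
  apply: ae_foralln => i; apply: (ae_full (B := Z i @^-1` D)).
    exact: (preimage_measurable (iidZ.1 i)).
  by rewrite (iid_law iidZ).
apply: filterS => w Dw _; congr (_%:E).
by apply: eq_bigr => j _; apply: eq_bigr => i _; rewrite /= isoT.
Qed.

Lemma ot_eq_carried_same_sampling (F1 F2 : probability (kreinB R) R) :
  is_grd F1 -> ot_eq_carried F1 F2 -> same_sampling_distribution F1 F2.
Proof.
move=> grd1 /ot_eq_carried_pushforward[D [T [mD D1 mT isoT F12]]].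
have sample1 := graph_sample_exists grd1.
have mA := @measurable_sample_edge R.
have sample2 := graph_sample_transfer mD D1 mT isoT F12 sample1.
pose Pr : probability _ R := pprod (iprod F1) (iprod (iprod (uniform_prob (@ltr01 R)))).
pose A : {mfun _ >-> array} := HB.pack (@sample_edge R) (isMeasurableFun.Build _ _ _ _ _ mA).
pose mu : probability array R := distribution Pr A.
have law : has_law Pr (@sample_edge R) mu by split.
exists mu; split.
  by exists _, _, Pr, (@sample_root R), (@sample_edge R); split.
exists _, _, Pr, (fun i => T \o @sample_root R i), (@sample_edge R).
by split.
Qed.

End transfer.

(** * Polynomial approximation of spectral projections *)

Section riesz.
Variable R : realType.
Implicit Types u v : ell2 R.

Definition trunc n u : ell2 R := \sum_(i < n) u i *: basis_vec R i.

Lemma dot_trunc n u v : dot (trunc n u) v = \sum_(i < n) u i * v i.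
Proof. by rewrite dot_suml; apply: eq_bigr => i _; rewrite dotZl dotC dot_basis. Qed.

Lemma trunc_coord n u j : trunc n u j = if (j < n)%N then u j else 0.
Proof.
rewrite -dot_basis dot_trunc; case: ltnP => jn.
  rewrite (bigD1 (Ordinal jn))//= eqxx mulr1 big1 ?addr0// => i.
  by rewrite -val_eqE/= => /negbTE ->; rewrite mulr0.
rewrite big1// => i _; rewrite /= (_ : (i == j :> nat) = false) ?mulr0//.
by apply/negbTE; rewrite neq_ltn (leq_trans (ltn_ord i) jn).
Qed.

Lemma trunc_cvg u : (fun n => trunc n u) @ \oo --> u.
Proof.
apply/cvgrPdist_lt => e e0.
have c : (fun n => dot u u - \sum_(0 <= j < n) u j * u j) @ \oo --> dot u u - dot u u.
  by apply: cvgB; [exact: cvg_cst|exact: is_cvg_dot].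
rewrite subrr in c.
have e20 : 0 < e ^+ 2 by rewrite exprn_gt0.
move/cvgrPdist_lt : c => /(_ _ e20); apply: filterS => n.
rewrite sub0r normrN => h; rewrite ltNge; apply/negP => eu.
have : e ^+ 2 <= `|u - trunc n u| ^+ 2 by apply: lerXn2r => //; rewrite nnegrE// ltW.
rewrite (ell2_norm_sqrB u (trunc n u)) (dotC u (trunc n u)) !dot_trunc.
have -> : \sum_(i < n) u i * trunc n u i = \sum_(i < n) u i * u i.
  by apply: eq_bigr => i _; rewrite trunc_coord ltn_ord.
move: h; rewrite big_mkord; move: (dot u u) (\sum_(i < n) u i * u i) => a b.
by move=> /(le_lt_trans (ler_norm _)); lra.
Qed.

Lemma riesz (phi : ell2 R -> R) C :
  (forall a u v, phi (a *: u + v) = a * phi u + phi v) ->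
  (forall u, `|phi u| <= C * `|u|) -> exists w, forall u, phi u = dot w u.
Proof.
move=> phiP phiC.
have phi0 : phi 0 = 0 by have := phiP 1 0 0; rewrite scaler0 addr0; lra.
have phiS n (c : nat -> R) : phi (\sum_(i < n) c i *: basis_vec R i) =
    \sum_(i < n) c i * phi (basis_vec R i).
  elim: n => [|n ih]; first by rewrite !big_ord0.
  by rewrite !big_ord_recr/= addrC phiP ih addrC.
have C0 : 0 <= C.
  have := phiC (basis_vec R 0); have : 0 < `|basis_vec R 0|.
    rewrite normr_gt0; apply/eqP => e.
    have := dot_basis (basis_vec R 0) 0; rewrite {1}e dot0l /= => /esym/eqP.
    by rewrite oner_eq0.
  move=> e0 h; rewrite -(pmulr_lge0 _ e0); exact: le_trans (normr_ge0 _) h.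
pose c j := phi (basis_vec R j).
(* Testing phi at the truncated candidate w gives |w|^2 = phi w <= C |w|, a bound uniform in n. *)
have cs n : \sum_(0 <= j < n) c j ^+ 2 <= C ^+ 2.
  pose w : ell2 R := \sum_(i < n) c i *: basis_vec R i.
  have S : phi w = \sum_(0 <= j < n) c j ^+ 2.
    by rewrite /w phiS big_mkord; apply: eq_bigr => i _; rewrite expr2.
  have wj (i : 'I_n) : w i = c i.
    rewrite -dot_basis /w dot_suml (bigD1 i)//= dotZl dot_basis/= eqxx mulr1.
    rewrite big1 ?addr0// => k ki; rewrite dotZl dot_basis/=.
    by rewrite (_ : (i == k :> nat) = false) ?mulr0//; apply/negbTE; move: ki; rewrite -val_eqE eq_sym.
  have ww : `|w| ^+ 2 = phi w.
    rewrite ell2_norm_sqr {1}/w dot_suml S big_mkord; apply: eq_bigr => i _.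
    by rewrite dotZl dotC dot_basis wj expr2.
  have wC : `|w| <= C.
    have h : `|w| * `|w| <= C * `|w|.
      by rewrite -expr2 ww; exact: le_trans (ler_norm _) (phiC w).
    have [w0|w0] := eqVneq `|w| 0; first by rewrite w0.
    by rewrite -(ler_pM2r (_ : 0 < `|w|))// lt_neqAle eq_sym w0 normr_ge0.
  by rewrite -S -ww; apply: lerXn2r => //; rewrite nnegrE.
exists (Ell2 (square_summable_bounded cs)) => u; set w := Ell2 _.
have c1 : (fun n => phi (trunc n u)) @ \oo --> phi u.
  apply/cvg_distP; apply: (@squeeze_cvgr _ _ _ _ (fun=> 0) (fun n => C * `|trunc n u - u|)).
  - apply: nearW => n; rewrite normr_ge0/=.
    have -> : phi (trunc n u) - phi u = phi (trunc n u - u).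
      by rewrite (_ : _ - u = (-1) *: u + trunc n u) ?phiP ?mulN1r 1?addrC// scaleN1r addrC.
    exact: phiC.
  - exact: cvg_cst.
  - rewrite -(mulr0 C); apply: cvgM; first exact: cvg_cst.
    by apply/cvg_distP; exact: trunc_cvg.
have c2 : (fun n => phi (trunc n u)) @ \oo --> dot w u.
  rewrite (_ : (fun n => _) = (fun n => dot w (trunc n u))).
    by apply: cvg_dot; [exact: cvg_cst|exact: trunc_cvg].
  apply/funext => n; rewrite phiS dotC dot_trunc; apply: eq_bigr => i _.
  by [].
exact: (cvg_unique _ c1 c2).
Qed.

End riesz.

(** * Polynomials with a certificate of positivity on [0, 1] *)

Section positive_cone.
Variable R : realType.
Implicit Types p q : {poly R}.

(* These polynomials are nonnegative on [0, 1], and so are their values at a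
   self-adjoint operator [0 <= A <= 1], without any spectral theorem. *)
Definition pcone : set {poly R} := [set p | exists s : seq (R * nat * nat),
  all (fun c => 0 <= c.1.1) s /\
  p = \sum_(c <- s) c.1.1 *: ('X ^+ c.1.2 * (1 - 'X) ^+ c.2)].

Lemma pconeD p q : pcone p -> pcone q -> pcone (p + q).
Proof.
move=> [s [s0 ->]] [t [t0 ->]]; exists (s ++ t).
by rewrite all_cat s0 t0 big_cat.
Qed.

Lemma pconeC c : 0 <= c -> pcone c%:P.
Proof.
move=> c0; exists [:: (c, 0%N, 0%N)]; rewrite /= c0 big_seq1/= !expr0 mulr1.
by rewrite alg_polyC.
Qed.

Lemma pconeM p q : pcone p -> pcone q -> pcone (p * q).
Proof.
move=> [s [+ ->]] [t [t0 ->]]; elim: s => [_|a s ih /= /andP[a0 /ih h]].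
  by rewrite big_nil mul0r; exact: (pconeC (lexx 0)).
rewrite big_cons mulrDl; apply: pconeD => //.
exists [seq (a.1.1 * b.1.1, (a.1.2 + b.1.2)%N, (a.2 + b.2)%N) | b <- t]; split.
  by rewrite all_map; apply: sub_all t0 => b b0 /=; exact: mulr_ge0.
rewrite big_map mulr_sumr; apply: eq_bigr => b _ /=.
by rewrite -scalerAl -scalerAr scalerA !exprD; congr (_ *: _); ring.
Qed.

Lemma pcone1 : pcone 1. Proof. exact: pconeC. Qed.

Lemma pconeX : pcone 'X.
Proof. by exists [:: (1, 1%N, 0%N)]; rewrite /= ler01 big_seq1/= scale1r expr0 expr1 mulr1. Qed.

Lemma pcone1X : pcone (1 - 'X).
Proof. by exists [:: (1, 0%N, 1%N)]; rewrite /= ler01 big_seq1/= scale1r expr0 expr1 mul1r. Qed.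

Lemma pconeZ c p : 0 <= c -> pcone p -> pcone (c *: p).
Proof. by move=> c0 pp; rewrite -mul_polyC; apply: pconeM => //; exact: pconeC. Qed.

Lemma pconeXn p n : pcone p -> pcone (p ^+ n).
Proof.
move=> pp; elim: n => [|n ih]; first by rewrite expr0; exact: pcone1.
by rewrite exprS; exact: pconeM.
Qed.

Lemma pcone_halfX : pcone (2^-1 *: 'X).
Proof. by apply: pconeZ pconeX; rewrite invr_ge0. Qed.

Lemma pcone_1halfX : pcone (1 - 2^-1 *: 'X).
Proof.
have -> : 1 - 2^-1 *: 'X = 2^-1 *: (1 + (1 - 'X)) :> {poly R}.
  rewrite -!mul_polyC; set k := (2^-1)%:P.
  have k2 : k * (1 + 1) = 1 by rewrite /k -polyCD -polyCM mulVf.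
  by rewrite -[in LHS]k2; ring.
by apply: pconeZ (pconeD pcone1 pcone1X); rewrite invr_ge0.
Qed.

End positive_cone.

Arguments pcone {R}.

Section polynomial_calculus.
Variables (R : realType) (A : {linear ell2 R -> ell2 R}).
Implicit Types (p q : {poly R}) (u v : ell2 R).

Definition peval p v : ell2 R := \sum_(i < size p) p`_i *: iter i A v.

Lemma pevalE n p v : (size p <= n)%N -> peval p v = \sum_(i < n) p`_i *: iter i A v.
Proof.
move=> pn; rewrite /peval (big_ord_widen n (fun i => p`_i *: iter i A v) pn) big_mkcond/=.
apply: eq_bigr => i _; case: ifPn => //; rewrite -leqNgt => ci.
by rewrite nth_default// scale0r.
Qed.

Lemma pevalD p q v : peval (p + q) v = peval p v + peval q v.
Proof.
pose n := maxn (size p) (size q).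
rewrite (@pevalE n (p + q)) ?size_polyD// (@pevalE n p) ?leq_maxl// (@pevalE n q) ?leq_maxr//.
by rewrite -big_split/=; apply: eq_bigr => i _; rewrite coefD scalerDl.
Qed.

Lemma pevalZ a p v : peval (a *: p) v = a *: peval p v.
Proof.
rewrite (@pevalE (size p)) ?size_scale_leq// scaler_sumr.
by apply: eq_bigr => i _; rewrite coefZ scalerA.
Qed.

Lemma pevalN p v : peval (- p) v = - peval p v.
Proof. by rewrite -scaleN1r pevalZ scaleN1r. Qed.

Lemma pevalB p q v : peval (p - q) v = peval p v - peval q v.
Proof. by rewrite pevalD pevalN. Qed.

Lemma pevalC c v : peval c%:P v = c *: v.
Proof.
by rewrite (@pevalE 1) ?size_polyC_leq1// big_ord1 coefC/=.
Qed.

Lemma peval1 v : peval 1 v = v.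
Proof. by rewrite pevalC scale1r. Qed.

Lemma pevalMX p v : peval (p * 'X) v = A (peval p v).
Proof.
rewrite (@pevalE (size p).+1); last first.
  by have [->|p0] := eqVneq p 0; rewrite ?mul0r ?size_poly0// size_mulX.
rewrite big_ord_recl coefMX/= scale0r add0r /peval linear_sum/=.
by apply: eq_bigr => i _; rewrite coefMX/= linearZ.
Qed.

Lemma pevalX v : peval 'X v = A v.
Proof. by rewrite -[X in peval X]mul1r pevalMX peval1. Qed.

Lemma iter_linear n a u v : iter n A (a *: u + v) = a *: iter n A u + iter n A v.
Proof. by elim: n => //= n ->; rewrite linearP. Qed.

Lemma pevalP p a u v : peval p (a *: u + v) = a *: peval p u + peval p v.
Proof.
rewrite /peval scaler_sumr -big_split/=; apply: eq_bigr => i _.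
by rewrite iter_linear scalerDr !scalerA mulrC.
Qed.

Lemma pevalM p q v : peval (p * q) v = peval p (peval q v).
Proof.
elim/poly_ind: p => [|p c ih]; first by rewrite mul0r /peval size_poly0 !big_ord0.
rewrite mulrDl !pevalD -mulrA -(commr_polyX q) mulrA pevalMX ih pevalMX.
by rewrite mul_polyC pevalZ pevalC.
Qed.

Hypothesis Asym : forall u v, dot (A u) v = dot u (A v).

Lemma iter_sym n u v : dot (iter n A u) v = dot u (iter n A v).
Proof. by elim: n u v => //= n ih u v; rewrite Asym ih -iterS iterSr. Qed.

Lemma peval_sym p u v : dot (peval p u) v = dot u (peval p v).
Proof.
rewrite /peval dot_suml dot_sumr; apply: eq_bigr => i _.
by rewrite dotZl dotZr iter_sym.
Qed.

Hypothesis Age0 : forall v, 0 <= dot v (A v).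
Hypothesis Ale1 : forall v, dot v (A v) <= dot v v.

(** Halving the exponents writes the product as q r q with r one of 1, X, 1 - X, X (1 - X), and
    symmetry moves one q to the other side. The last case uses X (1 - X) = (1 - X) X (1 - X) + X (1
    - X) X. *)
Lemma peval_base_ge0 k l v : 0 <= dot v (peval ('X ^+ k * (1 - 'X) ^+ l) v).
Proof.
have sqm q r w : dot w (peval (q * (r * q)) w) = dot (peval q w) (peval r (peval q w)).
  by rewrite pevalM pevalM peval_sym.
have X0 w : 0 <= dot w (peval 'X w) by rewrite pevalX.
have Y0 w : 0 <= dot w (peval (1 - 'X) w).
  by rewrite pevalB peval1 pevalX dotBr subr_ge0.
have XY0 w : 0 <= dot w (peval ('X * (1 - 'X)) w).
  have -> : 'X * (1 - 'X) = (1 - 'X) * ('X * (1 - 'X)) + 'X * ((1 - 'X) * 'X) :> {poly R} by ring.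
  by rewrite pevalD dotDr !sqm addr_ge0.
pose q : {poly R} := 'X ^+ k./2 * (1 - 'X) ^+ l./2.
rewrite -(odd_double_half k) -(odd_double_half l) !exprD -!addnn !exprD.
have -> : 'X^(odd k) * ('X^(k./2) * 'X^(k./2)) *
    ((1 - 'X) ^+ odd l * ((1 - 'X) ^+ l./2 * (1 - 'X) ^+ l./2)) =
    q * ('X ^+ odd k * (1 - 'X) ^+ odd l * q) by rewrite /q; ring.
rewrite sqm; case: (odd k); case: (odd l); rewrite ?expr0 ?expr1 ?mul1r ?mulr1 //.
by rewrite peval1 dot_ge0.
Qed.

Lemma pcone_ge0 p v : pcone p -> 0 <= dot v (peval p v).
Proof.
move=> [s [+ ->]]; elim: s => [_|c s ih /= /andP[c0 /ih h]].
  by rewrite big_nil pevalC scale0r dot0r.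
by rewrite big_cons pevalD pevalZ dotDr dotZr addr_ge0// mulr_ge0// peval_base_ge0.
Qed.

Lemma pcone_le p q v : pcone (q - p) -> dot v (peval p v) <= dot v (peval q v).
Proof. by move=> /(pcone_ge0 v); rewrite pevalB dotBr subr_ge0. Qed.

End polynomial_calculus.

(* Newton-Schulz iteration, converging to the sign function on [-1, 1]. *)
Section newton_schulz.
Variable R : realType.

Fixpoint sign_poly (n : nat) : {poly R} :=
  if n is n'.+1 then 2^-1 *: (sign_poly n' * (3%:P - sign_poly n' ^+ 2)) else 'X.

Local Notation g := sign_poly.
Let half_ge0 : 0 <= 2^-1 :> R. Proof. by rewrite invr_ge0. Qed.

Let polyZ_eq (p q : {poly R}) : 2%:P * p = q -> p = 2^-1 *: q.
Proof. by move=> <-; rewrite mul_polyC scalerA mulVf ?scale1r. Qed.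

Let halfE (p : {poly R}) : 2%:P * (2^-1 *: p) = p.
Proof. by rewrite mul_polyC scalerA mulfV// scale1r. Qed.

Lemma sign_polyS n : g n.+1 = 2^-1 *: (g n * (2%:P + (1 - g n) * (1 + g n))).
Proof.
rewrite /=; congr (_ *: (_ * _)).
have -> : 3%:P = 2%:P + 1%:P :> {poly R} by rewrite -polyCD; congr (_%:P); ring.
by ring.
Qed.

Lemma sign_polyS1 n : 1 - g n.+1 = 2^-1 *: ((1 - g n) ^+ 2 * (2%:P + g n)).
Proof.
apply: polyZ_eq; rewrite sign_polyS mulrBr mulr1 halfE.
have -> : 2%:P = 1 + 1 :> {poly R} by rewrite -polyCD.
by ring.
Qed.

Lemma sign_polySB n : g n.+1 - g n = 2^-1 *: (g n * ((1 - g n) * (1 + g n))).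
Proof.
apply: polyZ_eq; rewrite sign_polyS mulrBr halfE.
by ring.
Qed.

(** In terms of values on [0, 1]: X <= g n <= 1, with error 1 - g n at most (1 - X/2)^n. The rate
    comes from 1 - g (n + 1) = (1 - g n) (1 - g n / 2 - (g n)^2 / 2) together with g n >= X. *)
Lemma pcone_sign_poly n : [/\ pcone (g n), pcone (1 - g n), pcone (g n - 'X) &
  pcone ((1 - 2^-1 *: 'X) ^+ n - (1 - g n))].
Proof.
elim: n => [|n [g0 g1 gX gn]].
  rewrite /= subrr expr0 subKr; split; [exact: pconeX|exact: pcone1X| |exact: pconeX].
  exact: pconeC.
have c2 : pcone (2%:P : {poly R}) by exact: pconeC.
have c1 := pcone1 R.
have p1g : pcone (1 + g n) by exact: pconeD.
have gSX : pcone (g n.+1 - g n).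
  by rewrite sign_polySB; apply: (pconeZ half_ge0); exact: pconeM g0 (pconeM g1 p1g).
have gS : pcone (g n.+1) by rewrite -(subrK (g n) (g n.+1)); exact: pconeD gSX g0.
split; first exact: gS.
- rewrite sign_polyS1; apply: (pconeZ half_ge0).
  exact: pconeM (pconeXn 2 g1) (pconeD c2 g0).
- by rewrite -(subrK (g n) (g n.+1)) -addrA; exact: pconeD gSX gX.
pose h : {poly R} := 1 - 2^-1 *: 'X.
have ch : pcone h := pcone_1halfX R.
(* The induction hypothesis times h, plus the slack between h and the contraction factor of one
   Newton-Schulz step. *)
have -> : h ^+ n.+1 - (1 - g n.+1) = h * (h ^+ n - (1 - g n)) +
    (1 - g n) * (2^-1 *: ((g n - 'X) + g n ^+ 2)).
  rewrite sign_polyS1.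
  suff : (1 - g n) * h - 2^-1 *: ((1 - g n) ^+ 2 * (2%:P + g n)) =
    (1 - g n) * (2^-1 *: ((g n - 'X) + g n ^+ 2)).
    by move=> <-; rewrite exprS; ring.
  rewrite /h -!mul_polyC; set k := _%:P; set a := g n.
  have k2 : k * (1 + 1) = 1 by rewrite /k -polyCD -polyCM mulVf.
  have -> : 2%:P = 1 + 1 :> {poly R} by rewrite -polyCD.
  have -> : (1 - a) * (1 - k * 'X) - k * ((1 - a) ^+ 2 * (1 + 1 + a)) =
    (1 - a) * (k * ((a - 'X) + a ^+ 2)) + (1 - a) * (1 - k * (1 + 1)) by ring.
  by rewrite k2 subrr mulr0 addr0.
apply: pconeD; first exact: pconeM ch gn.
exact: pconeM g1 (pconeZ half_ge0 (pconeD gX (pconeXn 2 g0))).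
Qed.

Lemma sign_poly_odd n : g n \Po (- 'X) = - g n.
Proof.
elim: n => [|n ih]; first by rewrite comp_polyX.
rewrite /= comp_polyZ comp_polyM rmorphB/= comp_polyC rmorphXn/= ih.
by rewrite sqrrN mulNr scalerN.
Qed.

(* These tend to the indicators of the positive and of the negative half-line;
   they vanish to second order at 0, so only kernels of paths with at least two
   interior vertices occur when they are applied to the kernel of K. *)
Definition pos_poly n : {poly R} := 2^-1 *: (g n ^+ 2 + g n ^+ 3).
Definition neg_poly n : {poly R} := 2^-1 *: (g n ^+ 2 - g n ^+ 3).

(** The kernel acts as -B on the negative component, where a polynomial p therefore appears as p(-X)
    at B; since g n is odd, the reflection exchanges the two half-lines. *)
Lemma pos_poly_comp n : pos_poly n \Po (- 'X) = neg_poly n.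
Proof.
rewrite /pos_poly /neg_poly comp_polyZ comp_polyD !rmorphXn/= sign_poly_odd.
by congr (_ *: _); ring.
Qed.

Lemma neg_poly_comp n : neg_poly n \Po (- 'X) = pos_poly n.
Proof.
rewrite /pos_poly /neg_poly comp_polyZ comp_polyB !rmorphXn/= sign_poly_odd.
by congr (_ *: _); ring.
Qed.

Lemma dvdX_sign_poly n : exists p, g n = p * 'X.
Proof.
elim: n => [|n [p ih]]; first by exists 1; rewrite mul1r.
exists (2^-1 *: (p * (3%:P - g n ^+ 2))).
by rewrite /= -scalerAl; congr (_ *: _); rewrite {1}ih; ring.
Qed.

Lemma pos_neg_poly_coef n i : (i < 2)%N -> (pos_poly n)`_i = 0 /\ (neg_poly n)`_i = 0.
Proof.
have [p gp] := dvdX_sign_poly n.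
have h (q : {poly R}) : (q * 'X * 'X)`_0 = 0 /\ (q * 'X * 'X)`_1 = 0.
  by rewrite !coefMX.
have -> : pos_poly n = (2^-1 *: (p ^+ 2 + p ^+ 3 * 'X)) * 'X * 'X.
  by rewrite /pos_poly gp -!scalerAl; congr (_ *: _); ring.
have -> : neg_poly n = (2^-1 *: (p ^+ 2 - p ^+ 3 * 'X)) * 'X * 'X.
  by rewrite /neg_poly gp -!scalerAl; congr (_ *: _); ring.
by case: i => [|[|]]// _; split; rewrite !coefMX.
Qed.

(** Both errors are divisible by 1 - g: they equal (1 - g) (2 + 2 g + g^2) / 2 and (1 - g) g^2 / 2.
    The cofactors are at most 5/2 and 1/2 for 0 <= g <= 1, whence the constant 3. *)
Lemma pcone_pos_neg_poly n : [/\ pcone (1 - pos_poly n),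
  pcone (3%:P * (1 - g n) - (1 - pos_poly n)), pcone (neg_poly n) &
  pcone (3%:P * (1 - g n) - neg_poly n)].
Proof.
have [g0 g1 gX gn] := pcone_sign_poly n.
rewrite /pos_poly /neg_poly -!mul_polyC; set k := (2^-1)%:P; set a := g n in g0 g1 *.
have k2 : k * (1 + 1) = 1 by rewrite /k -polyCD -polyCM mulVf.
have ck : pcone k by exact: pconeC half_ge0.
have c1 := pcone1 R.
have -> : 3%:P = 1 + 1 + 1 :> {poly R} by rewrite -!polyCD; congr (_%:P); ring.
have e1 : 1 - k * (a ^+ 2 + a ^+ 3) = (1 - a) * (k * ((1 + 1) + (1 + 1) * a + a ^+ 2)).
  have -> : (1 - a) * (k * ((1 + 1) + (1 + 1) * a + a ^+ 2)) =
    k * (1 + 1) - k * (a ^+ 2 + a ^+ 3) by ring.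
  by rewrite k2.
have e2 : (1 + 1 + 1) * (1 - a) - (1 - k * (a ^+ 2 + a ^+ 3)) =
   (1 - a) * (k * ((1 - a) * ((1 + 1 + 1) + a))) + (1 - a) * k.
  rewrite e1.
  have -> : (1 + 1 + 1) * (1 - a) - (1 - a) * (k * (1 + 1 + (1 + 1) * a + a ^+ 2)) =
    (1 - a) * (k * ((1 - a) * ((1 + 1 + 1) + a))) + (1 - a) * k +
    (1 + 1 + 1) * (1 - a) * (1 - k * (1 + 1)) by ring.
  by rewrite k2 subrr mulr0 addr0.
have e3 : k * (a ^+ 2 - a ^+ 3) = k * (a ^+ 2 * (1 - a)) by ring.
have e4 : (1 + 1 + 1) * (1 - a) - k * (a ^+ 2 - a ^+ 3) =
   (1 - a) * (k * ((1 - a) * (1 + a)) + k * (1 + 1 + 1 + 1 + 1)).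
  have -> : (1 + 1 + 1) * (1 - a) - k * (a ^+ 2 - a ^+ 3) =
    (1 - a) * (k * ((1 - a) * (1 + a)) + k * (1 + 1 + 1 + 1 + 1)) +
    (1 + 1 + 1) * (1 - a) * (1 - k * (1 + 1)) by ring.
  by rewrite k2 subrr mulr0 addr0.
have c2 : pcone (1 + 1 : {poly R}) := pconeD c1 c1.
have c3 : pcone (1 + 1 + 1 : {poly R}) := pconeD c2 c1.
have c5 : pcone (1 + 1 + 1 + 1 + 1 : {poly R}) := pconeD (pconeD c3 c1) c1.
split.
- by rewrite e1; exact: pconeM g1 (pconeM ck (pconeD (pconeD c2 (pconeM c2 g0)) (pconeXn 2 g0))).
- rewrite e2; apply: pconeD; last exact: pconeM g1 ck.
  exact: pconeM g1 (pconeM ck (pconeM g1 (pconeD c3 g0))).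
- by rewrite e3; exact: pconeM ck (pconeM (pconeXn 2 g0) g1).
- by rewrite e4; exact: pconeM g1 (pconeD (pconeM ck (pconeM g1 (pconeD c1 g0))) (pconeM ck c5)).
Qed.

(* Certificate of [(1 + n h) (1 - h)^n <= 1] on [0, 1], with [h = X / 2]. *)
Lemma pcone_power_decay n :
  pcone (1 - (1 + n%:R *: (2^-1 *: 'X)) * (1 - 2^-1 *: 'X) ^+ n : {poly R}).
Proof.
set h : {poly R} := 2^-1 *: 'X.
have c1 := pcone1 R.
have ch : pcone h := pcone_halfX R.
have ch1 : pcone (1 - h) := pcone_1halfX R.
elim: n => [|n ih]; first by rewrite scale0r addr0 mul1r expr0 subrr; exact: pconeC.
have -> : 1 - (1 + n.+1%:R *: h) * (1 - h) ^+ n.+1 =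
  (1 - (1 + n%:R *: h) * (1 - h) ^+ n) + (1 - h) ^+ n * (n.+1%:R *: (h * h)).
  rewrite exprS -!mul_polyC -[n.+1]addn1 natrD polyCD.
  by move: (n%:R%:P) ((1 - h) ^+ n) => a b; ring.
apply: pconeD ih _; apply: pconeM (pconeXn n ch1) _.
exact: (pconeZ (ler0n R n.+1) (pconeM ch ch)).
Qed.

End newton_schulz.

(** * Convergence of the polynomials on the closure of the range *)

Section strong_limit.
Variables (R : realType) (A : {linear ell2 R -> ell2 R}).
Hypothesis Asym : forall u v, dot (A u) v = dot u (A v).
Hypothesis Age0 : forall v, 0 <= dot v (A v).
Hypothesis Ale1 : forall v, dot v (A v) <= dot v v.
Implicit Types x y v : ell2 R.

Let h : {poly R} := 2^-1 *: 'X.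
(** By [pcone_sign_poly] this quadratic form dominates that of 1 - g n, so its decay controls the
    error of the sign polynomials. *)
Let omega n x := dot x (peval A ((1 - h) ^+ n) x).

Let ch : pcone h. Proof. exact: pcone_halfX. Qed.
Let ch1 : pcone (1 - h). Proof. exact: pcone_1halfX. Qed.

Let ge0 p v : pcone p -> 0 <= dot v (peval A p v).
Proof. exact: pcone_ge0. Qed.

Let le p q v : pcone (q - p) -> dot v (peval A p v) <= dot v (peval A q v).
Proof. exact: pcone_le. Qed.

Definition decays x := (fun n => omega n x) @ \oo --> (0 : R).

Let omega_ge0 n x : 0 <= omega n x.
Proof. by apply: ge0; exact: pconeXn. Qed.

Let omega_le n x : omega n x <= dot x x.
Proof.
have e : dot x x = dot x (peval A 1 x) by rewrite peval1.
rewrite /omega [leRHS]e; apply: le.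
have := pconeD (pcone_power_decay R n) (pconeM (pconeM (pconeC (ler0n R n)) ch) (pconeXn n ch1)).
by congr pcone; rewrite -mul_polyC; ring.
Qed.

(** The form at [A v] is that of X^2 (1 - X/2)^n at v. One factor X is at most 1, and n (X/2) (1 -
    X/2)^n <= 1 by [pcone_power_decay]. *)
Lemma omega_range n v : n%:R * omega n (A v) <= 2 * dot v v.
Proof.
have e : omega n (A v) = dot v (peval A ('X * ((1 - h) ^+ n * 'X)) v).
  by rewrite /omega pevalM pevalX pevalM pevalX Asym.
have l1 : omega n (A v) <= dot v (peval A ((1 - h) ^+ n * 'X) v).
  rewrite e; apply: le.
  have -> : (1 - h) ^+ n * 'X - 'X * ((1 - h) ^+ n * 'X) = (1 - h) ^+ n * ('X * (1 - 'X)) by ring.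
  exact: pconeM (pconeXn n ch1) (pconeM (@pconeX R) (@pcone1X R)).
have l2 : dot v (peval A ((n%:R * 2^-1) *: ((1 - h) ^+ n * 'X)) v) <= dot v v.
  have e1 : dot v v = dot v (peval A 1 v) by rewrite peval1.
  rewrite [leRHS]e1; apply: le.
  have := pconeD (pcone_power_decay R n) (pconeXn n ch1).
  congr pcone; rewrite -/h -!mul_polyC polyCM /h -!mul_polyC.
  by ring.
rewrite pevalZ dotZr in l2.
have n0 : 0 <= n%:R :> R := ler0n R n.
move: l1 l2 n0; move: (omega n (A v)) (dot v (peval _ _ v)) (dot v v) (n%:R) => a b c m.
move=> ab; nra.
Qed.

Lemma decays_range v : decays (A v).
Proof.
apply: (@squeeze_cvgr _ _ _ _ (fun=> 0)
  (fun n => (2 * dot v v + dot (A v) (A v)) * n.+1%:R^-1)).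
- apply: nearW => n; rewrite omega_ge0/= ler_pdivlMr; last by rewrite ltr0n.
  have := omega_range n v; have := omega_le n (A v); rewrite -[n.+1]addn1 natrD.
  by move: (omega n (A v)) (n%:R) (dot _ _) => a b c; lra.
- exact: cvg_cst.
- rewrite -(mulr0 (2 * dot v v + dot (A v) (A v))).
  by apply: cvgM; [exact: cvg_cst|exact: cvg_harmonic].
Qed.

Lemma omegaD n x y : omega n (x + y) <= 2 * omega n x + 2 * omega n y.
Proof.
have s := omega_ge0 n (x - y); move: s; rewrite /omega.
have p a b : peval A ((1 - h) ^+ n) (a + b) = peval A ((1 - h) ^+ n) a + peval A ((1 - h) ^+ n) b.
  by have := pevalP A ((1 - h) ^+ n) 1 a b; rewrite !scale1r.
have q a b : peval A ((1 - h) ^+ n) (a - b) = peval A ((1 - h) ^+ n) a - peval A ((1 - h) ^+ n) b.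
  by have := pevalP A ((1 - h) ^+ n) (-1) b a; rewrite !scaleN1r ![- _ + _]addrC.
rewrite q p; move: (peval _ _ x) (peval _ _ y) => a b.
rewrite dotBl !dotBr dotDl !dotDr.
by move: (dot x a) (dot x b) (dot y a) (dot y b) => t1 t2 t3 t4; lra.
Qed.

(** The decay on the range passes to its closure because omega n is bounded by the squared norm and
    subadditive up to a factor 2. On the kernel of A there is no decay: there omega n x is the
    squared norm of x for all n. *)
Lemma decays_adherence x : adherence (range A) x -> decays x.
Proof.
move=> xA; apply/cvgrPdist_le => e e0.
(* Both terms of [omegaD] become at most e/4, and its factor 2 restores e. *)
have e1 : 0 < Num.sqrt (e / 4) by rewrite sqrtr_gt0 divr_gt0.
have [_ [v _ <-] xv] := xA _ e1.
have e4 : 0 < e / 4 by rewrite divr_gt0.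
have /cvgrPdist_le /(_ _ e4) := decays_range v.
apply: filterS => n; rewrite !sub0r !normrN !ger0_norm//.
move=> on; have := omegaD n (A v) (x - A v).
rewrite (addrC (A v)) subrK => /le_trans; apply.
have : omega n (x - A v) <= e / 4.
  apply: le_trans (omega_le _ _) _; rewrite -ell2_norm_sqr.
  have s : Num.sqrt (e / 4) ^+ 2 = e / 4 by rewrite sqr_sqrtr// ltW.
  by rewrite -s; apply: lerXn2r; [rewrite nnegrE|rewrite nnegrE ltW|exact: ltW].
by move: (omega n (x - A v)) (omega n (A v)) on => a b; lra.
Qed.

Let amgm p x y : pcone p ->
  2 * `|dot x (peval A p y)| <= dot x (peval A p x) + dot y (peval A p y).
Proof.
move=> cp.
have a := ge0 (x + y) cp; have b := ge0 (x - y) cp; move: a b.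
have p1 : peval A p (x + y) = peval A p x + peval A p y.
  by have := pevalP A p 1 x y; rewrite !scale1r.
have p2 : peval A p (x - y) = peval A p x - peval A p y.
  by have := pevalP A p (-1) y x; rewrite !scaleN1r ![- _ + _]addrC.
rewrite p1 p2 dotBl !dotBr dotDl !dotDr (_ : dot y (peval A p x) = dot x (peval A p y)); last first.
  by rewrite dotC peval_sym.
move: (dot x (peval A p x)) (dot x (peval A p y)) (dot y (peval A p y)) => t1 t2 t3 h1 h2.
have : `|t2| <= 2^-1 * (t1 + t3) by rewrite ler_norml; apply/andP; split; lra.
by lra.
Qed.

(** Positivity bounds the bilinear values by the quadratic ones, and these lie below three times
    omega n, which tends to 0 at x and at y. *)
Lemma cvg_dominated_cone (p : nat -> {poly R}) x y :
  (forall n, pcone (p n)) ->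
  (forall n, pcone (3%:P * (1 - sign_poly R n) - p n)) ->
  decays x -> decays y -> (fun n => dot x (peval A (p n) y)) @ \oo --> (0 : R).
Proof.
move=> p0 p3 dx dy; apply/norm_cvg0P.
apply: (@squeeze_cvgr _ _ _ _ (fun=> 0) (fun n => 3 * (omega n x + omega n y))).
- apply: nearW => n; rewrite normr_ge0/=.
  have hx v : dot v (peval A (p n) v) <= 3 * omega n v.
    apply: le_trans (le v (p3 n)) _; rewrite pevalM pevalC dotZr.
    rewrite ler_wpM2l//; apply: le.
    by have [_ _ _] := pcone_sign_poly R n.
  have := amgm x y (p0 n); have := hx x; have := hx y.
  have := omega_ge0 n x; have := omega_ge0 n y.
  move: `|_| (omega n x) (omega n y) (dot x (peval A (p n) x)) (dot y (peval A (p n) y)) => a b c d f.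
  by lra.
- exact: cvg_cst.
- rewrite -(mulr0 3) -[X in 3 * X](addr0 0); apply: cvgM; first exact: cvg_cst.
  exact: cvgD.
Qed.

Lemma cvg_pos_poly x y : decays x -> decays y ->
  (fun n => dot x (peval A (pos_poly R n) y)) @ \oo --> dot x y.
Proof.
move=> dx dy.
have c : (fun n => dot x (peval A (1 - pos_poly R n) y)) @ \oo --> (0 : R).
  by apply: cvg_dominated_cone => // n; have [] := pcone_pos_neg_poly R n.
have -> : (fun n => dot x (peval A (pos_poly R n) y)) =
    (fun n => dot x y - dot x (peval A (1 - pos_poly R n) y)).
  apply/funext => n; rewrite pevalB peval1 dotBr.
  by move: (dot x y) (dot x _) => a b; ring.
by rewrite -[X in _ --> X]subr0; apply: cvgB => //; exact: cvg_cst.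
Qed.

Lemma cvg_neg_poly x y : decays x -> decays y ->
  (fun n => dot x (peval A (neg_poly R n) y)) @ \oo --> (0 : R).
Proof.
by move=> dx dy; apply: cvg_dominated_cone => // n; have [] := pcone_pos_neg_poly R n.
Qed.

End strong_limit.

(** * Covariance operators and iterated kernels *)

Lemma itv01M (R : realType) (a b : R) : 0 <= a <= 1 -> 0 <= b <= 1 -> 0 <= a * b <= 1.
Proof.
move=> /andP[a0 a1] /andP[b0 b1]; rewrite mulr_ge0//=.
by rewrite -[leRHS]mulr1 ler_pM.
Qed.

Lemma itv01B (R : realType) (a b : R) : 0 <= a <= 1 -> 0 <= b <= 1 -> `|a - b| <= 1.
Proof. by move=> /andP[? ?] /andP[? ?]; rewrite ler_norml; apply/andP; split; lra. Qed.

Section mean_calculus.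
Context d (T : measurableType d) (R : realType) (mu : probability T R).
Implicit Types f g : T -> R.

Definition mean f : R := \int[mu]_x f x.

Definition summable_fun f := mu.-integrable setT (EFin \o f).

Lemma summable_measurable f : summable_fun f -> measurable_fun setT f.
Proof. by move=> /integrableP[/measurable_EFinP]. Qed.

Lemma mean_EFin f : summable_fun f -> (\int[mu]_x (f x)%:E)%E = (mean f)%:E.
Proof. by move=> sf; rewrite /mean /Rintegral fineK//; exact: integrable_fin_num. Qed.

Lemma summableZ a f : summable_fun f -> summable_fun (fun x => a * f x).
Proof. by move=> sf; exact: (integrableZl measurableT a sf). Qed.

Lemma summableD f g : summable_fun f -> summable_fun g -> summable_fun (fun x => f x + g x).
Proof. by move=> sf sg; exact: (integrableD measurableT sf sg). Qed.

Lemma summableB f g : summable_fun f -> summable_fun g -> summable_fun (fun x => f x - g x).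
Proof. by move=> sf sg; exact: (integrableB measurableT sf sg). Qed.

Lemma meanZ a f : summable_fun f -> mean (fun x => a * f x) = a * mean f.
Proof. by move=> sf; exact: RintegralZl. Qed.

Lemma meanD f g : summable_fun f -> summable_fun g ->
  mean (fun x => f x + g x) = mean f + mean g.
Proof. by move=> sf sg; exact: RintegralD. Qed.

Lemma meanB f g : summable_fun f -> summable_fun g ->
  mean (fun x => f x - g x) = mean f - mean g.
Proof. by move=> sf sg; exact: RintegralB. Qed.

Lemma summable_le f g : measurable_fun setT f -> (forall x, `|f x| <= g x) ->
  summable_fun g -> summable_fun f.
Proof.
move=> mf fg; apply: le_integrable => //; first exact/measurable_EFinP.
by move=> x _; rewrite /= lee_fin; exact: le_trans (fg x) (ler_norm _).
Qed.

Lemma summable_cst c : summable_fun (fun=> c).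
Proof.
apply/integrableP; split; first exact: measurable_cst.
by rewrite /= integral_cst//= probability_setT mule1 ltry.
Qed.

Lemma summable_bounded f c : measurable_fun setT f -> (forall x, `|f x| <= c) ->
  summable_fun f.
Proof. by move=> mf fc; apply: summable_le mf fc (summable_cst c). Qed.

Lemma summable_itv f : measurable_fun setT f -> (forall x, 0 <= f x <= 1) -> summable_fun f.
Proof.
move=> mf f01; apply: (summable_bounded (c := 1)) => // x.
by have /andP[f0 f1] := f01 x; rewrite ger0_norm.
Qed.

Lemma mean_cst c : mean (fun=> c) = c.
Proof.
apply: EFin_inj.
by rewrite -mean_EFin; [rewrite integral_cst//= probability_setT mule1|exact: summable_cst].
Qed.

Lemma mean_le f g : summable_fun f -> summable_fun g -> (forall x, f x <= g x) ->
  mean f <= mean g.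
Proof. by move=> sf sg fg; apply: le_Rintegral. Qed.

Lemma mean_ge0 f : (forall x, 0 <= f x) -> 0 <= mean f.
Proof. by move=> f0; apply: Rintegral_ge0. Qed.

Lemma eq_mean f g : (forall x, f x = g x) -> mean f = mean g.
Proof. by move=> fg; congr mean; apply/funext. Qed.

Lemma mean_ae f g : measurable_fun setT f -> measurable_fun setT g ->
  {ae mu, forall x, f x = g x} -> mean f = mean g.
Proof.
move=> mf mg fg; rewrite /mean /Rintegral; congr fine.
apply: ae_eq_integral => //; [exact/measurable_EFinP|exact/measurable_EFinP|].
by apply: filterS fg => x /= -> _.
Qed.

Lemma mean_eq0 f : summable_fun f -> (forall x, 0 <= f x) -> mean f = 0 ->
  {ae mu, forall x, f x = 0}.
Proof.
move=> sf f0 m0; have mf := summable_measurable sf.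
have : (\int[mu]_x `|(f x)%:E| = 0)%E.
  under eq_integral do rewrite gee0_abs ?lee_fin//.
  by rewrite mean_EFin// m0.
move/(@ae_eq_integral_abs _ _ _ mu setT measurableT (EFin \o f)) => h.
have [|N [mN N0 hN]] := h _; first exact/measurable_EFinP.
exists N; split => // x /= fx; apply: hN => /= hx; apply: fx.
by have := hx I => -[].
Qed.

End mean_calculus.

Section covariance.
Context (R : realType) (F : probability (kreinB R) R).
Hypothesis sqF : square_integrable F.
Implicit Types (z : kreinB R) (u v : ell2 R).

Definition component (P : kreinB R -> ell2 R) :=
  coord_measurable P /\ forall z, `|P z| <= `|z : krein R|.

Lemma component_fst : component fst.
Proof. by split; [exact: coord_measurable_fst|exact: krein_norm1_le]. Qed.

Lemma component_snd : component snd.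
Proof. by split; [exact: coord_measurable_snd|exact: krein_norm2_le]. Qed.

Lemma summable_norm2 : summable_fun F (fun z => `|z : krein R| ^+ 2).
Proof.
apply/integrableP; split.
  by apply/measurable_EFinP; apply: measurable_funX; exact: measurable_krein_norm.
move: sqF; rewrite /square_integrable unlock; apply: le_lt_trans.
apply: ge0_le_integral => //.
- apply/measurable_EFinP; apply: measurableT_comp => //.
  by apply: measurable_funX; exact: measurable_krein_norm.
- by apply/measurable_EFinP; apply: measurable_funX; exact: measurable_krein_norm.
- by move=> z _; rewrite /= lee_fin ger0_norm ?sqr_ge0.
Qed.

Definition second_moment : R := mean F (fun z => `|z : krein R| ^+ 2).

Lemma second_moment_ge0 : 0 <= second_moment.
Proof. by apply: mean_ge0 => z; exact: sqr_ge0. Qed.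

Variables (c : R) (c0 : 0 < c) (cM : second_moment <= c).

Lemma measurable_dot_component P u : component P ->
  measurable_fun setT (fun z => dot u (P z)).
Proof. by move=> [mP _]; apply: measurable_dot => //; exact: coord_measurable_cst. Qed.

Lemma dot_component_le P P' u v z : component P -> component P' ->
  `|dot u (P z) * dot (P' z) v| <= `|u| * `|v| * `|z : krein R| ^+ 2.
Proof.
move=> [_ cP] [_ cP'].
rewrite normrM; have h1 := dot_norm_le u (P z); have h2 := dot_norm_le (P' z) v.
apply: (le_trans (ler_pM (normr_ge0 _) (normr_ge0 _) h1 h2)).
have := cP z; have := cP' z; have : 0 <= `|P z| by []; have : 0 <= `|P' z| by [].
have : 0 <= `|u| by []; have : 0 <= `|v| by [].
move: `|u| `|v| `|P z| `|P' z| `|z : krein R| => a b p p' n a0 b0 p0 p'0 p'n pn.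
have -> : a * p * (p' * b) = (a * b) * (p * p') by ring.
by rewrite ler_wpM2l ?mulr_ge0// expr2 ler_pM.
Qed.

Lemma summable_dot_component P P' u v : component P -> component P' ->
  summable_fun F (fun z => dot u (P z) * dot (P' z) v).
Proof.
move=> cP cP'; apply: (summable_le _ (fun z => dot_component_le u v z cP cP')).
  apply: measurable_funM; first exact: measurable_dot_component.
  by under eq_fun do rewrite dotC; exact: measurable_dot_component.
exact: summableZ summable_norm2.
Qed.

Lemma mean_dot_component_le P P' u v : component P -> component P' ->
  c^-1 * `|mean F (fun z => dot u (P z) * dot (P' z) v)| <= `|u| * `|v|.
Proof.
move=> cP cP'; have sPP := summable_dot_component u v cP cP'.
have h : `|mean F (fun z => dot u (P z) * dot (P' z) v)| <= `|u| * `|v| * second_moment.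
  rewrite /second_moment -(meanZ _ summable_norm2); rewrite ler_norml; apply/andP; split.
    rewrite lerNl -mulN1r -meanZ//; apply: mean_le => [| |z].
    - exact: summableZ.
    - exact: summableZ summable_norm2.
    - apply: le_trans (dot_component_le u v z cP cP').
      by rewrite mulN1r -normrN ler_norm.
  apply: mean_le => [//| |z].
    exact: summableZ summable_norm2.
  exact: le_trans (ler_norm _) (dot_component_le u v z cP cP').
rewrite mulrC ler_pdivrMr//; apply: le_trans h _.
by rewrite ler_wpM2l// mulr_ge0.
Qed.

(** Riesz applied to the second moment form. Division by c, which bounds the second moment, makes
    the operator a contraction; c is not the second moment itself because one value has to serve
    both laws. *)
Lemma cross_covariance P P' : component P -> component P' ->
  exists A : {linear ell2 R -> ell2 R}, forall u v,
    dot u (A v) = c^-1 * mean F (fun z => dot u (P z) * dot (P' z) v).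
Proof.
move=> cP cP'.
have sPP u v := summable_dot_component u v cP cP'.
have /choice[A hA] v : exists w, forall u,
    c^-1 * mean F (fun z => dot u (P z) * dot (P' z) v) = dot w u.
  apply: (@riesz R (fun u => c^-1 * mean F (fun z => dot u (P z) * dot (P' z) v)) `|v|).
    move=> a u u'; rewrite (_ : mean F _ =
        a * mean F (fun z => dot u (P z) * dot (P' z) v) +
        mean F (fun z => dot u' (P z) * dot (P' z) v)).
      by ring.
    rewrite -(meanZ a (sPP u v)) -meanD; last 2 first.
      exact: (summableZ a (sPP u v)).
      exact: sPP.
    by apply: eq_mean => z; rewrite dotP; ring.
  have ci : 0 <= c^-1 by rewrite invr_ge0 ltW.
  by move=> u; rewrite normrM (ger0_norm ci) [leRHS]mulrC; exact: mean_dot_component_le.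
have Alin a u v : A (a *: u + v) = a *: A u + A v.
  apply: dot_eqP => w; rewrite dotP -!hA (_ : mean F _ =
        a * mean F (fun z => dot w (P z) * dot (P' z) u) +
        mean F (fun z => dot w (P z) * dot (P' z) v)); first by ring.
  rewrite -(meanZ a (sPP w u)) -meanD; last 2 first.
    exact: (summableZ a (sPP w u)).
    exact: sPP.
  by apply: eq_mean => z; rewrite dotDr dotZr; ring.
pose Al : {linear ell2 R -> ell2 R} :=
  HB.pack A (GRing.isLinear.Build R (ell2 R) (ell2 R) *:%R A Alin).
exists Al => u v /=.
by rewrite dotC -hA.
Qed.

(** For the last clause: if v is orthogonal to the range of A, then the mean of the squared inner
    product of v and P z is c times the inner product of v and A v, that is 0, so P z is almost
    surely orthogonal to v. *)
Lemma covariance P : component P -> exists A : {linear ell2 R -> ell2 R},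
  [/\ forall u v, dot u (A v) = c^-1 * mean F (fun z => dot u (P z) * dot (P z) v),
      forall u v, dot (A u) v = dot u (A v),
      forall v, 0 <= dot v (A v),
      forall v, dot v (A v) <= dot v v &
      {ae F, forall z, adherence (range A) (P z)}].
Proof.
move=> cP; have [A hA] := cross_covariance cP cP.
have Asym u v : dot (A u) v = dot u (A v).
  rewrite dotC !hA; congr (_ * _); apply: eq_mean => z.
  by rewrite mulrC; congr (_ * _); exact: dotC.
exists A; split => //.
- move=> v; rewrite hA; apply: mulr_ge0; first by rewrite invr_ge0 ltW.
  apply: mean_ge0 => z.
  by rewrite (dotC (P z)) -expr2 sqr_ge0.
- move=> v; rewrite hA -ell2_norm_sqr expr2.
  apply: le_trans (mean_dot_component_le v v cP cP).
  by rewrite ler_wpM2l ?ler_norm// invr_ge0 ltW.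
pose M := adherence (range A).
have sA : subspace (range A).
  split; first by exists 0 => //; rewrite linear0.
  by move=> a _ _ [u _ <-] [v _ <-]; exists (a *: u + v) => //; rewrite linearP.
have cM' : closed_subspace M := adherence_closed_subspace sA.
(* The residues of the basis vectors are countably many and span the orthogonal complement of M
   densely, so a single null set suffices. *)
have ae_j j : {ae F, forall z, dot (basis_vec R j - proj M (basis_vec R j)) (P z) = 0}.
  set v := _ - _.
  have v0 : dot v (A v) = 0.
    by apply: (proj_orth cM'); apply: subset_adherence; exists v.
  have m0 : mean F (fun z => dot v (P z) * dot (P z) v) = 0.
    apply/eqP; move/eqP: v0; rewrite hA mulf_eq0 invr_eq0.
    by rewrite (gt_eqF c0).
  have := mean_eq0 (summable_dot_component v v cP cP) _ m0.
  have pos z : 0 <= dot v (P z) * dot (P z) v by rewrite (dotC (P z)) -expr2 sqr_ge0.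
  move=> /(_ pos); apply: filterS => z /eqP.
  by rewrite (dotC (P z)) mulf_eq0 orbb => /eqP.
have := ae_foralln ae_j; apply: filterS => z hz.
suff -> : P z = proj M (P z) by exact: proj_in.
apply: ell2_eqP => j; rewrite -!dot_basis.
rewrite (proj_self_adjoint cM') dotC -[in RHS]dotC; apply/eqP.
by rewrite -subr_eq0 -dotBl; apply/eqP; exact: hz.
Qed.

End covariance.

(** * Iterated kernels as powers of an operator *)

Section kernel.
Context (R : realType) (F : probability (kreinB R) R).
Implicit Types (z u w : kreinB R).

Lemma kdotC z w : kdot z w = kdot w z.
Proof. by rewrite /kdot (dotC z.1) (dotC z.2). Qed.

(** [kdot] lies in [0, 1] only almost surely. The clipped kernel is bounded everywhere, so all
    iterated integrals exist, and it is exactly the edge probability of the threshold construction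
    for arbitrary roots. *)
Definition kclip z w : R := Num.max 0 (Num.min 1 (kdot z w)).

Lemma kclip_itv z w : 0 <= kclip z w <= 1.
Proof. by rewrite le_max lexx ge_max ler01 ge_min lexx. Qed.

Lemma kclip_id z w : 0 <= kdot z w <= 1 -> kclip z w = kdot z w.
Proof. by move=> /andP[k0 k1]; rewrite /kclip min_r// max_r. Qed.

Lemma measurable_kclip d (T : measurableType d) (f g : T -> kreinB R) :
  measurable_fun setT f -> measurable_fun setT g ->
  measurable_fun setT (fun t => kclip (f t) (g t)).
Proof.
move=> mf mg; apply: measurable_maxr; first exact: measurable_cst.
by apply: measurable_minr; [exact: measurable_cst|exact: measurable_kdot].
Qed.

(* The kernel of paths from [z] to [w] with [m] interior vertices. *)
Fixpoint iker (m : nat) z w : R :=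
  if m is m'.+1 then mean F (fun u => kclip z u * iker m' u w) else kclip z w.

Lemma iker_itv_measurable m : (forall z w, 0 <= iker m z w <= 1) /\
  measurable_fun setT (fun zw : kreinB R * kreinB R => iker m zw.1 zw.2).
Proof.
elim: m => [|m [ih mi]].
  split; first exact: kclip_itv.
  exact: measurable_kclip.
have mku (w : kreinB R) : measurable_fun setT (fun u => iker m u w).
  by have := measurable_fun_pair1 w mi.
have k01 z w u := itv01M (kclip_itv z u) (ih u w).
have sk z w : summable_fun F (fun u => kclip z u * iker m u w).
  apply: summable_itv => [|u]; last exact: k01.
  by apply: measurable_funM; [exact: measurable_kclip|exact: mku].
split.
  move=> z w /=; apply/andP; split.
    by apply: mean_ge0 => u; have /andP[] := k01 z w u.
  rewrite -[leRHS](mean_cst F); apply: mean_le => //; first exact: summable_cst.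
  by move=> u; have /andP[] := k01 z w u.
rewrite /= (_ : (fun _ => _) = fun zw : kreinB R * kreinB R =>
   fine (\int[F]_u (kclip zw.1 u * iker m u zw.2)%:E)%E).
  apply: measurableT_comp; first exact: fine_measurable.
  apply: (@measurable_fun_fubini_tonelli_F _ _ _ _ R F
    (fun t : (kreinB R * kreinB R) * kreinB R =>
       (kclip t.1.1 t.2 * iker m t.2 t.1.2)%:E)) => [|t]; last first.
    by rewrite lee_fin; have /andP[] := k01 t.1.1 t.1.2 t.2.
  apply/measurable_EFinP; apply: measurable_funM.
    apply: measurable_kclip; last exact: measurable_snd.
    by apply: measurableT_comp; [exact: measurable_fst|exact: measurable_fst].
  apply: (measurableT_comp mi (_ : measurable_fun setT
    (fun t : (kreinB R * kreinB R) * kreinB R => (t.2, t.1.2)))).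
  apply: measurable_fun_pair; first exact: measurable_snd.
  by apply: measurableT_comp; [exact: measurable_snd|exact: measurable_fst].
by apply/funext => zw.
Qed.

Lemma iker_itv m z w : 0 <= iker m z w <= 1.
Proof. exact: (iker_itv_measurable m).1. Qed.

Lemma measurable_iker d (T : measurableType d) m (f g : T -> kreinB R) :
  measurable_fun setT f -> measurable_fun setT g ->
  measurable_fun setT (fun t => iker m (f t) (g t)).
Proof.
move=> mf mg.
exact: (measurableT_comp (iker_itv_measurable m).2 (measurable_fun_pair mf mg)).
Qed.

Definition typical : set (kreinB R) := [set z | {ae F, forall u, 0 <= kdot z u <= 1}].

Lemma ae_typical : is_grd F -> {ae F, forall z, typical z}.
Proof.
move=> grd; pose S := [set z : kreinB R * kreinB R | 0 <= kdot z.1 z.2 <= 1].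
have mS : measurable S := @measurable_kdot_itv R.
have mSC : measurable (~` S) := measurableC mS.
have h0 : (\int[F]_z `|F (xsection (~` S) z)| = 0)%E.
  have e : (F \x F)%E (~` S) = 0%E.
    transitivity (1 - pprod F F S)%E; first exact: (probability_setC (pprod F F)).
    by rewrite (_ : pprod F F S = 1%E) ?subee//; exact: grd.
  rewrite -[RHS]e /product_measure1/=; apply: eq_integral => z _.
  by rewrite gee0_abs.
have mx : measurable_fun setT (fun z => F (xsection (~` S) z)).
  exact: measurable_fun_xsection.
have [N [mN N0 hN]] := (ae_eq_integral_abs F measurableT mx).1 h0.
exists N; split => // z /= nz; apply: hN => /= hz; apply: nz.
have {}hz := hz I.
exists (xsection (~` S) z); split => //.
  exact: measurable_xsection.
by move=> u /= hu; rewrite /xsection/= inE.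
Qed.

Definition kop (A B : ell2 R -> ell2 R) z : kreinB R := (A z.1, - B z.2).

Section on_typical.
Variables (A B : {linear ell2 R -> ell2 R}) (c : R).
Hypothesis kA : forall z w, summable_fun F (fun u => kdot z u * kdot u w) /\
  mean F (fun u => kdot z u * kdot u w) = c * kdot z (kop A B w).
Hypothesis grdF : is_grd F.

(** At least one interior vertex is required: two given typical points may violate 0 <= kdot z w <=
    1, whereas the conditions on (z, u) and (u, w) hold for almost every u. Each further vertex
    applies [kop A B] once more, with a factor c. *)
Lemma iker_typical m z w : typical z -> typical w ->
  iker m.+1 z w = c ^+ m.+1 * kdot z (iter m.+1 (kop A B) w).
Proof.
move=> tz tw; elim: m z tz => [|m ih] z tz.
  rewrite /= expr1 -(kA z w).2; apply: mean_ae.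
  - by apply: measurable_funM; apply: measurable_kclip.
  - by apply: measurable_funM; apply: measurable_kdot.
  apply: filterS2 tz tw => u zu wu.
  by rewrite !kclip_id// (kdotC u).
set v := iter m.+1 (kop A B) w in ih *.
have [sv mv] := kA z v.
have -> : iker m.+2 z w = mean F (fun u => kclip z u * iker m.+1 u w) by [].
transitivity (mean F (fun u => c ^+ m.+1 * (kdot z u * kdot u v))); last first.
  rewrite (meanZ _ sv) mv (_ : iter m.+2 (kop A B) w = kop A B v)//.
  by rewrite [c ^+ m.+2]exprSr mulrA.
apply: mean_ae.
- by apply: measurable_funM; [exact: measurable_kclip|exact: measurable_iker].
- apply: measurable_funM; first exact: measurable_cst.
  by apply: measurable_funM; apply: measurable_kdot.
apply: filterS2 tz (ae_typical grdF) => u zu tu.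
by rewrite kclip_id// ih//; ring.
Qed.

Lemma kdot_iter_kop m z w : kdot z (iter m (kop A B) w) =
  dot z.1 (iter m A w.1) - (-1) ^+ m * dot z.2 (iter m B w.2).
Proof.
have -> : iter m (kop A B) w = (iter m A w.1, (-1) ^+ m *: iter m B w.2).
  elim: m => [|m ih]; first by rewrite expr0 scale1r; case: w.
  by rewrite iterS ih /kop/= linearZ/= exprS -scalerA scaleN1r.
by rewrite /kdot/= dotZr.
Qed.

(* [c^-i] times the [i]-fold kernel is the kernel of the [i]-th power of the
   operator [kop A B] normalised by [c]. *)
Definition kpoly (p : {poly R}) z w : R :=
  \sum_(i < size p) p`_i * (c^-1 ^+ i * iker i z w).

Lemma peval_compN p v : peval B (p \Po (- 'X)) v =
  \sum_(i < size p) (p`_i * (-1) ^+ i) *: iter i B v.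
Proof.
rewrite comp_polyE.
rewrite (big_morph (fun q => peval B q v) (fun p q => pevalD B p q v) (_ : peval B 0 v = 0)); last first.
  by rewrite pevalC scale0r.
apply: eq_bigr => i _.
rewrite -scaleN1r exprZn !pevalZ scalerA; congr (_ *: _).
elim: (i : nat) => [|k ih]; first by rewrite expr0 peval1.
by rewrite exprSr pevalMX ih.
Qed.

Hypothesis c0 : c != 0.

Lemma kpoly_typical (p : {poly R}) z w : typical z -> typical w ->
  (forall i, (i < 2)%N -> p`_i = 0) ->
  kpoly p z w = dot z.1 (peval A p w.1) - dot z.2 (peval B (p \Po (- 'X)) w.2).
Proof.
move=> tz tw p01; rewrite peval_compN /peval !dot_sumr -sumrB; apply: eq_bigr => i _.
rewrite !dotZr.
case: (ltnP i 2) => i2; first by rewrite p01// !mul0r subrr.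
rewrite -mulrA -mulrBr -kdot_iter_kop; congr (_ * _).
case: (i : nat) i2 => // m _.
by rewrite iker_typical// mulrA -exprMn mulVf// expr1n mul1r.
Qed.

End on_typical.

End kernel.

(** * Separating the two components by polynomials of the kernel *)

Section separation.
Context (R : realType) (F : probability (kreinB R) R).
Hypotheses (grdF : is_grd F) (sqF : square_integrable F).
Hypothesis uncF : uncorrelated_components F.
Implicit Types (z w : kreinB R).

(** The hypothesis concerns coordinates only. It gives the matrix entries of the cross-covariance
    operator, which is bounded and hence vanishes; the adjoint C' serves to pass from basis vectors
    to arbitrary v. *)
Let cross0 u v : mean F (fun z => dot u z.1 * dot z.2 v) = 0.
Proof.
pose c := second_moment F + 1.
have c0 : 0 < c by rewrite ltr_wpDl// second_moment_ge0.
have cM : second_moment F <= c by rewrite lerDl.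
have [C hC] := cross_covariance sqF c0 cM (component_fst R) (component_snd R).
have [C' hC'] := cross_covariance sqF c0 cM (component_snd R) (component_fst R).
have CC' x y : dot x (C y) = dot y (C' x).
  rewrite hC hC'; congr (_ * _); apply: eq_mean => z.
  by rewrite mulrC (dotC y) (dotC x).
have C'0 j : C' (basis_vec R j) = 0.
  apply: ell2_eqP => k; rewrite -dot_basis dotC -CC' hC.
  have /(congr1 fine) := uncF j k; rewrite unlock/= => e.
  rewrite (_ : mean _ _ = 0) ?mulr0//; rewrite -[RHS]e; apply: eq_mean => z.
  by rewrite dotC !dot_basis.
have C0 : C v = 0.
  by apply: ell2_eqP => j; rewrite -dot_basis dotC CC' C'0 dot0r.
have := hC u v; rewrite C0 dot0r => /esym/eqP.
by rewrite mulf_eq0 invr_eq0 (gt_eqF c0) => /eqP.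
Qed.

(** At typical points a polynomial p of the kernel yields p(A) on the positive part minus p(-X)
    evaluated at B on the negative part. One of the two tends to the inner product and the other to
    0, because almost every component lies in the closure of the range of its covariance. The minus
    sign of the form explains the negation in the second limit. *)
Lemma separation c : 0 < c -> second_moment F <= c -> exists G : set (kreinB R),
  {ae F, forall z, G z} /\ forall z w, G z -> G w ->
  (fun n => kpoly F c (pos_poly R n) z w) @ \oo --> dot z.1 w.1 /\
  (fun n => - kpoly F c (neg_poly R n) z w) @ \oo --> dot z.2 w.2.
Proof.
move=> c0 cM.
have [A [hA sA A0 A1 aA]] := covariance sqF c0 cM (component_fst R).
have [B [hB sB B0 B1 aB]] := covariance sqF c0 cM (component_snd R).
have c1 : c != 0 by rewrite gt_eqF.
have kAB z w : summable_fun F (fun u => kdot z u * kdot u w) /\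
    mean F (fun u => kdot z u * kdot u w) = c * kdot z (kop A B w).
  have s1 := summable_dot_component sqF z.1 w.1 (component_fst R) (component_fst R).
  have s2 := summable_dot_component sqF z.2 w.2 (component_snd R) (component_snd R).
  have s3 := summable_dot_component sqF z.1 w.2 (component_fst R) (component_snd R).
  have s4 := summable_dot_component sqF w.1 z.2 (component_fst R) (component_snd R).
  have e (u : kreinB R) : kdot z u * kdot u w =
    (dot z.1 u.1 * dot u.1 w.1 + dot z.2 u.2 * dot u.2 w.2) -
    (dot z.1 u.1 * dot u.2 w.2 + dot w.1 u.1 * dot u.2 z.2).
    by rewrite /kdot (dotC w.1) (dotC u.2 z.2); ring.
  split.
    rewrite (_ : (fun u => _) = (fun u => (dot z.1 u.1 * dot u.1 w.1 + dot z.2 u.2 * dot u.2 w.2) -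
      (dot z.1 u.1 * dot u.2 w.2 + dot w.1 u.1 * dot u.2 z.2))); last exact/funext.
    exact: summableB (summableD s1 s2) (summableD s3 s4).
  rewrite (eq_mean F e) (meanB (summableD s1 s2) (summableD s3 s4)) (meanD s1 s2) (meanD s3 s4).
  rewrite !cross0 /kdot /kop/= dotNr hA hB opprK addr0 subr0 -mulrDr mulrA.
  by rewrite mulfV// mul1r.
exists [set z | [/\ typical F z, adherence (range A) z.1 & adherence (range B) z.2]].
split.
  by apply: filterS3 (ae_typical grdF) aA aB => z; split.
move=> z w [tz Az Bz] [tw Aw Bw].
have dz1 := decays_adherence sA A0 A1 Az; have dw1 := decays_adherence sA A0 A1 Aw.
have dz2 := decays_adherence sB B0 B1 Bz; have dw2 := decays_adherence sB B0 B1 Bw.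
have p01 n i : (i < 2)%N -> (pos_poly R n)`_i = 0 by move=> /(pos_neg_poly_coef R n)[].
have n01 n i : (i < 2)%N -> (neg_poly R n)`_i = 0 by move=> /(pos_neg_poly_coef R n)[].
split.
  rewrite (_ : (fun n => _) = (fun n => dot z.1 (peval A (pos_poly R n) w.1) -
      dot z.2 (peval B (neg_poly R n) w.2))); last first.
    by apply/funext => n; rewrite (kpoly_typical kAB grdF c1 tz tw (p01 n)) pos_poly_comp.
  rewrite -[X in _ --> X]subr0; apply: cvgB.
    exact: (cvg_pos_poly sA A0 A1 dz1 dw1).
  exact: (cvg_neg_poly sB B0 B1 dz2 dw2).
rewrite (_ : (fun n => _) = (fun n => dot z.2 (peval B (pos_poly R n) w.2) -
    dot z.1 (peval A (neg_poly R n) w.1))); last first.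
  by apply/funext => n; rewrite (kpoly_typical kAB grdF c1 tz tw (n01 n)) neg_poly_comp opprB.
rewrite -[X in _ --> X]subr0; apply: cvgB.
  exact: (cvg_pos_poly sB B0 B1 dz2 dw2).
exact: (cvg_neg_poly sA A0 A1 dz1 dw1).
Qed.

End separation.

(** * Averages of uncorrelated variables *)

Lemma norm_sum_le (R : realType) (a : nat -> R) n : (forall v, `|a v| <= 1) ->
  `|\sum_(v < n) a v| <= n%:R.
Proof.
move=> a1; elim: n => [|n ih]; first by rewrite big_ord0 normr0.
rewrite big_ord_recr/= -[n.+1]addn1 natrD; apply: le_trans (ler_normD _ _) _.
exact: lerD ih (a1 n).
Qed.

Section laws.
Context d (T : measurableType d) (R : realType) (mu : probability T R).

Lemma integral_law d' (T' : measurableType d') (nu : probability T' R) (X : T -> T')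
    (f : T' -> \bar R) :
  measurable_fun setT X -> (forall B, measurable B -> mu (X @^-1` B) = nu B) ->
  measurable_fun setT f -> (\int[mu]_x f (X x) = \int[nu]_y f y)%E.
Proof.
move=> mX law mf.
have pos (g : T' -> \bar R) : measurable_fun setT g -> (forall y, (0%:E <= g y)%E) ->
    (\int[mu]_x g (X x) = \int[nu]_y g y)%E.
  move=> mg g0; transitivity (\int[pushforward mu X]_y g y)%E; last first.
    by apply: eq_measure_integral => B mB _; exact: law.
  by rewrite ge0_integral_pushforward//; move=> y _; exact: g0.
rewrite integralE [RHS]integralE; congr (_ - _)%E.
  rewrite -(pos _ (measurable_funepos mf) (funepos_ge0 f)).
  by apply: eq_integral => x _; rewrite -[RHS]/((f^\+ \o X)%E x) -funepos_comp.
rewrite -(pos _ (measurable_funeneg mf) (funeneg_ge0 f)).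
by apply: eq_integral => x _; rewrite -[RHS]/((f^\- \o X)%E x) -funeneg_comp.
Qed.

Lemma mean_law d' (T' : measurableType d') (nu : probability T' R) (X : T -> T')
    (f : T' -> R) :
  measurable_fun setT X -> (forall B, measurable B -> mu (X @^-1` B) = nu B) ->
  measurable_fun setT f -> mean mu (fun x => f (X x)) = mean nu f.
Proof.
move=> mX law mf; rewrite /mean /Rintegral; congr fine.
by apply: (integral_law (f := EFin \o f)) => //; exact/measurable_EFinP.
Qed.

Definition pr (B : set T) : R := fine (mu B).

Lemma pr_EFin B : measurable B -> (pr B)%:E = mu B.
Proof. by move=> mB; rewrite /pr fineK// fin_num_measure. Qed.

Lemma summable_indic B : measurable B -> summable_fun mu (\1_B : T -> R).
Proof.
move=> mB; apply: summable_itv; first exact: measurable_indic.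
by move=> x; rewrite indicE; case: (_ \in _); rewrite ?lexx ler01.
Qed.

Lemma mean_indic B : measurable B -> mean mu (\1_B : T -> R) = pr B.
Proof. by move=> mB; rewrite /mean /Rintegral integral_indic// setIT. Qed.

Lemma pr_ge0 B : 0 <= pr B. Proof. exact: fine_ge0. Qed.

Lemma pr_le A B : measurable A -> measurable B -> A `<=` B -> pr A <= pr B.
Proof. by move=> mA mB AB; rewrite -lee_fin !pr_EFin// le_measure ?inE. Qed.

Lemma pr_setC B : measurable B -> pr (~` B) = 1 - pr B.
Proof.
move=> mB; apply: EFin_inj; rewrite pr_EFin; last exact: measurableC.
by rewrite EFinB pr_EFin//; exact: probability_setC.
Qed.

Lemma pr_setT : pr setT = 1. Proof. by rewrite /pr probability_setT. Qed.

Lemma pr_setU_le A B : measurable A -> measurable B -> pr (A `|` B) <= pr A + pr B.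
Proof.
move=> mA mB; rewrite -lee_fin EFinD !pr_EFin//; first exact: measureU2.
exact: measurableU.
Qed.

Lemma pr_ae B : measurable B -> {ae mu, forall x, B x} -> pr B = 1.
Proof.
move=> mB [N [mN N0 hN]]; have : pr (~` B) = 0.
  apply/eqP; rewrite eq_le pr_ge0 andbT; apply: le_trans (pr_le _ mN hN) _.
    exact: measurableC.
  by rewrite /pr N0.
by rewrite pr_setC// => /eqP; rewrite subr_eq0 => /eqP.
Qed.

Lemma pr_bigcup_le (B : nat -> set T) (e : R) : (forall n, measurable (B n)) ->
  (forall n, pr (B n) <= e * 2^-1 ^+ n) -> pr (\bigcup_n B n) <= 2 * e.
Proof.
move=> mB Be.
have fin n : pr (\bigcup_(i < n) B i) <= e * (2 - 2 * 2^-1 ^+ n).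
  elim: n => [|n ih]; first by rewrite bigcup_mkord big_ord0 /pr measure0/= expr0; lra.
  rewrite bigcup_mkord big_ord_recr/= -bigcup_mkord.
  have mb := bigcup_measurable (fun i (_ : `I_n i) => mB i).
  apply: le_trans (pr_setU_le mb (mB n)) _.
  have := Be n; move: ih; rewrite exprS; rewrite mulrA mulfV// mul1r.
  by move: (pr _) (pr _) (2^-1 ^+ n : R) => a b c; lra.
have mU : measurable (\bigcup_n B n) by exact: bigcup_measurable.
have e0 : 0 <= e by have := Be 0; rewrite expr0 mulr1; apply: le_trans; exact: pr_ge0.
have cv := @nondecreasing_cvg_mu _ _ _ mu (fun n => \bigcup_(i < n) B i).
have {}cv : mu (\bigcup_(i < n) B i) @[n --> \oo] --> mu (\bigcup_n B n).
  have -> : \bigcup_n B n = \bigcup_n \bigcup_(i < n) B i.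
    apply/seteqP; split => x; first by move=> [n _ Bx]; exists n.+1 => //; exists n => /=.
    by move=> [n _ [i _ Bx]]; exists i.
  apply: cv.
  - by move=> n; apply: bigcup_measurable => i _.
  - by apply: bigcup_measurable => n _; apply: bigcup_measurable => i _.
  - by move=> m n mn; apply/subsetPset => x [i im Bx]; exists i => //=; exact: leq_trans mn.
rewrite -lee_fin pr_EFin// -(cvg_lim _ cv)//; apply: lime_le; first by apply/cvg_ex; eexists; exact: cv.
apply: nearW => n; rewrite -pr_EFin; last by apply: bigcup_measurable => i _.
rewrite lee_fin; apply: le_trans (fin n) _.
have : 0 <= 2^-1 ^+ n :> R by rewrite exprn_ge0.
by move: (2^-1 ^+ n : R) => a a0; nra.
Qed.

Lemma measurable_norm_ge (f : T -> R) a : measurable_fun setT f ->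
  measurable [set x | a <= `|f x|].
Proof.
move=> mf; rewrite (_ : mkset _ = (fun x => `|f x|) @^-1` `[a, +oo[%classic).
  by apply: preimage_measurable => //; exact: measurableT_comp.
by apply/seteqP; split => x /=; rewrite in_itv/= andbT.
Qed.

Lemma measurable_le_cst (f : T -> R) a : measurable_fun setT f -> measurable [set x | f x <= a].
Proof.
move=> mf; rewrite (_ : mkset _ = f @^-1` `]-oo, a]%classic); first exact: preimage_measurable.
by apply/seteqP; split => x /=; rewrite in_itv.
Qed.

Lemma markov_sqr (S : T -> R) a : measurable_fun setT S -> 0 < a ->
  summable_fun mu (fun x => S x ^+ 2) ->
  pr [set x | a <= `|S x|] * a ^+ 2 <= mean mu (fun x => S x ^+ 2).
Proof.
move=> mS a0 sS.
have mB := measurable_norm_ge a mS.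
rewrite -mean_indic// mulrC -meanZ; last exact: summable_indic.
apply: mean_le => [| // |x]; first by apply: summableZ; exact: summable_indic.
rewrite indicE; case: (boolP (x \in _)) => [|_]; last by rewrite mulr0 sqr_ge0.
by rewrite inE/= mulr1 -[S x ^+ 2]real_normK ?num_real// => h; rewrite lerXn2r// nnegrE// ltW.
Qed.

Lemma mean_sqr_sum_uncorrelated (D : nat -> T -> R) n :
  (forall v, measurable_fun setT (D v)) -> (forall v x, `|D v x| <= 1) ->
  (forall v w, (v < w)%N -> mean mu (fun x => D v x * D w x) = 0) ->
  mean mu (fun x => (\sum_(v < n) D v x) ^+ 2) <= n%:R.
Proof.
move=> mD D1 D0.
have mSum m : measurable_fun setT (fun x => \sum_(v < m) D v x).
  by apply: measurable_sum => v.
have bSum m x : `|\sum_(v < m) D v x| <= m%:R.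
  exact: (norm_sum_le _ (D1 ^~ x)).
have sDD v w : summable_fun mu (fun x => D v x * D w x).
  apply: (@summable_bounded _ _ _ _ _ 1); first exact: measurable_funM.
  by move=> x; rewrite normrM -[leRHS]mulr1 ler_pM.
have sSD m w : summable_fun mu (fun x => (\sum_(v < m) D v x) * D w x).
  apply: (@summable_bounded _ _ _ _ _ m%:R); first exact: measurable_funM.
  by move=> x; rewrite normrM -[leRHS]mulr1 ler_pM.
have sSS m : summable_fun mu (fun x => (\sum_(v < m) D v x) ^+ 2).
  apply: (@summable_bounded _ _ _ _ _ (m%:R ^+ 2)); first exact: measurable_funX.
  by move=> x; rewrite normrX lerXn2r ?nnegrE.
have cross m w : (m <= w)%N -> mean mu (fun x => (\sum_(v < m) D v x) * D w x) = 0.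
  elim: m => [_|m ih mw].
    by rewrite -[RHS](mean_cst mu); apply: eq_mean => x; rewrite big_ord0 mul0r.
  rewrite (eq_mean _ (g := fun x => (\sum_(v < m) D v x) * D w x + D m x * D w x)); last first.
    by move=> x; rewrite big_ord_recr/= mulrDl.
  by rewrite meanD// ih ?D0 ?addr0//; exact: ltnW.
elim: n => [|n ih].
  rewrite (eq_mean _ (g := cst 0)) ?mean_cst// => x.
  by rewrite big_ord0 expr0n.
rewrite (eq_mean _ (g := fun x => ((\sum_(v < n) D v x) ^+ 2 +
    2 * ((\sum_(v < n) D v x) * D n x)) + D n x * D n x)); last first.
  by move=> x; rewrite big_ord_recr/=; ring.
rewrite meanD//; last by apply: summableD => //; exact: summableZ.
rewrite meanD//; last exact: summableZ.
rewrite meanZ// cross// mulr0 addr0 -[n.+1]addn1 natrD lerD//.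
rewrite -[leRHS](mean_cst mu); apply: mean_le => //; first exact: summable_cst.
by move=> x; apply: (le_trans (ler_norm _)); rewrite normrM -[leRHS]mulr1 ler_pM.
Qed.

Lemma chebyshev_average (D : nat -> T -> R) n e :
  (forall v, measurable_fun setT (D v)) -> (forall v x, `|D v x| <= 1) ->
  (forall v w, (v < w)%N -> mean mu (fun x => D v x * D w x) = 0) -> 0 < e ->
  pr [set x | e <= `|n.+1%:R^-1 * \sum_(v < n.+1) D v x|] <= (n.+1%:R * e ^+ 2)^-1.
Proof.
move=> mD D1 D0 e0.
have n0 : 0 < n.+1%:R :> R by rewrite ltr0n.
have := mean_sqr_sum_uncorrelated n.+1 mD D1 D0.
have mS : measurable_fun setT (fun x => \sum_(v < n.+1) D v x) by apply: measurable_sum.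
have sS : summable_fun mu (fun x => (\sum_(v < n.+1) D v x) ^+ 2).
  apply: (@summable_bounded _ _ _ _ _ (n.+1%:R ^+ 2)); first exact: measurable_funX.
  move=> x; rewrite normrX; apply: lerXn2r; rewrite ?nnegrE ?normr_ge0 ?ler0n//.
  exact: (norm_sum_le _ (D1 ^~ x)).
have ne0 : 0 < n.+1%:R * e by rewrite mulr_gt0.
move=> h; have := le_trans (markov_sqr mS ne0 sS) h.
rewrite (_ : mkset _ = [set x | e <= `|n.+1%:R^-1 * \sum_(v < n.+1) D v x|]); last first.
  apply/seteqP; split => x /=.
    by rewrite normrM gtr0_norm ?invr_gt0// ler_pdivlMl.
  by rewrite normrM gtr0_norm ?invr_gt0// ler_pdivlMl.
move: (pr _) => p h'.
rewrite -[X in _ <= X]div1r ler_pdivlMr ?mulr_gt0// ?exprn_gt0//.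
have {}h' : n.+1%:R * (p * (n.+1%:R * e ^+ 2)) <= n.+1%:R * 1.
  by rewrite mulr1; apply: le_trans h'; rewrite exprMn; move: (n.+1%:R) => a; rewrite le_eqVlt; apply/orP; left; apply/eqP; ring.
by rewrite ler_pM2l in h'.
Qed.

End laws.

(** * Replacing one coordinate by an independent copy *)

Section resampling.
Context d (E : measurableType d) (R : realType) (P : probability E R).

Lemma resample_law k A : measurable A ->
  (iprod P \x P)%E ((fun we => upd k we.1 we.2) @^-1` A) = iprod P A.
Proof.
have mu1 : measurable_fun setT (fun we : seqspace E * E => upd k we.1 we.2) := measurable_upd k.
pose U : {mfun (seqspace E * E)%type >-> seqspace E} :=
  HB.pack (fun we : seqspace E * E => upd k we.1 we.2) (isMeasurableFun.Build _ _ _ _ _ mu1).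
pose m : probability (seqspace E) R := distribution (pprod (iprod P) P) U.
move=> mA; apply: (seqspace_measure_unique (m1 := m)) => //.
  exact: (le_lt_trans (probability_le1 m measurableT) (ltry 1)).
move=> n B mB; rewrite /m/= /distribution/= /pushforward/=.
pose B' i := if i == k then setT else B i.
have mB' i : measurable (B' i) by rewrite /B'; case: ifP.
pose C := if (k < n)%N then B k else setT.
have mC : measurable C by rewrite /C; case: ifP.
rewrite (_ : _ @^-1` _ = rect n B' `*` C); last first.
  apply/seteqP; split => we /=.
    move=> h; split.
      move=> i ni; have := h i ni; rewrite /B' /upd; case: eqP => //.
    by rewrite /C; case: ifP => // kn; have := h k kn; rewrite /upd eqxx.
  move=> [h Ck] i ni; rewrite /upd; case: eqP => [e|/eqP e].
    by move: Ck; rewrite /C -e ni.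
  by have := h i ni; rewrite /B' (negbTE e).
have mr := measurable_rect n mB'.
transitivity (iprod P (rect n B') * P C)%E; first exact: product_measure1E.
rewrite (iprod_rect P n mB') (iprod_rect P n mB).
have [kn|kn] := ltnP k n.
  rewrite (bigD1 (Ordinal kn))//= [RHS](bigD1 (Ordinal kn))//= /B' eqxx probability_setT mul1e.
  rewrite /C kn muleC; congr (_ * _)%E; apply: eq_bigr => i.
  by rewrite -val_eqE/= => /negbTE ->.
rewrite /C ltnNge kn probability_setT mule1; apply: eq_bigr => i _.
by rewrite /B' ifF//; apply/negbTE; rewrite neq_ltn (leq_trans (ltn_ord i) kn).
Qed.

Lemma mean_pprod d' (E' : measurableType d') (Q : probability E' R) (f : E * E' -> R) :
  measurable_fun setT f -> (forall x, 0 <= f x) ->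
  (forall x, summable_fun Q (fun y => f (x, y))) ->
  mean (pprod P Q) f = mean P (fun x => mean Q (fun y => f (x, y))).
Proof.
move=> mf f0 sf; rewrite /mean /Rintegral; congr fine.
rewrite (@fubini_tonelli1 _ _ _ _ _ P Q (EFin \o f)) => [||x]; last by rewrite lee_fin.
  by apply: eq_integral => x _; rewrite /fubini_F/= mean_EFin.
exact/measurable_EFinP.
Qed.

End resampling.

(** Fubini in a single coordinate: [iprod] is not presented as a product of coordinate k with the
    others, and invariance under resampling takes the place of such a splitting. *)
Lemma mean_resample d (E : measurableType d) (R : realType) (P : probability E R)
    k (G : seqspace E -> R) :
  measurable_fun setT G -> (forall w, 0 <= G w <= 1) ->
  mean (iprod P) G = mean (iprod P) (fun w => mean P (fun e => G (upd k w e))).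
Proof.
move=> mG G01.
have mu1 : measurable_fun setT (fun we : seqspace E * E => upd k we.1 we.2) := measurable_upd k.
have mGu : measurable_fun setT (fun we : seqspace E * E => G (upd k we.1 we.2)).
  exact: measurableT_comp mG mu1.
transitivity (mean (pprod (iprod P) P) (fun we => G (upd k we.1 we.2))); last rewrite mean_pprod//.
- apply/esym/(mean_law mu1) => // B mB; exact: resample_law.
- by move=> x; have /andP[] := G01 (upd k x.1 x.2).
- move=> w; apply: summable_itv; first exact: (measurable_fun_pair2 w mGu).
  by move=> e; exact: G01.
Qed.

(** * Paths in the sampled graph *)

Section present_edges.
Context (R : realType) (F : probability (kreinB R) R).

Let mR := measurableTypeR R.
Let U : probability mR R := uniform_prob (@ltr01 R).
Let WZ := seqspace (kreinB R).
Let WU := seqspace (seqspace mR).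
Let PZ : probability WZ R := iprod F.
Let PU : probability WU R := iprod (iprod U).

Let Uset b (p : R) := [set x : mR | (x <= p) = b].

Lemma uniform_le_clip p : U [set x : mR | x <= p] = (Num.max 0 (Num.min 1 p))%:E.
Proof.
have -> : [set x : mR | x <= p] = Uset true p by [].
have h q : 0 <= q <= 1 -> U (Uset true q) = q%:E by move=> q01; rewrite uniform_le_pmf.
have ms q : measurable (Uset true q) by exact: measurable_le_set.
have mono q q' : q <= q' -> (U (Uset true q) <= U (Uset true q'))%E.
  by move=> qq; apply: le_measure; rewrite ?inE//; move=> x /= xq; exact: le_trans qq.
case: (leP p 0) => p0.
  have -> : Num.min 1 p = p by rewrite min_r// (le_trans p0).
  rewrite max_l//; apply/eqP; rewrite eq_le measure_ge0 andbT.
  by rewrite -(h 0) ?lexx ?ler01//; exact: mono.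
case: (leP p 1) => p1.
  by rewrite (max_r (ltW p0)) h// (ltW p0).
rewrite max_r//; apply/eqP; rewrite eq_le probability_le1//=.
by rewrite -(h 1) ?lexx ?ler01//; apply: mono; exact: ltW.
Qed.

Lemma prod_pairs n (f : nat -> nat -> R) (es : seq (nat * nat)) :
  uniq es -> all (fun e => (e.1 < e.2 < n)%N) es ->
  \prod_(j < n) \prod_(i < j) (if (i : nat, j : nat) \in es then f i j else 1) =
  \prod_(e <- es) f e.1 e.2.
Proof.
elim: es => [_ _|e es ih /= /andP[ees ues] /andP[/andP[e12 e2n] aes]].
  by rewrite big_nil big1// => j _; rewrite big1.
rewrite big_cons -ih//.
have -> : f e.1 e.2 = \prod_(j < n) \prod_(i < j) (if (i : nat, j : nat) == e then f i j else 1).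
  rewrite (bigD1 (Ordinal e2n))//= [X in _ * X]big1 ?mulr1; last first.
    move=> j; rewrite -val_eqE/= => jn; rewrite big1// => i _; case: eqP => // ije.
    by move: jn; rewrite -ije eqxx.
  rewrite (bigD1 (Ordinal e12))//= [X in _ * X]big1 ?mulr1; last first.
    move=> i; rewrite -val_eqE/= => jn; case: eqP => // ije.
    by move: jn; rewrite -{2}ije eqxx.
  by rewrite -surjective_pairing eqxx.
rewrite -big_split/=; apply: eq_bigr => j _; rewrite -big_split/=; apply: eq_bigr => i _.
rewrite inE; case: eqP => [->|_]; last by rewrite mul1r.
by rewrite (negbTE ees) mulr1.
Qed.

Definition present (es : seq (nat * nat)) (w : WZ * WU) : bool :=
  all (fun e => sample_edge w e.1 e.2) es.

Definition eweight (es : seq (nat * nat)) (z : WZ) : R :=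
  \prod_(e <- es) kclip (z e.1) (z e.2).

Lemma eweight_itv es z : 0 <= eweight es z <= 1.
Proof.
rewrite /eweight; elim: es => [|e es ih]; first by rewrite big_nil ler01 lexx.
by rewrite big_cons; exact: itv01M (kclip_itv _ _) ih.
Qed.

Lemma measurable_eweight es : measurable_fun setT (eweight es).
Proof.
by apply: measurable_prod => e _; apply: measurable_kclip; exact: measurable_coord.
Qed.

Lemma measurable_present es : measurable_fun setT (present es).
Proof.
elim: es => [|e es ih]; first exact: measurable_cst.
by apply: measurable_and; [exact: measurable_sample_edge_ij|exact: ih].
Qed.

Lemma present_section es z : uniq es -> all (fun e => (e.1 < e.2)%N) es ->
  PU [set u | present es (z, u)] = (eweight es z)%:E.
Proof.
move=> ues aes.
pose n := (\max_(e <- es) e.2).+1.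
have aen : all (fun e => (e.1 < e.2 < n)%N) es.
  apply/allP => e ee; rewrite (allP aes)//= ltnS.
  by apply: (@leq_bigmax_seq _ es xpredT snd).
pose B j i := if (i, j) \in es then [set x : mR | x <= kdot (z i) (z j)] else setT.
have mB j i : measurable (B j i).
  by rewrite /B; case: ifP => // _; exact: (measurable_le_set _ true).
rewrite (_ : mkset _ = rect n (fun j => rect j (B j))); last first.
  apply/seteqP; split => u /=.
    move=> /allP pu j jn i ij; rewrite /B; case: ifP => // /pu/=.
    by rewrite sample_edge_lt.
  move=> h; apply/allP => e ee; have /andP[e12 e2n] := allP aen e ee.
  rewrite sample_edge_lt//; have := h _ e2n _ e12.
  by rewrite /B -surjective_pairing ee.
transitivity (\prod_(j < n) iprod U (rect j (B j)))%E.
  by apply: iprod_rect => j; exact: measurable_rect.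
rewrite /eweight -(prod_pairs (fun i j => kclip (z i) (z j)) ues aen) -prodEFin.
apply: eq_bigr => j _; rewrite iprod_rect// -prodEFin; apply: eq_bigr => i _.
rewrite /B; case: ifP => _; last by rewrite probability_setT.
exact: uniform_le_clip.
Qed.

Lemma natr_bool_itv (b : bool) : 0 <= (b%:R : R) <= 1.
Proof. by case: b; rewrite ?lexx ?ler01. Qed.

Lemma measurable_natr_bool d (T : measurableType d) (b : T -> bool) :
  measurable_fun setT b -> measurable_fun setT (fun t => (b t)%:R : R).
Proof.
move=> mb; have -> : (fun t => (b t)%:R) = (\1_(b @^-1` [set true]) : T -> R).
  by apply/funext => t; rewrite indicE; congr (nat_of_bool _)%:R; apply/idP/idP; rewrite inE/=.
by apply: measurable_indic; exact: (preimage_measurable mb).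
Qed.

Definition canon : probability (WZ * WU)%type R := pprod PZ PU.

(** Given the roots, distinct edges are independent, so the conditional probability of the list is
    the product of clipped kernels; a repeated edge would break this product. *)
Lemma mean_present es (H : WZ -> R) : uniq es -> all (fun e => (e.1 < e.2)%N) es ->
  measurable_fun setT H -> (forall z, 0 <= H z <= 1) ->
  mean canon (fun w => (present es w)%:R * H w.1) = mean PZ (fun z => eweight es z * H z).
Proof.
move=> ues aes mH H01.
have mPH : measurable_fun setT (fun w : WZ * WU => (present es w)%:R * H w.1).
  apply: measurable_funM; first by apply: measurable_natr_bool; exact: measurable_present.
  exact: measurableT_comp mH measurable_fst.
have PH01 w : 0 <= (present es w)%:R * H w.1 <= 1 by exact: itv01M (natr_bool_itv _) (H01 _).
rewrite /canon (mean_pprod PZ mPH).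
- apply: eq_mean => z; rewrite /=.
  have mz : measurable [set u | present es (z, u)].
    have := measurable_xsection z (_ : measurable (present es @^-1` [set true])).
    rewrite /xsection (_ : [set y | _] = [set u | present es (z, u)]).
      by apply; exact: (preimage_measurable (measurable_present es)).
    by apply/seteqP; split => u /=; rewrite inE.
  transitivity (mean PU (fun u => H z * \1_[set u | present es (z, u)] u)).
    apply: eq_mean => u; rewrite mulrC; congr (_ * _); rewrite indicE.
    by congr (nat_of_bool _)%:R; apply/idP/idP; rewrite inE.
  rewrite meanZ; last exact: summable_indic.
  by rewrite mean_indic// /pr present_section// mulrC.
- by move=> w; have /andP[] := PH01 w.
- move=> z; apply: summable_itv; first exact: (measurable_fun_pair2 z mPH).
  by move=> u; exact: PH01.
Qed.

(* The path from [i] to [j] through the vertices [s, ..., s + m - 1], with each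
   edge stored in increasing order; meant for [i, j < s] and [0 < m]. *)
Fixpoint path_edges (m s i j : nat) : seq (nat * nat) :=
  if m is m'.+1 then (i, s) :: path_edges m' s.+1 s j else [:: (j, i)].

Lemma path_edgesP m s i j e : e \in path_edges m.+1 s i j -> (s <= e.2 < s + m.+1)%N.
Proof.
elim: m s i => [|m ih] s i; rewrite !inE => /orP[/eqP -> /=|]; try lia.
  by move=> /eqP -> /=; lia.
by move=> /ih; lia.
Qed.

Lemma path_edges_lt m s i j : (i < s)%N -> (j < s)%N ->
  all (fun e => (e.1 < e.2)%N) (path_edges m.+1 s i j).
Proof.
elim: m s i => [|m ih] s i is' js /=; first by rewrite is' js.
by rewrite is'/=; apply: (ih s.+1 s) => //; exact: ltnW.
Qed.

(** The case i = j must be covered, since the diagonal Gram entries are needed. A path i, s, i uses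
    the same edge twice; from two interior vertices on, closed paths have distinct edges as well. *)
Lemma path_edges_uniq m s i j : (j < s)%N -> uniq (path_edges m.+2 s i j).
Proof.
have last_uniq m' s' i' : (j < i')%N -> (i' < s')%N -> uniq (path_edges m'.+1 s' i' j).
  elim: m' s' i' => [|m' ih] s' i' ji is'.
    by rewrite /= inE andbT xpair_eqE negb_and (gtn_eqF ji).
  rewrite [path_edges _ _ _ _]/= -/(path_edges m'.+1 s'.+1 s' j) cons_uniq.
  rewrite ih ?andbT//; last exact: ltn_trans is'.
  by apply/negP => /path_edgesP /=; rewrite ltnn.
move=> js; rewrite [path_edges _ _ _ _]/= -/(path_edges m.+1 s.+1 s j) cons_uniq.
rewrite last_uniq// andbT.
by apply/negP => /path_edgesP /=; rewrite ltnn.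
Qed.

Definition indep_of (a b : nat) (H : WZ -> R) :=
  forall k z e, (a <= k < b)%N -> H (upd k z e) = H z.

(** H collects all factors that avoid the interior vertices, so the lemma applies to one path, to a
    path times a kernel and to a pair of paths. The induction absorbs the first edge into H,
    integrates the later vertices, then the vertex s. *)
Lemma mean_path m s i j (H : WZ -> R) : measurable_fun setT H ->
  (forall z, 0 <= H z <= 1) -> (i < s)%N -> (j < s)%N -> indep_of s (s + m) H ->
  mean PZ (fun z => eweight (path_edges m s i j) z * H z) =
  mean PZ (fun z => iker F m (z i) (z j) * H z).
Proof.
elim: m s i H => [|m ih] s i H mH H01 is' js Hind.
  apply: eq_mean => z; rewrite /eweight big_seq1/=.
  by rewrite /kclip kdotC.
have mk i' j' : measurable_fun setT (fun z : WZ => kclip (z i') (z j')).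
  by apply: measurable_kclip; exact: measurable_coord.
have kH01 (z : WZ) : 0 <= kclip (z i) (z s) * H z <= 1 by exact: itv01M (kclip_itv _ _) (H01 z).
transitivity (mean PZ (fun z => eweight (path_edges m s.+1 s j) z *
    (kclip (z i) (z s) * H z))).
  by apply: eq_mean => z; rewrite /eweight big_cons/=; ring.
rewrite ih; [|exact: measurable_funM|exact: kH01|exact: ltnSn|exact: ltnW|]; last first.
  move=> k z e /andP[sk ks]; rewrite Hind; last by lia.
  by rewrite /upd !ifF//; lia.
(* Only now is s integrated: the remaining path has become a kernel of [z s] and [z j], and
   averaging over [z s] adds one interior vertex. *)
rewrite (mean_resample F s); last 2 first.
- apply: measurable_funM; last exact: measurable_funM.
  by apply: measurable_iker; exact: measurable_coord.
- by move=> z; exact: itv01M (iker_itv _ _ _ _) (kH01 z).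
apply: eq_mean => z.
transitivity (mean F (fun e => H z * (kclip (z i) e * iker F m e (z j)))).
  apply: eq_mean => e; rewrite Hind; last by lia.
  by rewrite /upd eqxx !ifF; [ring|lia|lia].
rewrite meanZ; first by rewrite mulrC.
apply: summable_itv => [|e]; last exact: itv01M (kclip_itv _ _) (iker_itv _ _ _ _).
apply: measurable_funM; first by apply: measurable_kclip.
by apply: measurable_iker.
Qed.

Lemma eweight_path_upd m s i j k z e : k != i -> k != j -> ~~ (s <= k < s + m)%N ->
  eweight (path_edges m s i j) (upd k z e) = eweight (path_edges m s i j) z.
Proof.
rewrite /eweight; elim: m s i => [|m ih] s i ki kj ks.
  by rewrite !big_seq1/= /upd ![_ == k]eq_sym (negbTE ki) (negbTE kj).
have ks' : k != s by lia.
rewrite !big_cons ih//; last by lia.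
by rewrite /= /upd ![_ == k]eq_sym (negbTE ki) (negbTE ks').
Qed.

(* The copies [v = 0, 1, ...] of the path have disjoint sets of interior
   vertices, hence are independent given the latent positions of [i] and [j]. *)
Definition path_start (m i j v : nat) := ((maxn i j).+1 + v * m.+2)%N.

Definition path_present m i j v (a : array) : bool :=
  all (fun e => a e.1 e.2) (path_edges m.+2 (path_start m i j v) i j).

Definition path_freq n m i j (a : array) : R :=
  n.+1%:R^-1 * \sum_(v < n.+1) (path_present m i j v a)%:R.

Let path_start_gt m i j v : (i < path_start m i j v)%N /\ (j < path_start m i j v)%N.
Proof. by rewrite /path_start; lia. Qed.

Lemma measurable_path_present m i j v :
  measurable_fun setT (fun w : WZ * WU => path_present m i j v (sample_edge w)).
Proof. exact: measurable_present. Qed.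

(** With T v the indicator of path v and K the kernel at its endpoints, the means of T v T v', T v K
    and K K all equal that of K^2. The deviations T v - K are thus pairwise uncorrelated, and
    Chebyshev applies although K is random. *)
Lemma path_concentration n m i j (e : R) : 0 < e ->
  pr canon [set w | e <= `|path_freq n m i j (sample_edge w) - iker F m.+2 (w.1 i) (w.1 j)|] <=
  (n.+1%:R * e ^+ 2)^-1.
Proof.
move=> e0.
pose es v := path_edges m.+2 (path_start m i j v) i j.
pose K (z : WZ) := iker F m.+2 (z i) (z j).
pose T v (w : WZ * WU) : R := (present (es v) w)%:R.
have mK : measurable_fun setT K by apply: measurable_iker; exact: measurable_coord.
have K01 z : 0 <= K z <= 1 by exact: iker_itv.
have ues v : uniq (es v) by apply: path_edges_uniq; have [] := path_start_gt m i j v.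
have aes v : all (fun e => (e.1 < e.2)%N) (es v).
  by apply: path_edges_lt; have [] := path_start_gt m i j v.
have Kind v : indep_of (path_start m i j v) (path_start m i j v + m.+2) K.
  move=> k z u /andP[sk _]; have [is' js] := path_start_gt m i j v.
  by rewrite /K /upd !ifF//; lia.
have KK01 z : 0 <= K z * K z <= 1 by exact: itv01M (K01 z) (K01 z).
have meanTK v : mean canon (fun w => T v w * K w.1) = mean PZ (fun z => K z * K z).
  rewrite (mean_present (ues v) (aes v) mK K01).
  by have [is' js] := path_start_gt m i j v; rewrite mean_path.
have meanKK : mean canon (fun w => K w.1 * K w.1) = mean PZ (fun z => K z * K z).
  have := @mean_present [::] (fun z => K z * K z) isT isT (measurable_funM mK mK) KK01.
  rewrite (eq_mean canon (g := fun w => K w.1 * K w.1)); last by move=> w; rewrite mul1r.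
  by move=> ->; apply: eq_mean => z; rewrite /eweight big_nil mul1r.
have meanTT v v' : (v < v')%N -> mean canon (fun w => T v w * T v' w) = mean PZ (fun z => K z * K z).
  move=> vv'.
  have v'm : (path_start m i j v + m.+2 <= path_start m i j v')%N.
    by rewrite /path_start -addnA leq_add2l -mulSnr leq_mul2r vv' orbT.
  have dis : uniq (es v ++ es v').
    have esP u p : p \in es u ->
        (path_start m i j u <= p.2 < path_start m i j u + m.+2)%N by exact: path_edgesP.
    rewrite cat_uniq !ues andbT andTb; apply/hasPn => p /esP p'.
    by apply/negP => /esP; lia.
  have ltv : all (fun e => (e.1 < e.2)%N) (es v ++ es v') by rewrite all_cat !aes.
  have m1 : measurable_fun setT (fun _ : WZ => 1 : R) by exact: measurable_cst.
  have i1 (z : WZ) : 0 <= (1 : R) <= 1 by rewrite lexx ler01.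
  have := mean_present dis ltv m1 i1.
  rewrite (eq_mean canon (g := fun w => T v w * T v' w)); last first.
    by move=> w; rewrite mulr1 /present all_cat -natrM mulnb.
  move=> ->.
  transitivity (mean PZ (fun z => eweight (es v) z * eweight (es v') z)).
    by apply: eq_mean => z; rewrite mulr1 /eweight big_cat.
  have [is' js] := path_start_gt m i j v; have [is'' js'] := path_start_gt m i j v'.
  rewrite mean_path//; last 3 first.
  - exact: measurable_eweight.
  - exact: eweight_itv.
  - move=> k z u /andP[sk ks]; apply: eweight_path_upd; lia.
  transitivity (mean PZ (fun z => eweight (es v') z * K z)).
    by apply: eq_mean => z; rewrite mulrC.
  by rewrite mean_path.
pose D v w := T v w - K w.1.
have mT v : measurable_fun setT (T v) by apply: measurable_natr_bool; exact: measurable_present.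
have mK1 : measurable_fun setT (fun w : WZ * WU => K w.1) by exact: measurableT_comp mK measurable_fst.
have mD v : measurable_fun setT (D v) by exact: measurable_funB.
have D1 v w : `|D v w| <= 1.
  exact: itv01B (natr_bool_itv _) (K01 w.1).
have bound (f g : WZ * WU -> R) : measurable_fun setT f -> measurable_fun setT g ->
    (forall w, 0 <= f w <= 1) -> (forall w, 0 <= g w <= 1) -> summable_fun canon (fun w => f w * g w).
  move=> mf mg f1 g1; apply: summable_itv; first exact: measurable_funM.
  by move=> w; exact: itv01M (f1 w) (g1 w).
have T01 v w : 0 <= T v w <= 1 by exact: natr_bool_itv.
have D0 v v' : (v < v')%N -> mean canon (fun w => D v w * D v' w) = 0.
  move=> vv'.
  rewrite (eq_mean canon (g := fun w => (T v w * T v' w + K w.1 * K w.1) -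
      (T v w * K w.1 + T v' w * K w.1))); last by move=> w; rewrite /D; ring.
  have s1 := bound _ _ (mT v) (mT v') (T01 v) (T01 v').
  have s2 := bound _ _ mK1 mK1 (fun w => K01 w.1) (fun w => K01 w.1).
  have s3 := bound _ _ (mT v) mK1 (T01 v) (fun w => K01 w.1).
  have s4 := bound _ _ (mT v') mK1 (T01 v') (fun w => K01 w.1).
  rewrite (meanB (summableD s1 s2) (summableD s3 s4)) (meanD s1 s2) (meanD s3 s4).
  by rewrite meanTT// !meanTK meanKK subrr.
have DE w : n.+1%:R^-1 * \sum_(v < n.+1) D v w = path_freq n m i j (sample_edge w) - K w.1.
  rewrite /D sumrB mulrBr; congr (_ - _).
  by rewrite sumr_const card_ord -[X in _ * X]mulr_natl mulKf// pnatr_eq0.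
rewrite (_ : [set w | _] = [set w | e <= `|n.+1%:R^-1 * \sum_(v < n.+1) D v w|]).
  exact: (chebyshev_average n mD D1 D0 e0).
by under eq_set do rewrite -DE.
Qed.

End present_edges.

(** * Recovering the two Gram matrices *)

Section patterns.
Context (R : realType).
Implicit Types F : probability (kreinB R) R.

Definition agree n (a b : array) := forall i j, (i < j < n)%N -> a i j = b i j.

Lemma measurable_agree n b : measurable ([set a | agree n a b] : set array).
Proof.
rewrite (_ : mkset _ = \bigcap_i \bigcap_j [set a : array | (i < j < n)%N -> a i j = b i j]).
  apply: bigcapT_measurable => i; apply: bigcapT_measurable => j.
  case: (boolP (i < j < n)%N) => ij; last first.
    by rewrite (_ : mkset _ = setT)//; apply/seteqP; split.
  have me : measurable ([set a | a i j] : set array).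
    by apply: sub_sigma_algebra; exists i, j.
  case: (boolP (b i j)) => bij.
    rewrite (_ : mkset _ = [set a : array | a i j])//; apply/seteqP; split => a /=.
      by move=> /(_ isT) ->.
    by move=> ->.
  rewrite (_ : mkset _ = ~` [set a : array | a i j]); first exact: measurableC.
  apply/seteqP; split => a /=; first by move=> /(_ isT) ->.
  by move=> /negP/negbTE ->.
apply/seteqP; split => a h; first by move=> i _ j _; exact: h.
by move=> i j; exact: (h i I j I).
Qed.

(** Pattern probabilities depend on F alone. This replaces the arbitrary samples behind
    [same_sampling_distribution] by canonical ones, for which path frequencies are controlled. *)
Lemma sampling_agree F d (W : measurableType d) (Pr : probability W R) Z A n b :
  graph_sample Pr Z A F ->
  Pr [set w | agree n (A w) b] = (\int[iprod F]_z (pmf_prod n b z)%:E)%E.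
Proof.
move=> [iidZ mA _ _ hA].
have := hA n b setT; rewrite setTI => ->; last first.
  by apply: sub_sigma_algebra; exists 0%N, setT; split => //; rewrite preimage_setT.
pose ZZ (w : W) : seqspace (kreinB R) := fun i => Z i w.
have mZZ : measurable_fun setT ZZ by apply: measurable_seqspace => i; exact: iidZ.1.
apply: (integral_law (nu := iprod F) (X := ZZ) (f := fun z => (pmf_prod n b z)%:E)) => //.
- pose X : {mfun W >-> seqspace (kreinB R)} := HB.pack ZZ (isMeasurableFun.Build _ _ _ _ _ mZZ).
  move=> B mB; apply: (seqspace_measure_unique (m1 := distribution Pr X)) => //.
    exact: (le_lt_trans (probability_le1 (distribution Pr X) measurableT) (ltry 1)).
  move=> m C mC; transitivity (\prod_(i < m) F (C i))%E; last first.
    by apply/esym; exact: iprod_rect.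
  by rewrite -(iidZ.2 m C mC).
- apply/measurable_EFinP.
  exact: (measurable_pmf_prod n b (fun i => @measurable_coord _ (kreinB R) i)).
Qed.

Lemma same_agree F1 F2 n b : is_grd F1 -> is_grd F2 -> same_sampling_distribution F1 F2 ->
  pr (canon F1) [set w | agree n (sample_edge w) b] =
  pr (canon F2) [set w | agree n (sample_edge w) b].
Proof.
move=> g1 g2 [mu [[d1 [W1 [Pr1 [Z1 [A1 [s1 [mA1 l1]]]]]]] [d2 [W2 [Pr2 [Z2 [A2 [s2 [mA2 l2]]]]]]]]].
have can F : is_grd F -> canon F [set w | agree n (sample_edge w) b] =
    (\int[iprod F]_z (pmf_prod n b z)%:E)%E.
  by move=> g; exact: (sampling_agree n b (graph_sample_exists g)).
have law F d (W : measurableType d) (Pr : probability W R) Z A :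
    graph_sample Pr Z A F -> (forall B, measurable B -> Pr (A @^-1` B) = mu B) ->
    mu [set a | agree n a b] = (\int[iprod F]_z (pmf_prod n b z)%:E)%E.
  move=> s h; rewrite -(h _ (measurable_agree n b)).
  exact: (sampling_agree n b s).
have e12 := etrans (can _ g1) (etrans (esym (law _ _ _ _ _ _ s1 l1))
  (etrans (law _ _ _ _ _ _ s2 l2) (esym (can _ g2)))).
exact: (congr1 fine e12).
Qed.

Lemma mean_sum d (T : measurableType d) (mu : probability T R) (I : Type) (r : seq I)
    (P : pred I) (f : I -> T -> R) : (forall i, summable_fun mu (f i)) ->
  summable_fun mu (fun x => \sum_(i <- r | P i) f i x) /\
  mean mu (fun x => \sum_(i <- r | P i) f i x) = \sum_(i <- r | P i) mean mu (f i).
Proof.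
move=> sf; elim: r => [|i r [ih1 ih2]].
  under eq_fun do rewrite big_nil.
  by rewrite big_nil mean_cst; split => //; exact: summable_cst.
under eq_fun do rewrite big_cons; rewrite big_cons; case: (P i) => //.
by split; [exact: summableD|rewrite meanD// ih2].
Qed.

(** Let S be the set of patterns met by E1. The event that the pattern lies in S has the same
    probability under both laws, at least that of E1; if E2 avoided it, the two probabilities would
    add up to at most 1. *)
Lemma common_agree F1 F2 n (E1 E2 : set _) : is_grd F1 -> is_grd F2 ->
  same_sampling_distribution F1 F2 -> measurable E1 -> measurable E2 ->
  1 < pr (canon F1) E1 + pr (canon F2) E2 ->
  exists w1 w2, [/\ E1 w1, E2 w2 & agree n.+1 (sample_edge w1) (sample_edge w2)].
Proof.
move=> g1 g2 same mE1 mE2 lt1; apply: contrapT => noc.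
pose ptn (a : array) := [ffun p : 'I_n.+1 * 'I_n.+1 => (p.1 < p.2)%N && a p.1 p.2].
pose arr (f : {ffun 'I_n.+1 * 'I_n.+1 -> bool}) : array := fun i j => f (inord i, inord j).
have ptnE a b : ptn a = ptn b <-> agree n.+1 a b.
  split=> [/ffunP ab i j /andP[ij jn]|ab].
    have := ab (Ordinal (ltn_trans ij jn), Ordinal jn); rewrite !ffunE/= ij/=.
    exact.
  by apply/ffunP => -[i j]; rewrite !ffunE/=; case: ltnP => //= ij; rewrite ab// ij ltn_ord.
have arrK a f : ptn a = f -> ptn (arr f) = f.
  move=> <-; apply/ptnE => i j /andP[ij jn]; rewrite /arr ffunE/= !inordK// ?ij//.
  exact: ltn_trans jn.
pose ev f := [set w : _ * _ | ptn (@sample_edge R w) = f].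
(* A table that is no pattern, for instance with an entry off the strict upper triangle, gives the
   empty event. *)
have evE f : ev f = if ptn (arr f) == f then [set w | agree n.+1 (sample_edge w) (arr f)] else set0.
  apply/seteqP; split => w; case: eqP => [e|ne] /=.
  - by move=> h; apply/ptnE; rewrite e.
  - by move=> /arrK.
  - by move=> h; rewrite -e; apply/ptnE.
  - by [].
have mev f : measurable (ev f).
  rewrite evE; case: ifP => // _.
  exact: (preimage_measurable (@measurable_sample_edge R) (measurable_agree n.+1 (arr f))).
have ev12 f : pr (canon F1) (ev f) = pr (canon F2) (ev f).
  by rewrite evE; case: ifP => _; [exact: same_agree|rewrite /pr !measure0].
pose S f := `[< exists2 w1, E1 w1 & ptn (sample_edge w1) = f >].
have SE w : \sum_(f | S f) (\1_(ev f) w : R) = (S (ptn (sample_edge w)))%:R.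
  have e0 f : f != ptn (sample_edge w) -> \1_(ev f) w = 0 :> R.
    move=> h; rewrite indicE (_ : _ \in _ = false)//; apply/negP; rewrite inE/= => e.
    by rewrite e eqxx in h.
  case: (boolP (S _)) => Sw.
    rewrite (bigD1 (ptn (sample_edge w)))//= big1 ?addr0; last by move=> f /andP[_ /e0].
    by rewrite indicE (mem_set (_ : ev _ w)).
  rewrite big1// => f Sf; apply: e0; apply/negP => /eqP e.
  by rewrite -e Sf in Sw.
have s1 := mean_sum (index_enum _) S (fun f => summable_indic (canon F1) (mev f)).
have s2 := mean_sum (index_enum _) S (fun f => summable_indic (canon F2) (mev f)).
have le1 : pr (canon F1) E1 <= \sum_(f | S f) pr (canon F1) (ev f).
  under eq_bigr do rewrite -mean_indic//.
  rewrite -s1.2 -mean_indic//; apply: mean_le => [||w]; [exact: summable_indic|exact: s1.1|].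
  rewrite SE indicE; case: (boolP (w \in E1)); last by rewrite ler0n.
  by rewrite inE => E1w; rewrite (_ : S _)//; apply/asboolP; exists w.
have le2 : \sum_(f | S f) pr (canon F2) (ev f) <= 1 - pr (canon F2) E2.
  under eq_bigr do rewrite -mean_indic//.
  rewrite -s2.2 -pr_setC// -mean_indic; last exact: measurableC.
  apply: mean_le => [||w]; [exact: s2.1|by apply: summable_indic; exact: measurableC|].
  rewrite SE indicE; case: (boolP (w \in ~` E2)) => [_|]; first by case: (S _).
  rewrite in_setC negbK inE => E2w; case: (boolP (S _)) => // /asboolP[w1 E1w1 /ptnE e].
  by case: noc; exists w1, w.
move: le1; rewrite (eq_bigr _ (fun f _ => ev12 f)) => le1.
by move: (le_trans le1 le2); rewrite lerBrDr => /(lt_le_trans lt1); rewrite ltxx.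
Qed.

End patterns.

Lemma dist_half (R : realType) (a b d e : R) :
  `|a - b| < e / 2 -> `|b - d| < e / 2 -> `|a - d| < e.
Proof.
by move=> ab bd; rewrite -(subrKA b) [e]splitr; apply: le_lt_trans (ler_normD _ _) (ltrD ab bd).
Qed.

(** * Estimating Gram entries from a finite graph *)

Section gram_approximation.
Context (R : realType) (F : probability (kreinB R) R).
Hypotheses (grdF : is_grd F) (sqF : square_integrable F).
Hypothesis uncF : uncorrelated_components F.

Let W := (seqspace (kreinB R) * seqspace (seqspace (measurableTypeR R)))%type.
Local Notation P := (canon F).

Definition root (i : nat) (w : W) : kreinB R := w.1 i.

Lemma measurable_root i : measurable_fun setT (root i).
Proof. exact: measurable_sample_root. Qed.

Lemma iid_root : iid P root F.
Proof. exact: iid_sample_root. Qed.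

Lemma ae_root i (G : set (kreinB R)) : {ae F, forall z, G z} -> {ae P, forall w, G (root i w)}.
Proof.
move=> [N [mN N0 hN]]; exists (root i @^-1` N); split.
- exact: (preimage_measurable (measurable_root i)).
- by rewrite (iid_law iid_root).
- by move=> w /= nG; exact: hN.
Qed.

Lemma cvg_probability (f : nat -> W -> R) (g : W -> R) (e eta : R) :
  (forall n, measurable_fun setT (f n)) -> measurable_fun setT g ->
  {ae P, forall w, f ^~ w @ \oo --> g w} -> 0 < e -> 0 < eta ->
  exists L, forall l, (L <= l)%N -> pr P [set w | e <= `|f l w - g w|] <= eta.
Proof.
move=> mf mg fg e0 eta0.
have Poo : (P setT < +oo)%E by exact: (le_lt_trans (probability_le1 P measurableT) (ltry 1)).
have fg' : {ae P, forall w, setT w -> f ^~ w @ \oo --> g w}.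
  by apply: filterS fg => w h _.
have [B [mB PB uB]] := ae_pointwise_almost_uniform mf mg measurableT Poo fg' eta0.
have [L _ hL] : \forall l \near \oo, forall w, ~ B w -> `|g w - f l w| < e.
  have : nbhs (g : {uniform` (setT `\` B) -> R}) [set h | forall w, ~ B w -> `|g w - h w| < e].
    apply/uniform_nbhs; exists [set xy : R * R | ball xy.1 e xy.2]; split.
      exact: (entourage_ball R (PosNum e0)).
    by move=> h hB w nBw; have /= := hB w; rewrite -ball_normE/=; apply.
  by move/uB.
exists L => l Ll; have mE := measurable_norm_ge e (measurable_funB (mf l) mg).
apply: le_trans (pr_le P mE mB _) _.
  move=> w /= ew; apply: contrapT => /(hL l Ll w); rewrite distrC.
  by rewrite ltNge ew.
by rewrite -lee_fin pr_EFin//; exact: ltW.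
Qed.

Lemma pr_bigcup_fin_le (B : nat -> set W) n e : (forall i, measurable (B i)) ->
  (forall i, (i < n)%N -> pr P (B i) <= e) ->
  measurable (\bigcup_(i < n) B i) /\ pr P (\bigcup_(i < n) B i) <= n%:R * e.
Proof.
move=> mB; elim: n => [_|n ih Be].
  by rewrite bigcup_mkord big_ord0; split => //; rewrite /pr measure0 mul0r.
have [mb be] := ih (fun i (ni : (i < n)%N) => Be i (ltnW ni)).
rewrite bigcup_mkord big_ord_recr/= -bigcup_mkord; split; first exact: measurableU.
apply: le_trans (pr_setU_le P mb (mB n)) _.
by rewrite -[n.+1]addn1 natrD mulrDl mul1r lerD// Be.
Qed.

Variable c : R.
Hypotheses (c0 : 0 < c) (cM : second_moment F <= c).

(** The observable counterpart of [kpoly]; it involves the law only through c. [path_freq R N l] is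
    about paths with l + 2 interior vertices, hence the shift of the coefficients. *)
Definition fpoly N (p : {poly R}) i j (a : array) : R :=
  \sum_(l < (size p).-2) p`_l.+2 * (c^-1 ^+ l.+2 * path_freq R N l i j a).

Lemma measurable_path_freq N m i j :
  measurable_fun setT (fun w : W => path_freq R N m i j (sample_edge w)).
Proof.
apply: measurable_funM; first exact: measurable_cst.
apply: measurable_sum => v.
by apply: measurable_natr_bool; exact: measurable_path_present.
Qed.

Lemma measurable_fpoly N p i j : measurable_fun setT (fun w : W => fpoly N p i j (sample_edge w)).
Proof.
apply: measurable_sum => l; apply: measurable_funM; first exact: measurable_cst.
by apply: measurable_funM; [exact: measurable_cst|exact: measurable_path_freq].
Qed.

Lemma measurable_kpoly (p : {poly R}) i j :
  measurable_fun setT (fun w : W => kpoly F c p (root i w) (root j w)).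
Proof.
apply: measurable_sum => l; apply: measurable_funM; first exact: measurable_cst.
apply: measurable_funM; first exact: measurable_cst.
by apply: measurable_iker; exact: measurable_root.
Qed.

Lemma sum_ord_drop2 (f : nat -> R) s : f 0 = 0 -> f 1 = 0 ->
  \sum_(i < s) f i = \sum_(l < s.-2) f l.+2.
Proof.
move=> f0 f1; case: s => [|[|s]]; first by rewrite !big_ord0.
  by rewrite big_ord1 big_ord0.
by rewrite !big_ord_recl/= f0 f1 !add0r.
Qed.

Lemma fpoly_concentration (p : {poly R}) i j (e eta : R) : (forall l, (l < 2)%N -> p`_l = 0) ->
  0 < e -> 0 < eta -> exists N0, forall N, (N0 <= N)%N ->
  pr P [set w | e <= `|fpoly N p i j (sample_edge w) - kpoly F c p (root i w) (root j w)|] <= eta.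
Proof.
move=> p01 e0 eta0.
pose n := (size p).-2.
pose q l := p`_l.+2 * c^-1 ^+ l.+2.
(* M exceeds the total weight of the frequencies by 1, so errors of at most e / M in each of them
   sum to less than e, even when the weight is 0. *)
pose M : R := \sum_(l < n) `|q l| + 1.
have M0 : 0 < M by rewrite ltr_wpDl// sumr_ge0.
have kE w : kpoly F c p (root i w) (root j w) = \sum_(l < n) q l * iker F l.+2 (root i w) (root j w).
  rewrite /kpoly (sum_ord_drop2 (f := fun l => p`_l * (c^-1 ^+ l * iker F l (root i w) (root j w)))).
  - by apply: eq_bigr => l _; rewrite mulrA.
  - by rewrite p01// mul0r.
  - by rewrite p01// mul0r.
have fE N a : fpoly N p i j a = \sum_(l < n) q l * path_freq R N l i j a.
  by apply: eq_bigr => l _; rewrite mulrA.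
pose dl : R := e / M; have d0 : 0 < dl by rewrite divr_gt0.
pose D N l w := path_freq R N l i j (sample_edge w) - iker F l.+2 (root i w) (root j w).
have mD N l : measurable_fun setT (D N l).
  apply: measurable_funB; first exact: measurable_path_freq.
  by apply: measurable_iker; exact: measurable_root.
have n1 : 0 < n.+1%:R :> R by rewrite ltr0n.
(* From this sample size on, Chebyshev gives each frequency a failure probability of at most eta /
   (n + 1); n failures then cost less than eta. *)
pose X : R := n.+1%:R / (eta * dl ^+ 2).
have ed : 0 < eta * dl ^+ 2 by rewrite mulr_gt0// exprn_gt0.
have X0 : 0 <= X by rewrite divr_ge0// ltW.
exists (Num.bound X) => N N0.
have XN : X <= N.+1%:R.
  have := archi_boundP X0 => h; apply/ltW/(lt_le_trans h); rewrite ler_nat.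
  exact: leq_trans N0 (leqnSn _).
have prD l : pr P [set w | dl <= `|D N l w|] <= eta / n.+1%:R.
  apply: le_trans (path_concentration F N l i j d0) _.
  have N1 : 0 < N.+1%:R * dl ^+ 2 by rewrite mulr_gt0 ?ltr0n// exprn_gt0.
  rewrite -[X in X <= _]div1r ler_pdivrMr// mulrAC ler_pdivlMr// mul1r.
  by move: XN; rewrite /X ler_pdivrMr//; congr (_ <= _); ring.
have [mb be] := pr_bigcup_fin_le (n := n) (fun l => measurable_norm_ge dl (mD N l))
  (fun l _ => prD l).
apply: le_trans (_ : n%:R * (eta / n.+1%:R) <= _); last first.
  by rewrite mulrA ler_pdivrMr// mulrC ler_wpM2l ?ler_nat// ltW.
apply: le_trans be; apply: pr_le => //.
  apply: measurable_norm_ge; apply: measurable_funB; first exact: measurable_fpoly.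
  exact: measurable_kpoly.
move=> w /= ew; apply: contrapT => nw.
have Dd l : (l < n)%N -> `|D N l w| <= dl.
  by move=> ln; rewrite leNgt; apply/negP => h; apply: nw; exists l => //=; exact: ltW.
move: ew; rewrite fE kE -sumrB leNgt => /negP; apply.
apply: (@le_lt_trans _ _ ((M - 1) * dl)).
  apply: le_trans (ler_norm_sum _ _ _) _; rewrite /M addrK mulr_suml.
  apply: ler_sum => l _; rewrite -mulrBr normrM ler_wpM2l//.
  exact: Dd (ltn_ord l).
have -> : e = M * dl by rewrite /dl mulrC divfK// gt_eqF.
by rewrite ltr_pM2r// gtrBl.
Qed.

Definition gram_close N l i j (e : R) : set W := [set w |
  `|fpoly N (pos_poly R l) i j (sample_edge w) - dot (root i w).1 (root j w).1| < e /\
  `|- fpoly N (neg_poly R l) i j (sample_edge w) - dot (root i w).2 (root j w).2| < e].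

Lemma measurable_gram_close N l i j e : measurable (gram_close N l i j e).
Proof.
have h (f : W -> R) : measurable_fun setT f -> measurable [set w | `|f w| < e].
  move=> mf; rewrite (_ : mkset _ = ~` [set w | e <= `|f w|]).
    by apply: measurableC; exact: measurable_norm_ge.
  by apply/seteqP; split => w /=; rewrite ltNge; [move/negP|move=> ?; exact/negP].
apply: measurableI; apply: h; apply: measurable_funB.
- exact: measurable_fpoly.
- apply: measurable_dot; apply: coord_measurable_fst; exact: measurable_root.
- by apply: measurableT_comp => //; exact: measurable_fpoly.
- apply: measurable_dot; apply: coord_measurable_snd; exact: measurable_root.
Qed.

(** Two successive limits: the degree index l is fixed first by the almost sure convergence in
    [separation], and the number N of paths is then taken large depending on l. Two components and
    two limits give four bad events, each of probability at most eta / 4. *)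
Lemma gram_close_pr i j (e eta : R) : 0 < e -> 0 < eta ->
  exists L, forall l, (L <= l)%N -> exists N0, forall N, (N0 <= N)%N ->
  pr P (~` gram_close N l i j e) <= eta.
Proof.
move=> e0 eta0; have e20 : 0 < e / 2 by rewrite divr_gt0.
have et : 0 < eta / 4 by rewrite divr_gt0.
have [G [aG cG]] := separation grdF sqF uncF c0 cM.
have mk p : measurable_fun setT (fun w => kpoly F c p (root i w) (root j w)).
  exact: measurable_kpoly.
have m1 : measurable_fun setT (fun w : W => dot (root i w).1 (root j w).1).
  by apply: measurable_dot; apply: coord_measurable_fst; exact: measurable_root.
have m2 : measurable_fun setT (fun w : W => dot (root i w).2 (root j w).2).
  by apply: measurable_dot; apply: coord_measurable_snd; exact: measurable_root.
have mNk l : measurable_fun setT (fun w => - kpoly F c (neg_poly R l) (root i w) (root j w)).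
  exact: measurableT_comp.
have c1 : {ae P, forall w, (fun l => kpoly F c (pos_poly R l) (root i w) (root j w)) @ \oo -->
    dot (root i w).1 (root j w).1}.
  by apply: filterS2 (ae_root i aG) (ae_root j aG) => w Gi Gj; have [] := cG _ _ Gi Gj.
have c2 : {ae P, forall w, (fun l => - kpoly F c (neg_poly R l) (root i w) (root j w)) @ \oo -->
    dot (root i w).2 (root j w).2}.
  by apply: filterS2 (ae_root i aG) (ae_root j aG) => w Gi Gj; have [] := cG _ _ Gi Gj.
have [L1 h1] := cvg_probability (fun l => mk (pos_poly R l)) m1 c1 e20 et.
have [L2 h2] := cvg_probability mNk m2 c2 e20 et.
exists (maxn L1 L2) => l; rewrite geq_max => /andP[/h1 {}h1 /h2 {}h2].
have p01 k : (k < 2)%N -> (pos_poly R l)`_k = 0 by move=> /(pos_neg_poly_coef R l)[].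
have n01 k : (k < 2)%N -> (neg_poly R l)`_k = 0 by move=> /(pos_neg_poly_coef R l)[].
have [N1 h3] := fpoly_concentration i j p01 e20 et.
have [N2 h4] := fpoly_concentration i j n01 e20 et.
exists (maxn N1 N2) => N; rewrite geq_max => /andP[/h3 {}h3 /h4 {}h4].
set B1 := [set w | _] in h1; set B2 := [set w | _] in h2.
set B3 := [set w | _] in h3; set B4 := [set w | _] in h4.
have mf p := measurable_fpoly N p i j.
have mB1 : measurable B1 by apply: measurable_norm_ge; exact: measurable_funB.
have mB2 : measurable B2 by apply: measurable_norm_ge; exact: measurable_funB.
have mB3 : measurable B3 by apply: measurable_norm_ge; exact: measurable_funB.
have mB4 : measurable B4 by apply: measurable_norm_ge; exact: measurable_funB.
have mB12 : measurable (B1 `|` B2) by exact: measurableU.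
have mB34 : measurable (B3 `|` B4) by exact: measurableU.
apply: (@le_trans _ _ (pr P ((B1 `|` B2) `|` (B3 `|` B4)))); last first.
  apply: le_trans (pr_setU_le _ mB12 mB34) _.
  have q12 := le_trans (pr_setU_le P mB1 mB2) (lerD h1 h2).
  have q34 := le_trans (pr_setU_le P mB3 mB4) (lerD h3 h4).
  apply: le_trans (lerD q12 q34) _.
  by rewrite le_eqVlt; apply/orP; left; apply/eqP; field.
apply: pr_le.
- by apply: measurableC; exact: measurable_gram_close.
- exact: measurableU.
move=> w nw; apply: contrapT => nB; apply: nw.
have {}nB : [/\ ~ B1 w, ~ B2 w, ~ B3 w & ~ B4 w].
  by split => h; apply: nB; [left; left|left; right|right; left|right; right].
case: nB => /negP b1 /negP b2 /negP b3 /negP b4.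
move: b1 b2 b3 b4; rewrite /B1 /B2 /B3 /B4 /= -!ltNge.
move=> d1 d2 d3 d4; split; first exact: dist_half d3 d1.
by apply: dist_half d2; rewrite opprK addrC distrC.
Qed.

End gram_approximation.

(** * Two samples with a common finite graph *)

Section gram_coupling.
Context (R : realType).
Let W := (seqspace (kreinB R) * seqspace (seqspace (measurableTypeR R)))%type.

Lemma path_present_agree s m i j v (a b : array) :
  (path_start m i j v + m.+2 <= s)%N -> agree s a b ->
  path_present m i j v a = path_present m i j v b.
Proof.
move=> ls ab; apply: eq_in_all => e ee.
have /andP[_ e2] : (path_start m i j v <= e.2 < path_start m i j v + m.+2)%N.
  exact: path_edgesP ee.
apply: ab; rewrite (leq_trans e2 ls) andbT.
have lt : all (fun e => (e.1 < e.2)%N) (path_edges m.+2 (path_start m i j v) i j).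
  by apply: path_edges_lt; rewrite /path_start; lia.
exact: (allP lt).
Qed.

(** The N + 1 copies of a path start after i and j, and each occupies at most [size p] fresh
    vertices. *)
Lemma fpoly_agree s c N (p : {poly R}) i j n (a b : array) : (i < n)%N -> (j < n)%N ->
  (n + N.+1 * size p <= s)%N -> agree s a b -> fpoly c N p i j a = fpoly c N p i j b.
Proof.
move=> ni nj ns ab; apply: eq_bigr => l _; congr (_ * (_ * _)).
congr (_ * _); apply: eq_bigr => v _; congr (nat_of_bool _)%:R.
apply: path_present_agree ab; apply: leq_trans ns.
rewrite /path_start -addnA -mulSnr; apply: leq_add; first by lia.
by apply: leq_mul; [exact: ltn_ord|have := ltn_ord l; lia].
Qed.

Lemma pr_gram_close_all (F : probability (kreinB R) R) c n (e eta : R) : is_grd F ->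
  square_integrable F -> uncorrelated_components F -> 0 < c -> second_moment F <= c ->
  0 < e -> 0 < eta ->
  exists L, forall l, (L <= l)%N -> exists N0, forall N, (N0 <= N)%N ->
  exists B : set W, [/\ measurable B, pr (canon F) B <= eta &
    forall w i j, ~ B w -> (i < n)%N -> (j < n)%N -> gram_close c N l i j e w].
Proof.
move=> grd sq unc c0 cM e0 eta0.
(* The pairs (i, j) are numbered by i n + j, so that the union bound runs over one index. *)
pose K := (n * n)%N.
have K1 : 0 < K.+1%:R :> R by rewrite ltr0n.
have eK : 0 < eta / K.+1%:R by rewrite divr_gt0.
have /choice[L hL] k := gram_close_pr grd sq unc c0 cM (k %/ n) (k %% n) e0 eK.
exists (\max_(k < K) L k)%N => l Ll.
have /choice[N0 hN] k : exists N0, (k < K)%N -> forall N, (N0 <= N)%N ->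
    pr (canon F) (~` gram_close c N l (k %/ n) (k %% n) e) <= eta / K.+1%:R.
  case: (ltnP k K) => kK; last by exists 0%N.
  have /hL[N0 h] : (L k <= l)%N by apply: leq_trans Ll; exact: (leq_bigmax (Ordinal kK)).
  by exists N0.
exists (\max_(k < K) N0 k)%N => N NN.
pose B k : set W := ~` gram_close c N l (k %/ n) (k %% n) e.
have mB k : measurable (B k) by apply: measurableC; exact: measurable_gram_close.
have [mU pU] := pr_bigcup_fin_le mB (fun k (kK : (k < K)%N) =>
  hN k kK N (leq_trans (leq_bigmax (Ordinal kK)) NN)).
exists (\bigcup_(k < K) B k); split => //.
  apply: le_trans pU _; rewrite mulrA ler_pdivrMr// mulrC ler_wpM2l ?ler_nat//.
  exact: ltW.
move=> w i j nB ni nj; apply: contrapT => nc; apply: nB.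
exists (i * n + j)%N; first by rewrite /K/= -ltn_divLR ?(leq_trans _ ni)// divnMDl ?(leq_trans _ ni)// divn_small// addn0.
by rewrite /B/= divnMDl ?(leq_trans _ ni)// divn_small// addn0 modnMDl modn_small.
Qed.

(** Removing bad sets of probability at most 1/8 from the given events leaves at least 5/8 > 1/2 on
    each side, so a common pattern exists. On it the two statistics coincide, and each is within e/2
    of the Gram entry of its own sample. *)
Lemma gram_coupling (F1 F2 : probability (kreinB R) R) (E1 E2 : set W) n (e : R) :
  is_grd F1 -> is_grd F2 -> square_integrable F1 -> square_integrable F2 ->
  uncorrelated_components F1 -> uncorrelated_components F2 ->
  same_sampling_distribution F1 F2 -> measurable E1 -> measurable E2 ->
  3 / 4 <= pr (canon F1) E1 -> 3 / 4 <= pr (canon F2) E2 -> 0 < e ->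
  exists w1 w2, [/\ E1 w1, E2 w2 & forall i j, (i < n)%N -> (j < n)%N ->
    `|dot (root i w1).1 (root j w1).1 - dot (root i w2).1 (root j w2).1| < e /\
    `|dot (root i w1).2 (root j w1).2 - dot (root i w2).2 (root j w2).2| < e].
Proof.
move=> g1 g2 q1 q2 u1 u2 same mE1 mE2 pE1 pE2 e0.
pose c := second_moment F1 + second_moment F2 + 1.
have s1 := second_moment_ge0 F1; have s2 := second_moment_ge0 F2.
have c0 : 0 < c by rewrite ltr_wpDl// addr_ge0.
have c1 : second_moment F1 <= c by rewrite /c -addrA lerDl addr_ge0.
have c2 : second_moment F2 <= c by rewrite /c addrAC lerDr addr_ge0.
have e20 : 0 < e / 2 by rewrite divr_gt0.
have h8 : 0 < 8^-1 :> R by rewrite invr_gt0.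
have [L1 hL1] := pr_gram_close_all n g1 q1 u1 c0 c1 e20 h8.
have [L2 hL2] := pr_gram_close_all n g2 q2 u2 c0 c2 e20 h8.
pose l := maxn L1 L2.
have [N1 hN1] := hL1 l (leq_maxl _ _); have [N2 hN2] := hL2 l (leq_maxr _ _).
pose N := maxn N1 N2.
have [B1 [mB1 pB1 hB1]] := hN1 N (leq_maxl _ _); have [B2 [mB2 pB2 hB2]] := hN2 N (leq_maxr _ _).
have half F (E B : set W) : measurable E -> measurable B -> 3 / 4 <= pr (canon F) E ->
    pr (canon F) B <= 8^-1 -> 2^-1 < pr (canon F) (E `\` B).
  move=> mE mB pE pB.
  have h : pr (canon F) E <= pr (canon F) (E `\` B) + pr (canon F) B.
    apply: le_trans (pr_setU_le _ (measurableD mE mB) mB); apply: pr_le => //.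
      by apply: measurableU => //; exact: measurableD.
    by move=> x Ex; have [Bx|nBx] := pselect (B x); [right|left].
  move: pE pB h; move: (pr _ _) (pr _ _) (pr _ _) => a b d; clear; lra.
have lt1 : 1 < pr (canon F1) (E1 `\` B1) + pr (canon F2) (E2 `\` B2).
  have hh : 2^-1 + 2^-1 = 1 :> R by rewrite [RHS]splitr !mul1r.
  have := ltrD (half _ _ _ mE1 mB1 pE1 pB1) (half _ _ _ mE2 mB2 pE2 pB2).
  by rewrite hh.
pose s := (n + N.+1 * maxn (size (pos_poly R l)) (size (neg_poly R l)))%N.
have [w1 [w2 [[Ew1 nBw1] [Ew2 nBw2] ag]]] :=
  common_agree s g1 g2 same (measurableD mE1 mB1) (measurableD mE2 mB2) lt1.
exists w1, w2; split => // i j ni nj.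
have [p1 m1] := hB1 w1 i j nBw1 ni nj; have [p2 m2] := hB2 w2 i j nBw2 ni nj.
have sp : (n + N.+1 * size (pos_poly R l) <= s.+1)%N.
  by apply/leqW; rewrite leq_add2l leq_mul2l leq_maxl orbT.
have sn : (n + N.+1 * size (neg_poly R l) <= s.+1)%N.
  by apply/leqW; rewrite leq_add2l leq_mul2l leq_maxr orbT.
rewrite (fpoly_agree c ni nj sp ag) distrC in p1.
rewrite (fpoly_agree c ni nj sn ag) distrC in m1.
by split; [exact: dist_half p1 p2|exact: dist_half m1 m2].
Qed.

End gram_coupling.

(** * Realizations with equal Gram matrices *)

Section dense_sequence.
Variable R : realType.

Definition ratvec (s : seq rat) : ell2 R := \sum_(i < size s) ratr s`_i *: basis_vec R i.

Lemma ratvec_dense (u : ell2 R) e : 0 < e -> exists s, `|u - ratvec s| < e.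
Proof.
move=> e0; have e20 : 0 < e / 2 by rewrite divr_gt0.
have [N hN] := cvg_limn_le e20 (@trunc_cvg R u); rewrite distrC in hN.
have d0 : 0 < e / 2 / N.+1%:R by rewrite divr_gt0.
have /choice[r hr] i : exists r : rat, `|u i - ratr r| < e / 2 / N.+1%:R.
  have /rat_in_itvoo[r] : u i - e / 2 / N.+1%:R < u i + e / 2 / N.+1%:R by rewrite ltrD2l gtrN.
  by rewrite in_itv/= => /andP[r1 r2]; exists r; rewrite distrC ltr_distl r1 r2.
exists (mkseq r N); rewrite -(subrKA (trunc N u)) [e]splitr; apply: le_lt_trans (ler_normD _ _) (ltrD hN _).
rewrite /trunc /ratvec size_mkseq -sumrB.
apply: (@le_lt_trans _ _ (\sum_(i < N) e / 2 / N.+1%:R)).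
  apply: le_trans (ler_norm_sum _ _ _) _; apply: ler_sum => i _.
  rewrite nth_mkseq// -scalerBl normrZ.
  have -> : `|basis_vec R i| = 1 by rewrite ell2_normE dot_basis/= eqxx sqrtr1.
  by rewrite mulr1 ltW.
rewrite sumr_const card_ord -[X in X < _]mulr_natl mulrA ltr_pdivrMr ?ltr0n// mulrC ltr_pM2l// ltr_nat.
exact: ltnSn.
Qed.

Definition dense_seq (n : nat) : krein R :=
  let st := odflt ([::], [::]) (unpickle n : option (seq rat * seq rat)) in
  (ratvec st.1, ratvec st.2).

Lemma dense_seqP (z : krein R) e : 0 < e -> exists n, `|z - dense_seq n| < e.
Proof.
move=> e0; have e20 : 0 < e / 2 by rewrite divr_gt0.
have [s hs] := ratvec_dense z.1 e20; have [t ht] := ratvec_dense z.2 e20.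
exists (pickle (s, t)); rewrite /dense_seq pickleK/=.
apply: le_lt_trans (krein_norm_le _) _; rewrite [e]splitr.
exact: ltrD.
Qed.

Definition in_balls (s : seq (nat * nat)) (z : krein R) : bool :=
  has (fun ab => `|z - dense_seq ab.1| <= ab.2.+1%:R^-1) s.

Lemma closed_ball_dense l r : closed [set z : krein R | `|z - dense_seq l| <= r].
Proof.
apply: (@closed_comp _ _ (fun z : krein R => `|z - dense_seq l|) [set x | x <= r]); last exact: closed_le.
move=> z _; apply: lipschitz1_continuous => x y.
apply: le_trans (ler_dist_dist _ _) _.
by rewrite opprB addrA subrK.
Qed.

Lemma closed_in_balls s : closed [set z | in_balls s z].
Proof.
elim: s => [|ab s ih].
  have -> : [set z | in_balls [::] z] = set0 by apply/seteqP; split.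
  exact: closed0.
rewrite (_ : mkset _ = [set z | `|z - dense_seq ab.1| <= ab.2.+1%:R^-1] `|` [set z | in_balls s z]).
  by apply: closedU => //; exact: closed_ball_dense.
apply/seteqP; split => z /=; first by rewrite /in_balls /= => /orP[]; [left|right].
by rewrite /in_balls /= => -[->//|->]; rewrite orbT.
Qed.

Lemma measurable_in_balls s : measurable ([set z | in_balls s z] : set (kreinB R)).
Proof. by apply: closed_measurable_kreinB; exact: closed_in_balls. Qed.

Definition balls (l : nat) : seq (nat * nat) := odflt [::] (unpickle l).

Lemma pr_nondecreasing d (T : measurableType d) (mu : probability T R) (B : nat -> set T) e :
  (forall n, measurable (B n)) -> (forall m n, (m <= n)%N -> B m `<=` B n) -> 0 < e ->
  exists n, pr mu (\bigcup_n B n) < pr mu (B n) + e.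
Proof.
move=> mB Bmono e0.
have mU : measurable (\bigcup_n B n) by exact: bigcup_measurable.
have cv : mu (B n) @[n --> \oo] --> mu (\bigcup_n B n).
  apply: nondecreasing_cvg_mu => //; move=> m n mn; exact/subsetPset/Bmono.
have {}cv : (fun n => pr mu (B n)) @ \oo --> pr mu (\bigcup_n B n).
  apply: (fine_cvg (f := fun n => mu (B n))).
  by rewrite fineK ?fin_num_measure.
have [n hn] := cvg_limn_le e0 cv; exists n.
by rewrite -ltrBlDl; apply: le_lt_trans hn; rewrite distrC ler_norm.
Qed.

(** An open set is the increasing union of finite unions of those balls of the countable family that
    it contains; continuity from below selects one of them. Each finite union has a code, read back
    by [balls]. *)
Lemma inner_balls (F : probability (kreinB R) R) (O : set (krein R)) e : open O -> 0 < e ->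
  exists l, [set z | in_balls (balls l) z] `<=` O /\
    pr F O < pr F [set z | in_balls (balls l) z] + e.
Proof.
move=> oO e0.
pose ok (ab : nat * nat) := `[< [set z | `|z - dense_seq ab.1| <= ab.2.+1%:R^-1] `<=` O >].
pose s n := [seq ab <- pmap unpickle (iota 0 n) | ok ab].
pose B n := [set z : krein R | in_balls (s n) z].
have BO n : B n `<=` O.
  by move=> z /hasP[ab]; rewrite mem_filter => /andP[/asboolP h _] zab; exact: h.
have Bmono m n : (m <= n)%N -> B m `<=` B n.
  move=> mn z /hasP[ab]; rewrite mem_filter => /andP[okab hab] zab.
  apply/hasP; exists ab => //; rewrite mem_filter okab/=.
  move: hab; rewrite !mem_pmap => /mapP[k kn ->]; apply: map_f.
  by move: kn; rewrite !mem_iota => /andP[_ kn]; apply: leq_trans kn mn.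
have [n hn] := pr_nondecreasing F (fun n => measurable_in_balls (s n)) Bmono e0.
exists (pickle (s n)); rewrite /balls pickleK/=; split; first exact: BO.
apply: le_lt_trans hn; apply: pr_le.
- exact: open_measurable_kreinB.
- by apply: bigcup_measurable => k _; exact: measurable_in_balls.
move=> z Oz.
have /nbhs_ballP[r r0 rO] : nbhs z O by exact: open_nbhs_nbhs.
have [b br] : exists b : nat, b.+1%:R^-1 * 2 < r.
  have r20 : 0 < r / 2 by rewrite divr_gt0.
  have [b hb] := cvg_limn_le r20 (@cvg_harmonic R).
  exists b; move: hb; rewrite subr0 ger0_norm ?invr_ge0// => hb.
  by rewrite -ltr_pdivlMr.
have b0 : 0 < b.+1%:R^-1 :> R by rewrite invr_gt0.
have [a za] := dense_seqP z b0.
have okab : ok (a, b).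
  apply/asboolP => y /= ya; apply: rO; rewrite -ball_normE/=.
  rewrite -(subrKA (dense_seq a)) ; apply: le_lt_trans (ler_normD _ _) _.
  apply: lt_trans br; rewrite mulr2n mulrDr mulr1.
  by have yz := ya; rewrite distrC in yz; exact: (ltr_leD za yz).
exists (pickle (a, b)).+1 => //; apply/hasP; exists (a, b); last by rewrite /= ltW.
rewrite mem_filter okab andTb mem_pmap; apply/mapP; exists (pickle (a, b)).
  by rewrite mem_iota add0n ltnSn.
by rewrite pickleK.
Qed.

(** The argument of Ulam: the balls of radius r around a dense sequence cover K, so finitely many of
    them carry almost all the mass. *)
Lemma tightness (F : probability (kreinB R) R) e r : 0 < e -> 0 < r ->
  exists L, pr F [set z | ~ exists2 l, (l < L)%N & `|z - dense_seq l| <= r] <= e.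
Proof.
move=> e0 r0.
pose B n := [set z : kreinB R | exists2 l, (l < n)%N & `|(z : krein R) - dense_seq l| <= r].
have mB n : measurable (B n).
  rewrite (_ : B n = \bigcup_(l < n) [set z : kreinB R | `|(z : krein R) - dense_seq l| <= r]).
    apply: bigcup_measurable => l _; apply: closed_measurable_kreinB; exact: closed_ball_dense.
  by apply/seteqP; split => z [l ln zl]; exists l.
have Bmono m n : (m <= n)%N -> B m `<=` B n.
  by move=> mn z [l lm zl]; exists l => //; exact: leq_trans lm mn.
have [n hn] := pr_nondecreasing F mB Bmono e0.
exists n; rewrite -[mkset _]/(~` B n) pr_setC//.
have BT : \bigcup_n B n = setT.
  apply/seteqP; split => // z _; have [l zl] := dense_seqP z r0.
  by exists l.+1 => //; exists l => //; exact: ltW.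
by rewrite BT pr_setT in hn; rewrite lerBlDl ltW.
Qed.

End dense_sequence.

Local Notation roots w := (fun i => root i w).

(** * Tight and equidistributed samples *)

Section good_event.
Context (R : realType) (F : probability (kreinB R) R).
Let W := (seqspace (kreinB R) * seqspace (seqspace (measurableTypeR R)))%type.
Local Notation P := (canon F).

(* Makes Chebyshev's bound for an accuracy of 2^-k summable over [l <= k]. *)
Definition sample_size (k : nat) : nat := (2 ^ (4 * k + 4))%N.

Definition freq k (C : set (krein R)) (z : nat -> krein R) : R :=
  (sample_size k).+1%:R^-1 * \sum_(i < (sample_size k).+1) \1_C (z i).

Definition tight (L : nat -> nat -> nat) (z : nat -> krein R) :=
  forall i k, exists2 l, (l < L i k)%N & `|z i - dense_seq R l| <= 2^-1 ^+ k.

(* Along the finite unions of closed balls, a countable family, only lower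
   bounds are kept: they pass to limits in [z]. *)
Definition equidistributed (z : nat -> krein R) := forall k l, (l <= k)%N ->
  pr F [set y | in_balls (balls l) y] - 2^-1 ^+ k <= freq k [set y | in_balls (balls l) y] z.

Lemma freq_concentration k (C : set (kreinB R)) (e : R) : measurable C -> 0 < e ->
  pr P [set w | freq k C (roots w) <= pr F C - e] <= ((sample_size k).+1%:R * e ^+ 2)^-1.
Proof.
move=> mC e0.
pose D i (w : W) : R := \1_C (root i w) - pr F C.
have mI i : measurable_fun setT (fun w : W => \1_C (root i w) : R).
  exact: (measurableT_comp (measurable_indic mC) (measurable_root i)).
have mD i : measurable_fun setT (D i) by exact: measurable_funB.
have p01 : 0 <= pr F C <= 1.
  by rewrite pr_ge0/= -lee_fin pr_EFin// probability_le1.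
have i01 i w : 0 <= (\1_C (root i w) : R) <= 1 by rewrite indicE; exact: natr_bool_itv.
have D1 i w : `|D i w| <= 1 by exact: itv01B.
have sI i : summable_fun P (fun w => \1_C (root i w)) by exact: summable_itv (mI i) (i01 i).
have sII i j : summable_fun P (fun w => \1_C (root i w) * \1_C (root j w)).
  apply: summable_itv; first exact: measurable_funM.
  by move=> w; exact: itv01M.
have mpre i : measurable (root i @^-1` C) := preimage_measurable (measurable_root i) mC.
have meanI i : mean P (fun w => \1_C (root i w)) = pr F C.
  transitivity (mean P (\1_(root i @^-1` C) : W -> R)); first exact: eq_mean.
  by rewrite mean_indic// /pr (iid_law (iid_root F)).
have meanII i j : (i < j)%N -> mean P (fun w => \1_C (root i w) * \1_C (root j w)) = pr F C ^+ 2.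
  move=> ij; transitivity (mean P (\1_(root i @^-1` C `&` root j @^-1` C) : W -> R)).
    apply: eq_mean => w; rewrite indicI; congr (_ * _).
  rewrite mean_indic; last exact: measurableI.
  apply: EFin_inj; rewrite pr_EFin; last exact: measurableI.
  rewrite (iid_pair (iid_root F))// ?ltn_eqF// expr2 EFinM.
  by rewrite pr_EFin.
have D0 i j : (i < j)%N -> mean P (fun w => D i w * D j w) = 0.
  move=> ij.
  rewrite (eq_mean P (g := fun w => (\1_C (root i w) * \1_C (root j w) + pr F C ^+ 2) -
     (pr F C * \1_C (root i w) + pr F C * \1_C (root j w)))); last first.
    by move=> w; rewrite /D; ring.
  have s1 := sII i j; have s2 := summable_cst P (pr F C ^+ 2).
  have s3 := summableZ (pr F C) (sI i); have s4 := summableZ (pr F C) (sI j).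
  rewrite (meanB (summableD s1 s2) (summableD s3 s4)) (meanD s1 s2) (meanD s3 s4).
  by rewrite meanII// mean_cst !meanZ// !meanI expr2; ring.
apply: le_trans (chebyshev_average (sample_size k) mD D1 D0 e0).
have n0 : (sample_size k).+1%:R != 0 :> R by rewrite pnatr_eq0.
have DE w : (sample_size k).+1%:R^-1 * \sum_(i < (sample_size k).+1) D i w =
    freq k C (roots w) - pr F C.
  rewrite /D sumrB mulrBr /freq; congr (_ - _).
  by rewrite sumr_const card_ord -[X in _ * X]mulr_natl mulKf.
have mf : measurable_fun setT (fun w : W => freq k C (roots w)).
  by apply: measurable_funM; [exact: measurable_cst|apply: measurable_sum => i; exact: mI].
apply: pr_le.
- exact: measurable_le_cst.
- apply: measurable_norm_ge; apply: measurable_funM; first exact: measurable_cst.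
  exact: measurable_sum.
move=> w /= h; rewrite DE distrC; apply: le_trans (ler_norm _).
by rewrite lerBrDr addrC -lerBrDr.
Qed.

(** The factor k + 1 counts the sets l <= k and is at most 2^k, the accuracy contributes 4^k, and
    the sample size exceeds 16^(k + 1). *)
Lemma equidistributed_bound k :
  (k.+1)%:R * ((sample_size k).+1%:R * (2^-1 ^+ k) ^+ 2)^-1 <= 16^-1 * 2^-1 ^+ k :> R.
Proof.
have k2 : (k.+1 <= 2 ^ k)%N by exact: ltn_expl.
have a0 : 0 < 2^-1 ^+ k :> R by rewrite exprn_gt0 ?invr_gt0.
have A : 2 ^+ k * 2^-1 ^+ k = 1 :> R by rewrite -exprMn mulfV// expr1n.
rewrite ler_pdivrMr; last by rewrite mulr_gt0 ?ltr0n// exprn_gt0.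
have s : 16 * (2 ^+ k) ^+ 4 <= (sample_size k).+1%:R :> R.
  rewrite -exprM mulnC (_ : 16 = 2 ^+ 4) -?exprD; last by rewrite -natrX.
  by rewrite addnC -natrX ler_nat leqnSn.
have h : k.+1%:R <= 2 ^+ k :> R by rewrite -natrX ler_nat.
apply: le_trans h _.
apply: le_trans (_ : 16^-1 * 2^-1 ^+ k * (16 * (2 ^+ k) ^+ 4 * (2^-1 ^+ k) ^+ 2) <= _); last first.
  by rewrite ler_wpM2l ?mulr_ge0 ?invr_ge0// ?exprn_ge0 ?invr_ge0// ler_wpM2r// sqr_ge0.
move: A; move: (2 ^+ k) (2^-1 ^+ k) => a b ab.
have -> : 16^-1 * b * (16 * a ^+ 4 * b ^+ 2) = (16^-1 * 16) * (a * b) ^+ 3 * a by ring.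
by rewrite ab expr1n mulVf// !mul1r.
Qed.

Lemma good_event : exists (E : set W) (L : nat -> nat -> nat),
  [/\ measurable E, 3 / 4 <= pr P E &
    forall w, E w -> tight L (roots w) /\ equidistributed (roots w)].
Proof.
(* Each of the two families of bad events has total probability at most 2/16 = 1/8, so that 3/4
   remains. *)
have i16 : 0 < 16^-1 :> R by rewrite invr_gt0.
have half0 k : 0 < 2^-1 ^+ k :> R by rewrite exprn_gt0 ?invr_gt0.
have /choice[M hM] p : exists M, pr F [set z | ~ exists2 l, (l < M)%N &
    `|z - dense_seq R l| <= 2^-1 ^+ (odflt (0, 0)%N (unpickle p)).2] <= 16^-1 * 2^-1 ^+ p.
  by apply: tightness => //; exact: mulr_gt0.
pose T p := [set z : kreinB R | ~ exists2 l, (l < M p)%N &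
    `|(z : krein R) - dense_seq R l| <= 2^-1 ^+ (odflt (0, 0)%N (unpickle p)).2].
have mT p : measurable (T p).
  rewrite (_ : T p = ~` \bigcup_(l < M p) [set z : kreinB R |
      `|(z : krein R) - dense_seq R l| <= 2^-1 ^+ (odflt (0, 0)%N (unpickle p)).2]).
    apply: measurableC; apply: bigcup_measurable => l _.
    by apply: closed_measurable_kreinB; exact: closed_ball_dense.
  by apply/seteqP; split => z h [l ln zl]; apply: h; exists l.
pose B1 p : set W := root (odflt (0, 0)%N (unpickle p)).1 @^-1` T p.
have mB1 p : measurable (B1 p) := preimage_measurable (measurable_root _) (mT p).
have pB1 p : pr P (B1 p) <= 16^-1 * 2^-1 ^+ p.
  by rewrite /pr (iid_law (iid_root F))//; exact: hM.
pose C l := [set y : kreinB R | in_balls (balls l) (y : krein R)].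
have mC l : measurable (C l) by exact: measurable_in_balls.
pose B2' k l : set W := [set w | freq k (C l) (roots w) <= pr F (C l) - 2^-1 ^+ k].
have mB2' k l : measurable (B2' k l).
  apply: measurable_le_cst; apply: measurable_funM; first exact: measurable_cst.
  apply: measurable_sum => i.
  exact: (measurableT_comp (measurable_indic (mC l)) (measurable_root i)).
pose B2 k := \bigcup_(l < k.+1) B2' k l.
have pB2 k : measurable (B2 k) /\ pr P (B2 k) <= 16^-1 * 2^-1 ^+ k.
  have [m p] := pr_bigcup_fin_le (mB2' k) (fun l (_ : (l < k.+1)%N) =>
    freq_concentration k (mC l) (half0 k)).
  by split => //; apply: le_trans p (equidistributed_bound k).
have mU1 : measurable (\bigcup_p B1 p) by exact: bigcup_measurable.
have mU2 : measurable (\bigcup_k B2 k).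
  by apply: bigcup_measurable => k _; have [] := pB2 k.
have pU1 := pr_bigcup_le mB1 pB1.
have pU2 := pr_bigcup_le (fun k => (pB2 k).1) (fun k => (pB2 k).2).
exists (~` (\bigcup_p B1 p `|` \bigcup_k B2 k)), (fun i k => M (pickle (i, k))); split.
- by apply: measurableC; exact: measurableU.
- rewrite pr_setC; last exact: measurableU.
  have := le_trans (pr_setU_le P mU1 mU2) (lerD pU1 pU2).
  by move: (pr _ _) => x; clear; lra.
move=> w nw; split.
  move=> i k; apply: contrapT => h; apply: nw; left; exists (pickle (i, k)) => //.
  by rewrite /B1 /T pickleK.
move=> k l lk; rewrite leNgt; apply/negP => h; apply: nw; right; exists k => //.
by exists l => //; exact: ltW.
Qed.

End good_event.

(** * Limits of samples along an ultrafilter *)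

Section ultralimits.
Variable R : realType.

Lemma ultra_bigcup T (U : set_system T) (A : nat -> set T) n : UltraFilter U ->
  U (\bigcup_(l < n) A l) -> exists2 l, (l < n)%N & U (A l).
Proof.
move=> UU; have PU := @ultra_proper _ _ UU; elim: n => [|n ih].
  by rewrite bigcup_mkord big_ord0 => /filter_ex[].
rewrite bigcup_mkord big_ord_recr/= -bigcup_mkord => h.
have [An|nAn] := in_ultra_setVsetC (A n) UU; first by exists n.
have [|l ln Al] := ih.
  by apply: filterS (filterI h nAn) => x [[]].
by exists l => //; exact: ltnW.
Qed.

(** At each radius finitely many balls cover all the values, and the ultrafilter selects one of
    them; the image filter is therefore Cauchy in both components. *)
Lemma tight_ultra_cvg (U : set_system nat) L (s : nat -> nat -> krein R) i :
  UltraFilter U -> (forall n, tight L (s n)) -> exists z : krein R, (fun n => s n i) @ U --> z.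
Proof.
move=> UU ts; have PU := @ultra_proper _ _ UU.
have near e : 0 < e -> exists x, U [set n | `|s n i - x| <= e].
  move=> e0.
  have [k hk] : exists k, (2^-1 : R) ^+ k < e.
    have half1 : `|2^-1 : R| < 1 by rewrite gtr0_norm ?invr_gt0// invf_lt1// ltr1n.
    have [k hk] := cvg_limn_le e0 (cvg_expr half1); exists k.
    by move: hk; rewrite subr0; apply: le_lt_trans; exact: ler_norm.
  have hU : U (\bigcup_(l < L i k) [set n | `|s n i - dense_seq R l| <= 2^-1 ^+ k]).
    apply: filterS filterT => n _.
    by have [l lL sl] := ts n i k; exists l.
  have [l _ Ul] := ultra_bigcup UU hU.
  exists (dense_seq R l); apply: filterS Ul => n /= h.
  exact: le_trans h (ltW hk).
have [x1 h1] : exists x : ell2 R, (fun n => (s n i).1) @ U --> x.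
  apply: ell2_cauchy_cvg => e /near[x hx]; exists x.1.
  rewrite /nbhs/= /fmap/=; apply: filterS hx => n /= h; rewrite distrC -krein_fstB.
  exact: le_trans (krein_norm1_le _) h.
have [x2 h2] : exists x : ell2 R, (fun n => (s n i).2) @ U --> x.
  apply: ell2_cauchy_cvg => e /near[x hx]; exists x.2.
  rewrite /nbhs/= /fmap/=; apply: filterS hx => n /= h; rewrite distrC -krein_sndB.
  exact: le_trans (krein_norm2_le _) h.
by exists (x1, x2); apply/cvg_krein.
Qed.

Lemma freq_le k (C D : set (krein R)) z z' :
  (forall i, (i < (sample_size k).+1)%N -> \1_C (z i) <= \1_D (z' i) :> R) ->
  freq k C z <= freq k D z'.
Proof.
move=> h; apply: ler_wpM2l; first by rewrite invr_ge0 ler0n.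
by apply: ler_sum => i _; exact: h (ltn_ord i).
Qed.

(** Indicators of closed sets can only jump up in the limit, and a frequency involves finitely many
    indices, so some single n satisfies all the required inequalities at once. *)
Lemma equidistributed_lim (F : probability (kreinB R) R) (U : set_system nat)
    (s : nat -> nat -> krein R) (z : nat -> krein R) : UltraFilter U ->
  (forall n, equidistributed F (s n)) -> (forall i, (fun n => s n i) @ U --> z i) ->
  equidistributed F z.
Proof.
move=> UU es sz k l lk; have PU := @ultra_proper _ _ UU.
set C := [set y : krein R | in_balls (balls l) y].
have h i : U [set n | \1_C (s n i) <= \1_C (z i) :> R].
  have [Cz|nCz] := pselect (C (z i)).
    apply: filterS filterT => n _ /=; rewrite [leRHS]indicE (mem_set Cz).
    by rewrite indicE; case: (_ \in _).
  have oC : open (~` C) by apply: closed_openC; exact: closed_in_balls.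
  have : nbhs (z i) (~` C) by exact: open_nbhs_nbhs.
  move=> /(sz i) hC; apply: (filterS _ (hC : U (fun n => (~` C) (s n i)))) => n nC /=.
  by rewrite indicE (memNset nC).
have [n hn] : exists n, forall i, (i < (sample_size k).+1)%N -> \1_C (s n i) <= \1_C (z i) :> R.
  suff : forall m, U [set n | forall i, (i < m)%N -> \1_C (s n i) <= \1_C (z i) :> R].
    by move=> /(_ (sample_size k).+1)/filter_ex.
  elim=> [|m ih]; first by apply: filterS filterT.
  apply: filterS (filterI ih (h m)) => n [h1 h2] i.
  by rewrite ltnS leq_eqVlt => /predU1P[->|]; [exact: h2|exact: h1].
exact: le_trans (es n k l lk) (freq_le hn).
Qed.

Lemma realization (F1 F2 : probability (kreinB R) R) :
  is_grd F1 -> is_grd F2 -> square_integrable F1 -> square_integrable F2 ->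
  uncorrelated_components F1 -> uncorrelated_components F2 ->
  same_sampling_distribution F1 F2 ->
  exists z1 z2 : nat -> krein R, [/\ equidistributed F1 z1, equidistributed F2 z2,
    forall i j, dot (z1 i).1 (z1 j).1 = dot (z2 i).1 (z2 j).1 &
    forall i j, dot (z1 i).2 (z1 j).2 = dot (z2 i).2 (z2 j).2].
Proof.
move=> g1 g2 q1 q2 u1 u2 same.
have [E1 [L1 [mE1 pE1 hE1]]] := good_event F1.
have [E2 [L2 [mE2 pE2 hE2]]] := good_event F2.
pose W := (seqspace (kreinB R) * seqspace (seqspace (measurableTypeR R)))%type.
have /choice[w hw] n : exists w : W * W, [/\ E1 w.1, E2 w.2 &
    forall i j, (i < n)%N -> (j < n)%N ->
    `|dot (root i w.1).1 (root j w.1).1 - dot (root i w.2).1 (root j w.2).1| < n.+1%:R^-1 /\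
    `|dot (root i w.1).2 (root j w.1).2 - dot (root i w.2).2 (root j w.2).2| < n.+1%:R^-1].
  have e0 : 0 < n.+1%:R^-1 :> R by rewrite invr_gt0.
  have [w1 [w2 [h1 h2 h]]] := gram_coupling n g1 g2 q1 q2 u1 u2 same mE1 mE2 pE1 pE2 e0.
  by exists (w1, w2).
have [U [UU sU]] := ultraFilterLemma (@eventually_filter).
have PU := @ultra_proper _ _ UU.
pose s1 n i : krein R := root i (w n).1.
pose s2 n i : krein R := root i (w n).2.
have E1n n : E1 (w n).1 by have [] := hw n.
have E2n n : E2 (w n).2 by have [] := hw n.
have /choice[z1 hz1] i : exists z : krein R, (fun n => s1 n i) @ U --> z.
  by apply: tight_ultra_cvg => n; exact: (hE1 _ (E1n n)).1.
have /choice[z2 hz2] i : exists z : krein R, (fun n => s2 n i) @ U --> z.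
  by apply: tight_ultra_cvg => n; exact: (hE2 _ (E2n n)).1.
have close (a b : nat -> R) (x y : R) i j : a @ U --> x -> b @ U --> y ->
    (forall n, (i < n)%N -> (j < n)%N -> `|a n - b n| < n.+1%:R^-1) -> x = y.
  move=> ax bx ab; apply/eqP; rewrite -subr_eq0; apply/eqP.
  have d1 : (fun n => a n - b n) @ U --> x - y by exact: cvgB.
  suff d0 : (fun n => a n - b n) @ U --> (0 : R) by exact: (cvg_unique _ d1 d0).
  apply/norm_cvg0P; apply: (@squeeze_cvgr _ _ _ _ (fun=> 0) (fun n => n.+1%:R^-1)).
  - apply: sU; exists (maxn i j).+1 => // n /=; rewrite gtn_max => /andP[ni nj].
    by rewrite normr_ge0/= ltW// ab.
  - exact: cvg_cst.
  - by move=> V /(@cvg_harmonic R) /sU.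
exists z1, z2; split.
- by apply: (equidistributed_lim UU _ hz1) => n; exact: (hE1 _ (E1n n)).2.
- by apply: (equidistributed_lim UU _ hz2) => n; exact: (hE2 _ (E2n n)).2.
- move=> i j; apply: (close _ _ _ _ i j).
  + apply: cvg_dot; first exact: ((cvg_krein _ _).1 (hz1 i)).1.
    exact: ((cvg_krein _ _).1 (hz1 j)).1.
  + apply: cvg_dot; first exact: ((cvg_krein _ _).1 (hz2 i)).1.
    exact: ((cvg_krein _ _).1 (hz2 j)).1.
  + by move=> n ni nj; have [_ _ /(_ i j ni nj)[]] := hw n.
- move=> i j; apply: (close _ _ _ _ i j).
  + apply: cvg_dot; first exact: ((cvg_krein _ _).1 (hz1 i)).2.
    exact: ((cvg_krein _ _).1 (hz1 j)).2.
  + apply: cvg_dot; first exact: ((cvg_krein _ _).1 (hz2 i)).2.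
    exact: ((cvg_krein _ _).1 (hz2 j)).2.
  + by move=> n ni nj; have [_ _ /(_ i j ni nj)[]] := hw n.
Qed.

Lemma equidistributed_open (F : probability (kreinB R) R) z (O : set (krein R)) (e : R) :
  equidistributed F z -> open O -> 0 < e ->
  exists k0, forall k, (k0 <= k)%N -> pr F O < freq k O z + e.
Proof.
move=> ez oO e0; have e20 : 0 < e / 2 by rewrite divr_gt0.
have [l [lO hl]] := inner_balls F oO e20.
have half1 : `|2^-1 : R| < 1 by rewrite gtr0_norm ?invr_gt0// invf_lt1// ltr1n.
have /cvgrPdist_lt /(_ _ e20)[k1 _ hk1] := cvg_expr half1.
exists (maxn l k1) => k; rewrite geq_max => /andP[lk k1k].
have h1 := ez k l lk.
have h2 : (2^-1 : R) ^+ k < e / 2.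
  by have := hk1 k k1k; rewrite /= sub0r normrN; apply: le_lt_trans; exact: ler_norm.
have h3 : freq k [set y | in_balls (balls l) y] z <= freq k O z.
  apply: freq_le => i _; rewrite !indicE; case: (boolP (_ \in [set y | _])) => [|_]; last by case: (_ \in O).
  by rewrite inE => /lO Oz; rewrite (mem_set Oz).
move: hl h1 h2 h3; move: (pr F _) (pr F _) (freq _ _ _) (freq _ _ _) (2^-1 ^+ k : R) => a b c d x.
by clear; move=> ? ? ? ?; lra.
Qed.

Lemma freq_setC k C z : freq k (~` C) z = 1 - freq k C z :> R.
Proof.
rewrite /freq -[X in X - _](@mulVf _ (sample_size k).+1%:R) ?pnatr_eq0// -mulrBr; congr (_ * _).
apply/eqP; rewrite eq_sym subr_eq -big_split/=; apply/eqP.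
transitivity (\sum_(i < (sample_size k).+1) (1 : R)); first by rewrite sumr_const card_ord.
apply: eq_bigr => i _.
by rewrite !indicE in_setC; case: (_ \in _); rewrite /= ?addr0 ?add0r.
Qed.

End ultralimits.

(** * Identification of the laws *)

Section portmanteau.
Variable R : realType.
Implicit Types (mu nu : probability (kreinB R) R) (z : nat -> krein R).

Definition lower_frequencies mu z := forall (O : set (krein R)) (e : R), open O -> 0 < e ->
  exists k0, forall k, (k0 <= k)%N -> pr mu O < freq k O z + e.

Definition thickening (C : set (krein R)) n : set (krein R) := \bigcup_(y in C) ball y n.+1%:R^-1.

Lemma open_thickening C n : open (thickening C n).
Proof.
by apply: bigcup_open => y _; apply: ball_open; rewrite invr_gt0.
Qed.

(** Lower bounds suffice for both directions. The thickening O of C and the complement O' of its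
    closure are disjoint open sets, so up to e/3 at each comparison mu C <= mu O <= freq O <= 1 -
    freq O' <= 1 - nu O' <= nu C; the last loss comes from O' increasing to cover the complement of
    C. *)
Lemma lower_frequencies_le mu nu z (C : set (krein R)) : lower_frequencies mu z ->
  lower_frequencies nu z -> closed C -> pr mu C <= pr nu C.
Proof.
move=> hmu hnu cC; apply/ler_addgt0Pr => e e0.
have e30 : 0 < e / 3 by rewrite divr_gt0.
pose O n := thickening C n.
pose O' n := ~` closure (O n).
have oO' n : open (O' n) by apply: closed_openC; exact: closed_closure.
have mO' n : measurable (O' n : set (kreinB R)) by exact: open_measurable_kreinB.
have mC : measurable (C : set (kreinB R)) by exact: closed_measurable_kreinB.
have O'mono m n : (m <= n)%N -> O' m `<=` O' n.
  move=> mn x; apply: contra_not; apply: closure_subset => w [y Cy yw]; exists y => //.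
  by apply: le_ball yw; rewrite lef_pV2 ?posrE ?ltr0n// ler_nat.
have O'C : ~` C `<=` \bigcup_n O' n.
  move=> x nCx; have /nbhs_ballP[r r0 rC] : nbhs x (~` C).
    by apply: open_nbhs_nbhs; split => //; exact: closed_openC.
  have r20 : 0 < r / 2 by rewrite divr_gt0.
  have [n hn] := cvg_limn_le r20 (@cvg_harmonic R).
  exists n => // xO; have [w [[y Cy yw] xw]] := xO _ (nbhsx_ballx x _ r20).
  have d : n.+1%:R^-1 < r / 2.
    by move: hn; rewrite subr0; apply: le_lt_trans; exact: ler_norm.
  suff bxy : ball x r y by exact: (rC y bxy Cy).
  move: xw yw; rewrite -!ball_normE/= => xw yw.
  rewrite -(subrKA w) [r]splitr; apply: le_lt_trans (ler_normD _ _) (ltrD xw _).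
  by rewrite distrC; exact: lt_trans yw d.
have [n hn] := pr_nondecreasing nu mO' O'mono e30.
have [k1 h1] := hmu _ _ (@open_thickening C n) e30.
have [k2 h2] := hnu _ _ (oO' n) e30.
have {}h1 := h1 _ (leq_maxl k1 k2); have {}h2 := h2 _ (leq_maxr k1 k2).
have h3 : freq (maxn k1 k2) (O' n) z <= 1 - freq (maxn k1 k2) (O n) z.
  rewrite -freq_setC; apply: freq_le => i _; rewrite !indicE.
  case: (boolP (_ \in O' n)) => [|_]; last by case: (_ \in ~` O n).
  rewrite inE => nO; rewrite mem_set// => Oz; apply: nO; exact: subset_closure.
have h4 : 1 - pr nu C <= pr nu (\bigcup_n O' n).
  rewrite -pr_setC//; apply: pr_le => //; first exact: measurableC.
  exact: bigcup_measurable.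
have h5 : pr mu C <= pr mu (O n).
  apply: pr_le => //; first by apply: open_measurable_kreinB; exact: open_thickening.
  by move=> y Cy; exists y => //; apply: ballxx; rewrite invr_gt0.
rewrite -/(O n) in h1; move: h1 h2 h3 h4 h5 hn.
move: (pr _ _) (pr _ _) (pr _ _) (pr _ _) (pr _ _) (freq _ _ _) (freq _ _ _) => a b c d f g h.
by clear; move=> ? ? ? ? ? ?; lra.
Qed.

Lemma lower_frequencies_unique mu nu z : lower_frequencies mu z -> lower_frequencies nu z ->
  forall B, measurable B -> mu B = nu B.
Proof.
move=> hmu hnu; apply: kreinB_measure_unique => [|C cC].
  exact: (le_lt_trans (probability_le1 mu measurableT) (ltry 1)).
have mC : measurable (C : set (kreinB R)) by exact: closed_measurable_kreinB.
apply: (etrans (esym (pr_EFin mu mC)) (etrans _ (pr_EFin nu mC))).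
congr (_%:E); apply/eqP; by rewrite eq_le !(lower_frequencies_le (z := z)).
Qed.

Lemma pr_carried d (T : measurableType d) (mu : probability T R) (D A B : set T) :
  measurable D -> measurable A -> measurable B -> mu D = 1%E ->
  (forall x, D x -> A x <-> B x) -> mu A = mu B.
Proof.
move=> mD mA mB D1 AB.
have D0 : pr mu (~` D) = 0 by rewrite pr_setC// /pr D1 subrr.
have half X Y : measurable X -> measurable Y -> (forall x, D x -> X x -> Y x) -> pr mu X <= pr mu Y.
  move=> mX mY XY; rewrite -[leRHS]addr0 -D0.
  apply: le_trans (pr_setU_le mu mY (measurableC mD)); apply: pr_le => //.
    by apply: measurableU => //; exact: measurableC.
  by move=> x Xx; have [Dx|nDx] := pselect (D x); [left; exact: XY|right].
rewrite -(pr_EFin mu mA) -(pr_EFin mu mB); congr (_%:E); apply/eqP; rewrite eq_le.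
by apply/andP; split; apply: half => // x Dx; have [] := AB x Dx.
Qed.

End portmanteau.

(** * The isometry carries one law to the other *)

Section carried.
Variable R : realType.

(** The backward direction recovers the law of Z from that of [T \o Z] through T', which undoes T on
    the carrier D. *)
Lemma pushforward_law_iff (F1 F2 : probability (kreinB R) R) (D : set (kreinB R))
    (T T' : kreinB R -> kreinB R) :
  measurable D -> F1 D = 1%E -> measurable_fun setT T -> measurable_fun setT T' ->
  (forall z, D z -> T' (T z) = z) ->
  (forall B, measurable B -> F2 B = F1 (T @^-1` B)) ->
  forall d (W : measurableType d) (Pr : probability W R) (Z : W -> kreinB R),
    measurable_fun setT Z -> Pr (Z @^-1` D) = 1%E ->
    has_law Pr Z F1 <-> has_law Pr (T \o Z) F2.
Proof.
move=> mD D1 mT mT' T'T F12 d W Pr Z mZ ZD.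
split=> [[_ law]|[_ law]].
  split; first exact: measurableT_comp.
  by move=> B mB; rewrite F12// -law//; exact: preimage_measurable.
split => // B mB.
have mT'B := preimage_measurable mT' mB.
transitivity (Pr ((T \o Z) @^-1` (T' @^-1` B))).
  apply: (pr_carried (D := Z @^-1` D)) => //.
  - exact: preimage_measurable.
  - exact: preimage_measurable.
  - exact: (preimage_measurable (measurableT_comp mT mZ)).
  - by move=> w Dw; rewrite /= T'T.
rewrite law// F12//; apply/esym; apply: (pr_carried (D := D)) => //.
  exact: (preimage_measurable mT).
by move=> z Dz; rewrite /= T'T.
Qed.

Lemma lower_frequencies_of_equidistributed (F : probability (kreinB R) R) z :
  equidistributed F z -> lower_frequencies F z.
Proof. by move=> ez O e oO e0; exact: equidistributed_open. Qed.

Lemma continuous_transform Dp Dp' Dn Dn' (Qp Qn : {linear ell2 R -> ell2 R}) :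
  orthogonal_on Dp Dp' Qp -> orthogonal_on Dn Dn' Qn ->
  continuous (transform Qp Qn : krein R -> krein R).
Proof.
move=> oQp oQn z; apply/(@cvg_krein R _ (nbhs z)); split => /=.
  apply: (@cvg_comp _ _ _ (fun z : krein R => z.1) Qp); first exact: continuous_krein_fst.
  exact: (orthogonal_on_continuous oQp).
apply: (@cvg_comp _ _ _ (fun z : krein R => z.2) Qn); first exact: continuous_krein_snd.
exact: (orthogonal_on_continuous oQn).
Qed.

Lemma same_sampling_ot_eq_carried (F1 F2 : probability (kreinB R) R) :
  is_grd F1 -> is_grd F2 -> square_integrable F1 -> square_integrable F2 ->
  uncorrelated_components F1 -> uncorrelated_components F2 ->
  same_sampling_distribution F1 F2 -> ot_eq_carried F1 F2.
Proof.
move=> g1 g2 q1 q2 u1 u2 same.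
have [z1 [z2 [ez1 ez2 Gp Gn]]] := realization g1 g2 q1 q2 u1 u2 same.
have [Qp [Qp' [oQp oQp' Qpz Qp'Qp _]]] := gram_isometry Gp.
have [Qn [Qn' [oQn oQn' Qnz Qn'Qn _]]] := gram_isometry Gn.
set Dp := cspan _ in oQp oQp' Qp'Qp; set Dp' := cspan _ in oQp oQp'.
set Dn := cspan _ in oQn oQn' Qn'Qn; set Dn' := cspan _ in oQn oQn'.
pose D : set (krein R) := Dp `*` Dn.
have cD : closed D by apply: closed_kreinX; [case: (cspan_closed (fun i => (z1 i).1))|case: (cspan_closed (fun i => (z1 i).2))].
have mD : measurable (D : set (kreinB R)) by exact: closed_measurable_kreinB.
have Dz i : D (z1 i).
  split; first exact: (cspan_gen (fun i => (z1 i).1)).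
  exact: (cspan_gen (fun i => (z1 i).2)).
have F1D : F1 D = 1%E.
  (* Every [z1 i] lies in D, so the open complement of D has frequency 0 along z1, and its
     probability is below every positive e. *)
  rewrite -(pr_EFin F1 mD); congr (_%:E); apply/eqP; rewrite eq_le; apply/andP; split.
    by rewrite -lee_fin pr_EFin// probability_le1.
  rewrite -subr_le0 -pr_setC//; apply/ler_addgt0Pr => e e0.
  have [k0 hk] := equidistributed_open ez1 (closed_openC cD) e0.
  have := hk k0 (leqnn _); rewrite (_ : freq k0 (~` D) z1 = 0); first by move/ltW.
  by rewrite /freq big1 ?mulr0// => i _; rewrite indicE memNset//= => /(_ (Dz i)).
have mT := measurable_transform oQp oQn; have mT' := measurable_transform oQp' oQn'.
have cT := continuous_transform oQp oQn.
pose TT : {mfun kreinB R >-> kreinB R} := HB.pack (transform Qp Qn) (isMeasurableFun.Build _ _ _ _ _ mT).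
pose nu : probability (kreinB R) R := distribution F1 TT.
(* The map sends z1 to z2 termwise, and preimages of open sets are open, so the image of F1 inherits
   its lower bounds along z2. A law is determined by such bounds, so the image is F2. *)
have hnu : lower_frequencies nu z2.
  move=> O e oO e0.
  have oTO : open (transform Qp Qn @^-1` O : set (krein R)).
    by move/continuousP : cT; exact.
  have [k0 hk] := equidistributed_open ez1 oTO e0; exists k0 => k /hk.
  rewrite (_ : freq k _ z1 = freq k O z2)//; congr (_ * _); apply: eq_bigr => i _.
  rewrite !indicE; congr (nat_of_bool _)%:R.
  have Tz : transform Qp Qn (z1 i) = z2 i by rewrite /transform Qpz Qnz; case: (z2 i).
  by apply/idP/idP; rewrite !inE /= Tz.
have F12 B : measurable B -> F2 B = F1 (transform Qp Qn @^-1` B).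
  move=> mB; exact: (lower_frequencies_unique (lower_frequencies_of_equidistributed ez2) hnu mB).
have T'T z : D z -> transform Qp' Qn' (transform Qp Qn z) = z.
  by case: z => x y [Dx Dy]; congr (_, _); [exact: Qp'Qp|exact: Qn'Qn].
exists Dp, Dp', Dn, Dn', Qp, Qn; split => //.
exact: (pushforward_law_iff mD F1D mT mT' T'T F12).
Qed.

End carried.

(** * Extension to orthogonal transforms of the whole space *)

Section full_measure.
Context d (T : measurableType d) (R : realType) (mu : probability T R).

Lemma full_ae (B : set T) : measurable B -> mu B = 1%E <-> {ae mu, forall x, B x}.
Proof.
by move=> mB; split=> [|/(pr_ae mB) h]; [exact: ae_full|rewrite -(pr_EFin mu mB) h].
Qed.

End full_measure.

Section extension.
Context (R : realType) (F1 F2 : probability (kreinB R) R) (p : kreinB R -> ell2 R).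
Hypothesis mp : coord_measurable p.
Variables (D D' : set (ell2 R)) (Q U : {linear ell2 R -> ell2 R}).
Implicit Types (u v w x y : ell2 R).

Let null (F : probability (kreinB R) R) : set (ell2 R) :=
  [set u | F [set z | dot u (p z) = 0] = 1%E].
Let N1 := null F1.
Let N2 := null F2.

Hypothesis oQ : orthogonal_on D D' Q.
Hypothesis oU : orthogonal_on N1 N2 U.
Hypothesis aeD : {ae F1, forall z, D (p z)}.
Hypothesis F12 : forall u, F2 [set z | dot u (p z) = 0] = F1 [set z | dot u (Q (p z)) = 0].

Let cD : closed_subspace D. Proof. by case: oQ. Qed.
Let cN1 : closed_subspace N1. Proof. by case: oU. Qed.
Let isoQ x y : D x -> D y -> dot (Q x) (Q y) = dot x y. Proof. by case: oQ => _ h _ _; exact: h. Qed.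

Lemma measurable_null u : measurable [set z : kreinB R | dot u (p z) = 0].
Proof.
apply: (preimage_measurable (f := fun z : kreinB R => dot u (p z)) (B := [set 0])) => //.
by apply: measurable_dot => //; exact: coord_measurable_cst.
Qed.

Let nullP F u : null F u <-> {ae F, forall z, dot u (p z) = 0}.
Proof. exact: (full_ae F (measurable_null u)). Qed.

Let cN2 : closed_subspace N2.
Proof.
split.
- move=> u uN; apply/nullP.
  have /choice[s hs] n : exists v, N2 v /\ `|u - v| < n.+1%:R^-1.
    have n0 : 0 < n.+1%:R^-1 :> R by rewrite invr_gt0.
    have [v [Nv uv]] := uN _ (nbhsx_ballx u _ n0).
    by exists v; split => //; move: uv; rewrite -ball_normE.
  have su : s @ \oo --> u.
    apply/cvg_distP; apply: (@squeeze_cvgr _ _ _ _ (fun=> 0) (fun n => n.+1%:R^-1)).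
    + by apply: nearW => n; rewrite normr_ge0 distrC ltW//; case: (hs n).
    + exact: cvg_cst.
    + exact: cvg_harmonic.
  have ae n : {ae F2, forall z, dot (s n) (p z) = 0} by apply/nullP; case: (hs n).
  apply: filterS (ae_foralln ae) => z hz.
  have c1 : (fun n => dot (s n) (p z)) @ \oo --> dot u (p z).
    by apply: cvg_dot => //; exact: cvg_cst.
  suff c0 : (fun n => dot (s n) (p z)) @ \oo --> (0 : R) by exact: (cvg_unique _ c1 c0).
  rewrite (_ : (fun n => dot _ _) = cst 0); first exact: cvg_cst.
  by apply/funext => n; exact: hz.
- by apply/nullP; apply: aeW => z; rewrite dot0l.
- move=> a u v /nullP Nu /nullP Nv; apply/nullP.
  by apply: filterS2 Nu Nv => z uz vz; rewrite dotP uz vz mulr0 addr0.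
Qed.

Let null1P u : N1 u <-> {ae F1, forall z, dot u (p z) = 0}.
Proof. exact: nullP. Qed.

Let in_D_of_orth x : (forall u, (forall y, D y -> dot u y = 0) -> dot x u = 0) -> D x.
Proof.
move=> h; suff -> : x = proj D x by exact: proj_in.
apply/eqP; rewrite -subr_eq0; apply/eqP/dot_eq0.
rewrite dotBl (h _ (fun y => proj_orth cD x (y := y))) [dot (proj D x) _]dotC.
by rewrite (proj_orth cD x (proj_in cD x)) subrr.
Qed.

Let orth_D_null u : (forall y, D y -> dot u y = 0) -> N1 u.
Proof. by move=> h; apply/null1P; apply: filterS aeD => z /h. Qed.

Let orth_null_D x : (forall u, N1 u -> dot x u = 0) -> D x.
Proof. by move=> h; apply: in_D_of_orth => u /orth_D_null/h. Qed.

(** The vector w is the adjoint of Q applied to v. It lies in D because Q vanishes on the orthogonal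
    complement, and it relates the null directions of F2 to those of F1. *)
Let adjoint v : exists w, [/\ forall x, dot v (Q x) = dot w x, D w & N2 v <-> N1 w].
Proof.
have [|u|w hw] := @riesz R (fun x => dot v (Q x)) `|v|.
- by move=> a x y; rewrite linearP dotDr dotZr.
- apply: le_trans (dot_norm_le _ _) _; rewrite ler_wpM2l//.
  exact: orthogonal_on_norm oQ.
exists w; split => //.
  apply: in_D_of_orth => u hu; rewrite -hw.
  by case: oQ => _ _ _ -> //; rewrite dot0r.
rewrite /N2 /N1 /null /= F12.
by rewrite (_ : [set z | dot v (Q (p z)) = 0] = [set z | dot w (p z) = 0])//; apply/seteqP; split => z /=; rewrite hw.
Qed.

Let Q_orth x : (forall u, N1 u -> dot x u = 0) -> forall v, N2 v -> dot (Q x) v = 0.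
Proof.
move=> h v N2v; have [w [hw _ [Nw _]]] := adjoint v.
by rewrite dotC hw dotC h//; exact: Nw.
Qed.

Let Q_null x : N1 x -> N2 (Q x).
Proof.
move=> /null1P N1x; rewrite /N2 /null/= F12; apply/full_ae.
  have [w [hw _ _]] := adjoint (Q x).
  rewrite (_ : mkset _ = [set z | dot w (p z) = 0]); first exact: measurable_null.
  by apply/seteqP; split => z /=; rewrite hw.
apply: filterS2 N1x aeD => z xz Dz /=.
by rewrite (orthogonal_onE x oQ) (isoQ (proj_in cD x) Dz) (proj_dot cD x Dz).
Qed.

(* The complement of [N1] lies in [D]: it is mapped by [Q], and [N1] by [U]. *)
Definition extend x := Q (x - proj N1 x) + U x.

Lemma extend_linear : linear extend.
Proof.
move=> a x y; have e : a *: x + y - (a *: proj N1 x + proj N1 y) =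
    a *: (x - proj N1 x) + (y - proj N1 y) by rewrite scalerBr opprD addrACA.
by rewrite /extend (projP cN1) e (linearP Q) (linearP U) scalerDr addrACA.
Qed.

Let U_in x : N2 (U x).
Proof.
rewrite (orthogonal_onE x oU); case: oU => _ _ <- _.
by exists (proj N1 x) => //; exact: proj_in.
Qed.

Let orth1 x u : N1 u -> dot (x - proj N1 x) u = 0.
Proof. exact: (proj_orth cN1). Qed.

Lemma extend_dot x y : dot (extend x) (extend y) = dot x y.
Proof.
have isoU u v : N1 u -> N1 v -> dot (U u) (U v) = dot u v by case: oU => _ h _ _; exact: h.
have QU a b : dot (Q (a - proj N1 a)) (U b) = 0 by apply: Q_orth (U_in b); exact: orth1.
rewrite /extend dotDl !dotDr QU addr0 (dotC (U x) (Q _)) QU add0r.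
have xD := orth_null_D (orth1 x); have yD := orth_null_D (orth1 y).
rewrite (isoQ xD yD) (orthogonal_onE x oU) (orthogonal_onE y oU).
rewrite (isoU _ _ (proj_in cN1 x) (proj_in cN1 y)).
have e1 := orth1 x (proj_in cN1 y); have e2 := orth1 y (proj_in cN1 x).
rewrite dotBr e1 subr0 dotBl; rewrite dotBl dotC in e2.
by move: e2; rewrite (dotC (proj N1 y)) ; move: (dot _ _) (dot _ _) (dot _ _) => a b c; lra.
Qed.

Lemma extend_surj y : exists x, extend x = y.
Proof.
have [b Nb Ub] : exists2 b, N1 b & U b = proj N2 y.
  have := proj_in cN2 y; case: oU => _ _ <- _ [b Nb Ub].
  by exists b.
pose c := y - proj N2 y.
have cN2' u : N2 u -> dot c u = 0 by exact: (proj_orth cN2).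
have [w [hw Dw _]] := adjoint c.
have wN1 u : N1 u -> dot w u = 0 by move=> N1u; rewrite -hw cN2'//; exact: Q_null.
have QwN := Q_orth wN1.
(* Since w is the adjoint image of c, this difference is orthogonal to the whole range of Q, hence
   null for F2. As c and Q w are both orthogonal to N2, it is also orthogonal to itself. *)
have cQw : N2 (c - Q w).
  rewrite /N2 /null/= F12 (_ : mkset _ = setT) ?probability_setT//.
  apply/seteqP; split => z // _ /=; rewrite dotBl hw (orthogonal_onE (p z) oQ).
  by rewrite (isoQ Dw (proj_in cD (p z))) [dot w (proj _ _)]dotC (proj_dot cD (p z) Dw) dotC subrr.
have e0 : c = Q w.
  apply/eqP; rewrite -subr_eq0; apply/eqP/dot_eq0.
  by rewrite {1}dotBl (cN2' _ cQw) (QwN _ cQw) subrr.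
exists (w + b); rewrite /extend.
have -> : proj N1 (w + b) = b.
  by apply: (proj_unique cN1) => // u Nu; rewrite addrK wN1.
rewrite addrK -e0 linearD/= (_ : U w = 0) ?add0r ?Ub ?subrK//.
by case: oU => _ _ _; apply.
Qed.

(** The projections of the basis vectors to N1 are countably many null directions, so almost every p
    z is orthogonal to all of N1, and there only the Q part of the extension acts. *)
Lemma extend_ae : {ae F1, forall z, extend (p z) = Q (p z)}.
Proof.
have ae_j j : {ae F1, forall z, dot (proj N1 (basis_vec R j)) (p z) = 0}.
  by apply/null1P; exact: proj_in.
apply: filterS (ae_foralln ae_j) => z hz.
have p0 : proj N1 (p z) = 0.
  apply: ell2_eqP => j; rewrite -dot_basis (proj_self_adjoint cN1) dotC hz.
  by [].
rewrite /extend p0 subr0 (orthogonal_onE (p z) oU) p0 linear0.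
exact: addr0.
Qed.

End extension.

Section conclusion.
Variable R : realType.
Implicit Types F : probability (kreinB R) R.

Lemma ot_eq_same_sampling F1 F2 : is_grd F1 -> ot_eq F1 F2 -> same_sampling_distribution F1 F2.
Proof.
move=> g1 [Qp [Qn [oQp oQn h]]]; apply: ot_eq_carried_same_sampling => //.
exists setT, setT, setT, setT, Qp, Qn; split.
- exact: orthogonal_setT.
- exact: orthogonal_setT.
- by rewrite setXTT; exact: probability_setT.
- by move=> d W Pr Z mZ _; exact: h.
Qed.

Lemma orthogonal_inverse (Q : {linear ell2 R -> ell2 R}) : Defs.orthogonal Q ->
  exists Q' : {linear ell2 R -> ell2 R}, Defs.orthogonal Q' /\ forall x, Q' (Q x) = x.
Proof.
move=> [iso sur].
have inj x y : Q x = Q y -> x = y.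
  by move=> e; apply: dot_eqP => z; rewrite -(iso x z) -(iso y z) e.
have /choice[g gK] := sur.
have glin : linear g.
  by move=> a x y; apply: inj; rewrite (linearP Q) !gK.
pose Q' : {linear ell2 R -> ell2 R} :=
  HB.pack g (GRing.isLinear.Build R (ell2 R) (ell2 R) *:%R g glin).
have Q'Q x : Q' (Q x) = x by apply: inj; rewrite /= gK.
exists Q'; split => //; split; last by move=> y; exists (Q y).
by move=> x y; rewrite -iso /= !gK.
Qed.

(** The extensions agree almost surely under F1 with the carried maps, so they too send F1 to F2.
    Being invertible on the whole space, they give the equivalence for every random vector, with
    carrier [setT]. *)
Lemma ot_eq_carried_ot_eq F1 F2 : same_codimension F1 F2 -> ot_eq_carried F1 F2 -> ot_eq F1 F2.
Proof.
move=> [[Up oUp] [Un oUn]] [Dp [Dp' [Dn [Dn' [Qp [Qn [oQp oQn F1D h]]]]]]].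
have [cDp _ _ _] := oQp; have [cDn _ _ _] := oQn.
have mT := measurable_transform oQp oQn.
have mD : measurable (Dp `*` Dn : set (kreinB R)).
  by apply: closed_measurable_kreinB; apply: closed_kreinX; [case: cDp|case: cDn].
have F12 := law_iff_pushforward h F1D.
have aeD : {ae F1, forall z, (Dp `*` Dn : set (kreinB R)) z} by exact: ae_full.
have [N [mN N0 hN]] := aeD.
have aeDp : {ae F1, forall z : kreinB R, Dp z.1}.
  by exists N; split => // z nz; apply: hN => -[].
have aeDn : {ae F1, forall z : kreinB R, Dn z.2}.
  by exists N; split => // z nz; apply: hN => -[].
have mfst : coord_measurable (fst : kreinB R -> ell2 R) by exact: coord_measurable_fst.
have msnd : coord_measurable (snd : kreinB R -> ell2 R) by exact: coord_measurable_snd.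
have Fp u : F2 [set z | dot u z.1 = 0] = F1 [set z | dot u (Qp z.1) = 0].
  by rewrite F12//; exact: (measurable_null mfst).
have Fn u : F2 [set z | dot u z.2 = 0] = F1 [set z | dot u (Qn z.2) = 0].
  by rewrite F12//; exact: (measurable_null msnd).
have linp : linear (extend F1 fst Qp Up) by exact: (extend_linear _ oUp).
have linn : linear (extend F1 snd Qn Un) by exact: (extend_linear _ oUn).
pose Ep : {linear ell2 R -> ell2 R} := HB.pack (extend F1 fst Qp Up)
  (GRing.isLinear.Build R (ell2 R) (ell2 R) *:%R _ linp).
pose En : {linear ell2 R -> ell2 R} := HB.pack (extend F1 snd Qn Un)
  (GRing.isLinear.Build R (ell2 R) (ell2 R) *:%R _ linn).
have oEp : Defs.orthogonal Ep.
  by split; [exact: (extend_dot mfst oQp oUp aeDp Fp)|exact: (extend_surj mfst oQp oUp aeDp Fp)].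
have oEn : Defs.orthogonal En.
  by split; [exact: (extend_dot msnd oQn oUn aeDn Fn)|exact: (extend_surj msnd oQn oUn aeDn Fn)].
exists Ep, En; split => //.
have [Ep' [oEp' Ep'E]] := orthogonal_inverse oEp.
have [En' [oEn' En'E]] := orthogonal_inverse oEn.
have mE := measurable_transform (orthogonal_setT oEp) (orthogonal_setT oEn).
have mE' := measurable_transform (orthogonal_setT oEp') (orthogonal_setT oEn').
have E12 B : measurable B -> F2 B = F1 (transform Ep En @^-1` B).
  move=> mB; rewrite F12//.
  have [M1 [mM1 M10 hM1]] := @extend_ae _ _ _ fst mfst Qp _ oUp.
  have [M2 [mM2 M20 hM2]] := @extend_ae _ _ _ snd msnd Qn _ oUn.
  have mM : measurable (M1 `|` M2) by exact: measurableU.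
  have M0 : F1 (M1 `|` M2) = 0%E.
    have e1 : F1 M1 = 0%E by exact: M10.
    have e2 : F1 M2 = 0%E by exact: M20.
    apply/eqP; rewrite eq_le measure_ge0 andbT.
    apply: (@le_trans _ _ (F1 M1 + F1 M2)%E); first exact: measureU2.
    by rewrite e1 e2 adde0.
  apply: (pr_carried (D := ~` (M1 `|` M2))) => //.
  - exact: measurableC.
  - exact: preimage_measurable.
  - exact: preimage_measurable.
  - by transitivity (1 - F1 (M1 `|` M2))%E; [exact: probability_setC|rewrite M0 sube0].
  - move=> z nM.
    have e1 : extend F1 fst Qp Up z.1 = Qp z.1.
      by apply: contrapT => ne; apply: nM; left; exact: hM1.
    have e2 : extend F1 snd Qn Un z.2 = Qn z.2.
      by apply: contrapT => ne; apply: nM; right; exact: hM2.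
    have eT : transform Ep En z = transform Qp Qn z by congr (_, _).
    by rewrite -[_ z <-> _]/(B (transform Qp Qn z) <-> B (transform Ep En z)) eT.
move=> d W Pr Z mZ.
apply: (pushforward_law_iff (D := setT) measurableT _ mE mE' _ E12) => //.
- exact: probability_setT.
- by move=> [x y] _; congr (_, _); [exact: Ep'E|exact: En'E].
- by rewrite preimage_setT; exact: probability_setT.
Qed.

End conclusion.

Theorem theorem3p4 (R : realType) (F1 F2 : probability (kreinB R) R)
  (grd1 : is_grd F1) (grd2 : is_grd F2)
  (sq1 : square_integrable F1) (sq2 : square_integrable F2)
  (unc1 : uncorrelated_components F1) (unc2 : uncorrelated_components F2) :
  (same_sampling_distribution F1 F2 <-> ot_eq_carried F1 F2) /\
  (same_codimension F1 F2 ->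
     (same_sampling_distribution F1 F2 <-> ot_eq F1 F2)).
Proof.
have carried := same_sampling_ot_eq_carried grd1 grd2 sq1 sq2 unc1 unc2.
split; first by split => //; exact: ot_eq_carried_same_sampling.
move=> cod; split; last exact: ot_eq_same_sampling.
by move=> /carried; exact: ot_eq_carried_ot_eq.
Qed.
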